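(* Let $(L_n)$ be a sequence of positive integers and $(p_n)$ a sequence in $[0,1]$ such that $L_n\to\infty$ and $p_n\to 0$ as $n\to\infty$, and let $\lambda=\pi^2/18$. Then: (i) if $\liminf_{n\to\infty} p_n\log L_n>\lambda$ then $\lim_{n\to\infty} I(L_n,p_n)=1$; (ii) if $\limsup_{n\to\infty} p_n\log L_n<\lambda$ then $\lim_{n\to\infty} I(L_n,p_n)=0$.
   Context: Bootstrap percolation on $\mathbb{Z}^2$. For a site $x\in\mathbb{Z}^2$ let $N(x)=\{y\in\mathbb{Z}^2:\|x-y\|=1\}$ (Euclidean norm), the set of its four nearest neighbours. For $K\subseteq\mathbb{Z}^2$ let $\mathcal{B}(K)=K\cup\{x\in\mathbb{Z}^2:|N(x)\cap K|\ge 2\}$ and $\langle K\rangle=\lim_{t\to\infty}\mathcal{B}^t(K)=\bigcup_{t\ge 0}\mathcal{B}^t(K)$, where $\mathcal{B}^t$ is the $t$-th iterate. For $p\in[0,1]$, let $X\subseteq\mathbb{Z}^2$ be the random set in which each site is included independently with probability $p$, and let $P_p$ denote the corresponding product probability measure. A set $K\subseteq\mathbb{Z}^2$ is internally spanned if $\langle X\cap K\rangle=K$. For a positive integer $L$ let $R(L,L)=\{1,\dots,L\}\times\{1,\dots,L\}$ and $I(L,p)=P_p(R(L,L)\text{ is internally spanned})$. *)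

(* Defs.v *)
From HB Require Import structures.
From mathcomp Require Import all_boot all_order all_algebra.
From mathcomp Require Import all_classical all_reals all_analysis.

Set Implicit Arguments.
Unset Strict Implicit.
Unset Printing Implicit Defensive.

Import Order.TTheory GRing.Theory Num.Theory.
Import numFieldNormedType.Exports.

Local Open Scope classical_set_scope.
Local Open Scope ring_scope.

Definition site : Type := (int * int)%type.

(* The Euclidean condition |x - y| = 1, squared so as to stay in int. *)
Definition neighbours (x : site) : set site :=
  [set y | (x.1 - y.1) ^+ 2 + (x.2 - y.2) ^+ 2 = 1].

(* [`I_2 #<= A] says that A has at least two elements. *)
Definition bootstrap_step (K : set site) : set site :=
  K `|` [set x | (`I_2 #<= neighbours x `&` K)%card].

Definition bootstrap_closure (K : set site) : set site :=
  \bigcup_(t in [set: nat]) iter t bootstrap_step K.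

Definition internally_spanned (X K : set site) : Prop :=
  bootstrap_closure (X `&` K) = K.

Definition square (L : nat) : set site :=
  [set x | (1 <= x.1 <= L%:Z) /\ (1 <= x.2 <= L%:Z)].

Definition independent_events (R : realType) (d : measure_display)
    (T : measurableType d) (P : probability T R) (I : choiceType)
    (E : I -> set T) : Prop :=
  forall s : seq I, uniq s ->
    P (\bigcap_(i in [set` s]) E i) = (\prod_(i <- s) P (E i))%E.

(* The random set X contains each site independently with probability p
   under P. This determines the law of X, namely the product measure with
   density p on the cylinder sigma-algebra of subsets of Z^2. *)
Definition bernoulli_set (R : realType) (d : measure_display)
    (T : measurableType d) (P : probability T R) (X : T -> set site) (p : R)
    : Prop :=
  [/\ forall x : site, measurable [set w | X w x],
      forall x : site, P [set w | X w x] = p%:E &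
      independent_events P (fun x : int * int => [set w | X w x])].

(* The event depends only on the finitely many events [set w | X w x] with x in
   the square, so it is measurable as soon as they are. *)
Definition spanning_probability (R : realType) (d : measure_display)
    (T : measurableType d) (P : probability T R) (X : T -> set site) (L : nat)
    : \bar R :=
  P [set w | internally_spanned (X w) (square L)].

(* Main.v *)
Require Import Defs.
From HB Require Import structures.
From mathcomp Require Import all_boot all_order all_algebra.
From mathcomp Require Import all_classical all_reals all_analysis.
From mathcomp Require Import zify ring lra.
Set Implicit Arguments. Unset Strict Implicit. Unset Printing Implicit Defensive.
Import Order.TTheory GRing.Theory Num.Theory.
Import numFieldNormedType.Exports.
Local Open Scope classical_set_scope.
Local Open Scope ring_scope.

(* Let [beta u] be the positive root of b^2 = u b + u (1 - u) and
   g(z) = - ln (beta (1 - exp (- z))), the [cost] below. Up to constants,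
   exp (- m g(h p)) is the probability that no two consecutive ones among m
   adjacent columns of height h are empty. The integral of g over the positive
   reals is lambda = pi^2 / 18: the ratio of exp (- g(z)) to exp (- z)
   parametrizes the graph of g rationally, which yields dilogarithms, and g is
   an involution.

   (i) A square grows from a site to side M ~ 3 ln L / p, both sides at once,
   with probability at least exp (- (2 lambda + e) / p). With high probability
   one of the disjoint M x M squares in the L x L square is spanned, and no
   segment of length M is empty, so that this square fills everything.

   (ii) A spanned L x L square contains a spanned rectangle whose longer side is
   of order 1 / p (Aizenman--Lebowitz). Let V(w, h) be the least cost of a path
   of rectangles growing to size w x h, a column of height b costing about
   g(b p). By induction on the semi-perimeter, a w x h rectangle R is spanned
   with probability at most exp (- V(w, h)), with some room: either R contains a
   spanned rectangle S that is smaller by between T and 2 T, or it contains an S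
   of nearly full size generated by two disjointly spanned smaller rectangles,
   and the van den Berg--Kesten inequality applies; in both cases the strips of
   R outside S contain no two consecutive empty lines. Since g is convex, the
   diagonal path is optimal and V(n, n) is about 2 lambda / p for n >> 1 / p,
   which beats the L^2 positions of the rectangle. *)

(** * Stable sets and rectangles *)

(** A square of side k gains a column and a row at cost [2 g(k p)], whence the [2 lambda]; against
    [L ^ 2 = exp (2 ln L)] positions this balances at [p ln L = lambda]. The obstacle in (ii) is
    entropy. A descent by a few lines at a time would pay for the choice of the next rectangle at
    every step, more than a small gain per line affords. With T a small multiple of [1 / p],
    polynomially many choices face a gain exponential in T. In return, the rows and columns of a
    thick frame share its corners; these are conditioned on and then averaged. Mergers may occur at
    any point of the induction, so the bound carries a factor A, which a merger squares: small
    enough to beat the choice of three rectangles, large enough for thin rectangles, whose crossing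
    has a surplus exponential in T. Probabilities are sums over the subsets of a finite list of
    sites, and the probability space enters once, through [transfer]. The integral of g is not
    formed either: increments of an explicit primitive are compared with Riemann sums. *)

Definition stable (K : set site) : Prop :=
  forall x y z : site, neighbours x y -> neighbours x z -> y <> z ->
    K y -> K z -> K x.

Lemma card_ge2P (T : Type) (A : set T) :
  (`I_2 #<= A)%card <-> exists y z, [/\ A y, A z & y <> z].
Proof.
split.
  move=> /card_leP[f].
  have h0 : (0%N : nat) \in `I_2 by rewrite inE.
  have h1 : (1%N : nat) \in `I_2 by rewrite inE.
  exists (val (f (SigSub h0))), (val (f (SigSub h1))); split.
  - exact: set_valP.
  - exact: set_valP.
  - move=> /val_inj e; have : SigSub h0 = SigSub h1.
      by apply: (@inj _ _ setT f) e; rewrite inE.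
    by move=> /(congr1 val).
move=> [y [z [Ay Az yz]]].
pose f (n : nat) := if n == 0%N then y else z.
have fi : {in `I_2 &, injective f}.
  move=> m n; rewrite !inE /= /f.
  by case: m => [|[|m]] //=; case: n => [|[|n]] //= _ _ e; case: yz.
rewrite -(card_le_eql (inj_card_eq fi)); apply: subset_card_le.
by move=> _ [n _ <-]; rewrite /f; case: ifP.
Qed.

Lemma step_ext (K : set site) : K `<=` bootstrap_step K.
Proof. by move=> x; left. Qed.

Lemma iter_step_mono (K : set site) (m n : nat) : (m <= n)%N ->
  iter m bootstrap_step K `<=` iter n bootstrap_step K.
Proof.
move=> /subnK <-; elim: (n - m)%N => [|k IH] //=.
by apply: (subset_trans IH); exact: step_ext.
Qed.

Lemma closure_sub (K : set site) : K `<=` bootstrap_closure K.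
Proof. by move=> x Kx; exists 0%N. Qed.

Lemma closure_stable (K : set site) : stable (bootstrap_closure K).
Proof.
move=> x y z xy xz yz [m _ my] [n _ nz].
exists (maxn m n).+1 => //=; right; apply/card_ge2P; exists y, z; split => //.
  by split => //; apply: (iter_step_mono (leq_maxl m n)).
by split => //; apply: (iter_step_mono (leq_maxr m n)).
Qed.

(** The closure is the least stable set containing [K]. From here on it is used only through this
    property, and the iteration no longer appears. *)
Lemma closure_min (K K' : set site) : stable K' -> K `<=` K' ->
  bootstrap_closure K `<=` K'.
Proof.
move=> sK KK' x [n _]; elim: n x => [|n IH] x /=; first exact: KK'.
case => [/IH //|/card_ge2P [y [z [[xy ky] [xz kz] yz]]]].
exact: sK xy xz yz (IH _ ky) (IH _ kz).
Qed.

Lemma closure_mono (K K' : set site) : K `<=` K' ->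
  bootstrap_closure K `<=` bootstrap_closure K'.
Proof.
move=> h; apply: closure_min; first exact: closure_stable.
exact: subset_trans h (@closure_sub _).
Qed.

Lemma neighboursE (x y : site) : neighbours x y <->
  (x.1 = y.1 /\ (x.2 = y.2 + 1 \/ x.2 = y.2 - 1)) \/
  (x.2 = y.2 /\ (x.1 = y.1 + 1 \/ x.1 = y.1 - 1)).
Proof.
rewrite /neighbours /=; split; last first.
  by move=> [[-> [->|->]]|[-> [->|->]]]; ring.
move: (x.1) (x.2) (y.1) (y.2) => a b c d; nia.
Qed.

(* [(a, c, (w, h))] is the rectangle [a, a + w) x [c, c + h). *)
Definition rect : Type := (int * int * (nat * nat))%type.
Definition rx (r : rect) : int := r.1.1.
Definition ry (r : rect) : int := r.1.2.
Definition rw (r : rect) : nat := r.2.1.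
Definition rh (r : rect) : nat := r.2.2.
Definition rset (r : rect) : set site :=
  [set z | [/\ rx r <= z.1, z.1 < rx r + (rw r)%:Z, ry r <= z.2 &
               z.2 < ry r + (rh r)%:Z]].
Definition rsub (r r' : rect) : Prop :=
  [/\ rx r' <= rx r, rx r + (rw r)%:Z <= rx r' + (rw r')%:Z,
      ry r' <= ry r & ry r + (rh r)%:Z <= ry r' + (rh r')%:Z].
Definition rpos (r : rect) : Prop := (0 < rw r)%N /\ (0 < rh r)%N.
(** The semi-perimeter. By [rsub_eq] it is strictly monotone under inclusion, so it measures the
    progress of growth and of the inductions on rectangles. *)
Definition phi (r : rect) : nat := (rw r + rh r)%N.

Ltac runfold := rewrite /rsub /rset /rpos /phi /rx /ry /rw /rh /=.
Ltac rtac := runfold; try split; intros; try lia.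

Lemma rsub_set (r r' : rect) : rsub r r' -> rset r `<=` rset r'.
Proof. by move=> [? ? ? ?] z [? ? ? ?]; split; lia. Qed.

Lemma rset_sub (r r' : rect) : rpos r -> rset r `<=` rset r' -> rsub r r'.
Proof.
move=> [w0 h0] H.
have h1 : rset r (rx r, ry r) by split => /=; lia.
have h2 : rset r (rx r + (rw r)%:Z - 1, ry r + (rh r)%:Z - 1)
  by split => /=; lia.
by case: (H _ h1) => /= ? ? ? ?; case: (H _ h2) => /= ? ? ? ?; split; lia.
Qed.

Lemma rsub_refl r : rsub r r. Proof. by split. Qed.

Lemma rsub_trans r2 r1 r3 : rsub r1 r2 -> rsub r2 r3 -> rsub r1 r3.
Proof. by move=> [? ? ? ?] [? ? ? ?]; split; lia. Qed.

Lemma rsub_eq (r r' : rect) : rsub r r' -> (phi r' <= phi r)%N -> r = r'.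
Proof.
case: r => [[a c] [w h]]; case: r' => [[a' c'] [w' h']].
rewrite /phi /rw /rh /= => -[]; rewrite /rx /ry /rw /rh /= => ? ? ? ? ?.
have -> : a = a' by lia.
have -> : c = c' by lia.
have -> : w = w' by lia.
by have -> : h = h' by lia.
Qed.

(** A site outside a rectangle has at most one neighbour inside. *)
Lemma rset_stable (r : rect) : stable (rset r).
Proof.
move=> [x1 x2] [y1 y2] [z1 z2] /neighboursE /= xy /neighboursE /= xz yz.
move=> [/= ? ? ? ?] [/= ? ? ? ?].
have : ~ (y1 = z1 /\ y2 = z2) by move=> [? ?]; apply: yz; congr pair.
by move=> ?; split => /=; lia.
Qed.

Lemma closure_rect (X : set site) (r : rect) :
  bootstrap_closure (X `&` rset r) `<=` rset r.
Proof. by apply: closure_min; [exact: rset_stable | move=> x []]. Qed.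

Lemma spanned_mono (X Y : set site) (r : rect) : X `<=` Y ->
  internally_spanned X (rset r) -> internally_spanned Y (rset r).
Proof.
move=> XY h; apply/seteqP; split; first exact: closure_rect.
rewrite -[X in X `<=` _]h; apply: closure_mono => x [? ?]; split => //.
exact: XY.
Qed.

Section FillLine.
Variables (K : set site) (p o : int -> site) (u v : int).
Hypothesis sK : stable K.
Hypothesis op : forall j, neighbours (o j) (p j).
Hypothesis oS : forall j, neighbours (o j) (o (j + 1)).
Hypothesis oP : forall j, neighbours (o j) (o (j - 1)).
Hypothesis po : forall i j, p i <> o j.
Hypothesis Kp : forall j, u <= j < v -> K (p j).

(** The line [o] runs along the full line [p]. Infection spreads both ways from [o j0]: the next
    site has two infected neighbours, one in [p] and the previous one in [o]. Parametrized lines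
    serve columns and rows alike. *)
Lemma fill_line (j0 : int) : u <= j0 < v -> K (o j0) ->
  forall j, u <= j < v -> K (o j).
Proof.
move=> hj0 Kj0.
have up : forall n : nat, j0 + n%:Z < v -> K (o (j0 + n%:Z)).
  elim=> [|n IH] hn; first by rewrite addr0.
  have e : j0 + n.+1%:Z - 1 = j0 + n%:Z by lia.
  apply: (sK (op _) (oP _)); [exact: po | apply: Kp; lia |].
  by rewrite e; apply: IH; lia.
have down : forall n : nat, u <= j0 - n%:Z -> K (o (j0 - n%:Z)).
  elim=> [|n IH] hn; first by rewrite subr0.
  have e : j0 - n.+1%:Z + 1 = j0 - n%:Z by lia.
  apply: (sK (op _) (oS _)); [exact: po | apply: Kp; lia |].
  by rewrite e; apply: IH; lia.
move=> j hj; case: (leP j0 j) => h.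
  have -> : j = j0 + `|j - j0|%N%:Z by lia.
  by apply: up; lia.
have -> : j = j0 - `|j - j0|%N%:Z by lia.
by apply: down; lia.
Qed.
End FillLine.

Lemma fill_col (K : set site) (a b u v : int) : stable K ->
  (b = a + 1 \/ b = a - 1) -> (forall j, u <= j < v -> K (a, j)) ->
  forall j0, u <= j0 < v -> K (b, j0) -> forall j, u <= j < v -> K (b, j).
Proof.
move=> sK ab Ka j0 hj0 Kj0.
apply: (@fill_line K (fun j => (a, j)) (fun j => (b, j)) u v sK _ _ _ _ Ka j0 hj0 Kj0).
- by move=> j; apply/neighboursE => /=; lia.
- by move=> j; apply/neighboursE => /=; lia.
- by move=> j; apply/neighboursE => /=; lia.
- by move=> i j [] ?; lia.
Qed.

Lemma fill_row (K : set site) (a b u v : int) : stable K ->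
  (b = a + 1 \/ b = a - 1) -> (forall j, u <= j < v -> K (j, a)) ->
  forall j0, u <= j0 < v -> K (j0, b) -> forall j, u <= j < v -> K (j, b).
Proof.
move=> sK ab Ka j0 hj0 Kj0.
apply: (@fill_line K (fun j => (j, a)) (fun j => (j, b)) u v sK _ _ _ _ Ka j0 hj0 Kj0).
- by move=> j; apply/neighboursE => /=; lia.
- by move=> j; apply/neighboursE => /=; lia.
- by move=> j; apply/neighboursE => /=; lia.
- by move=> i j [] ? ?; lia.
Qed.

(** The range of interaction: two sites can infect a third only if they have a common neighbour,
    which puts them at distance at most two. *)
Definition near2 (x y : site) : Prop :=
  (`|x.1 - y.1|%N + `|x.2 - y.2|%N <= 2)%N.

Lemma infect_mid (K : set site) (x y z : site) : stable K -> K y -> K z ->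
  neighbours x y -> neighbours x z -> y.1 != z.1 \/ y.2 != z.2 -> K x.
Proof.
move=> sK Ky Kz xy xz yz; apply: (sK x y z) => // e.
by rewrite e !eqxx in yz; case: yz.
Qed.

(** The line along the side of [r] facing [z] contains either [z] itself or a common neighbour of
    [z] and a site of [r]; one infected site fills this line. It stays in [Q] because [z] is in
    [Q]. *)
Lemma grow_step (K : set site) (r Q : rect) (x z : site) : stable K ->
  rset r `<=` K -> rsub r Q -> rset r x -> K z -> rset Q z -> ~ rset r z ->
  near2 x z ->
  exists r', [/\ rsub r r', rsub r' Q, rset r' `<=` K & phi r' = (phi r).+1].
Proof.
case: r => [[a c] [w h]]; case: Q => [[A C] [W H]].
case: x => [x1 x2]; case: z => [z1 z2].
rewrite /near2 => sK rK [] + + + + [] + + + + Kz [] + + + + nz.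
rewrite /rx /ry /rw /rh /= => q1 q2 q3 q4 p1 p2 p3 p4 z1q z2q z3q z4q d.
have {}nz : ~ (a <= z1 /\ z1 < a + w%:Z /\ c <= z2 /\ z2 < c + h%:Z).
  by move=> [? [? [? ?]]]; apply: nz; split.
have rK' i j : a <= i -> i < a + w%:Z -> c <= j -> j < c + h%:Z -> K (i, j).
  by move=> ? ? ? ?; apply: rK; split.
have mid i j i1 j1 : K (i1, j1) ->
    (i == i1) && (j == j1 + 1) || (i == i1) && (j == j1 - 1)
    || (i == i1 + 1) && (j == j1) || (i == i1 - 1) && (j == j1) ->
    (i == z1) && (j == z2 + 1) || (i == z1) && (j == z2 - 1)
    || (i == z1 + 1) && (j == z2) || (i == z1 - 1) && (j == z2) ->
    (i1 != z1) || (j1 != z2) -> K (i, j).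
  move=> K1 h1 h2 /orP h3; apply: (infect_mid sK K1 Kz) => //=;
    by apply/neighboursE => /=; lia.
have [right|nr] := boolP ((a + w%:Z <= z1) ).
  have [j0 hj0 Kj0] : exists2 j0, c <= j0 < c + h%:Z & K (a + w%:Z, j0).
    have [/eqP e1|n1] := boolP (z1 == a + w%:Z).
      have [hz|hz] := boolP (c <= z2 < c + h%:Z).
        by exists z2 => //; rewrite -e1.
      exists x2; first lia.
      by apply: (mid _ _ (a + w%:Z - 1) x2); [apply: rK' | ..]; lia.
    exists x2; first lia.
    by apply: (mid _ _ (a + w%:Z - 1) x2); [apply: rK' | ..]; lia.
  have fl := @fill_col K (a + w%:Z - 1) (a + w%:Z) c (c + h%:Z) sK.
  exists (a, c, (w.+1, h)); split; [by rtac | by rtac | | by rtac].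
  move=> [i j] []; runfold => i1 i2 j1 j2.
  have [il|il] := boolP (i < a + w%:Z); first by apply: rK'.
  have -> : i = a + w%:Z by lia.
  by apply: fl Kj0 _ _ => //; [lia | move=> *; apply: rK'; lia | lia].
have [left|nl] := boolP ((z1 < a) ).
  have [j0 hj0 Kj0] : exists2 j0, c <= j0 < c + h%:Z & K (a - 1, j0).
    have [/eqP e1|n1] := boolP (z1 == a - 1).
      have [hz|hz] := boolP (c <= z2 < c + h%:Z).
        by exists z2 => //; rewrite -e1.
      exists x2; first lia.
      by apply: (mid _ _ a x2); [apply: rK' | ..]; lia.
    exists x2; first lia.
    by apply: (mid _ _ a x2); [apply: rK' | ..]; lia.
  have fl := @fill_col K a (a - 1) c (c + h%:Z) sK.
  exists (a - 1, c, (w.+1, h)); split; [by rtac | by rtac | | by rtac].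
  move=> [i j] []; runfold => i1 i2 j1 j2.
  have [il|il] := boolP (a <= i); first by apply: rK'; lia.
  have -> : i = a - 1 by lia.
  by apply: fl Kj0 _ _ => //; [lia | move=> *; apply: rK'; lia | lia].
have [up|nu] := boolP ((c + h%:Z <= z2) ).
  have [j0 hj0 Kj0] : exists2 j0, a <= j0 < a + w%:Z & K (j0, c + h%:Z).
    have [/eqP e1|n1] := boolP (z2 == c + h%:Z).
      by exists z1; [lia | rewrite -e1].
    exists x1; first lia.
    by apply: (mid _ _ x1 (c + h%:Z - 1)); [apply: rK' | ..]; lia.
  have fl := @fill_row K (c + h%:Z - 1) (c + h%:Z) a (a + w%:Z) sK.
  exists (a, c, (w, h.+1)); split; [by rtac | by rtac | | by rtac].
  move=> [i j] []; runfold => i1 i2 j1 j2.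
  have [il|il] := boolP (j < c + h%:Z); first by apply: rK'.
  have -> : j = c + h%:Z by lia.
  by apply: fl Kj0 _ _ => //; [lia | move=> *; apply: rK'; lia | lia].
have [j0 hj0 Kj0] : exists2 j0, a <= j0 < a + w%:Z & K (j0, c - 1).
  have [/eqP e1|n1] := boolP (z2 == c - 1).
    by exists z1; [lia | rewrite -e1].
  exists x1; first lia.
  by apply: (mid _ _ x1 c); [apply: rK' | ..]; lia.
have fl := @fill_row K c (c - 1) a (a + w%:Z) sK.
exists (a, c - 1, (w, h.+1)); split; [by rtac | by rtac | | by rtac].
move=> [i j] []; runfold => i1 i2 j1 j2.
have [il|il] := boolP (c <= j); first by apply: rK'; lia.
have -> : j = c - 1 by lia.
by apply: fl Kj0 _ _ => //; [lia | move=> *; apply: rK'; lia | lia].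
Qed.

(** The common form of the filling arguments below (hull of two rectangles, crossing of a strip,
    nucleus in a large square): it suffices that no intermediate rectangle is isolated from the rest
    of [K] in [Q]. *)
Lemma grow_fill (K : set site) (r Q : rect) : stable K -> rset r `<=` K ->
  rsub r Q ->
  (forall r', rsub r r' -> rsub r' Q -> r' <> Q -> rset r' `<=` K ->
     exists x z, [/\ rset r' x, K z, rset Q z, ~ rset r' z & near2 x z]) ->
  rset Q `<=` K.
Proof.
move=> sK; move: {2}(phi Q - phi r)%N (leqnn (phi Q - phi r)) => n.
elim: n r => [|n IH] r hn rK rQ H.
  by rewrite -(@rsub_eq r Q) //; lia.
have [<- //|neq] := pselect (r = Q).
have [x [z [rx_ Kz Qz nz xz]]] := H r (rsub_refl r) rQ neq rK.
have [r' [rr' r'Q r'K e]] := grow_step sK rK rQ rx_ Kz Qz nz xz.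
apply: (IH r') => //; first lia.
by move=> r'' s; apply: H; apply: rsub_trans s.
Qed.

(** * Disjoint spanning *)

Definition close (r1 r2 : rect) : Prop :=
  exists x y, [/\ rset r1 x, rset r2 y & near2 x y].

Lemma hull_ex (r1 r2 : rect) : rpos r1 -> rpos r2 ->
  exists Q, [/\ rpos Q, rsub r1 Q, rsub r2 Q &
    forall Q', rsub r1 Q' -> rsub r2 Q' -> rsub Q Q'].
Proof.
case: r1 => [[a1 c1] [w1 h1]]; case: r2 => [[a2 c2] [w2 h2]].
runfold => -[p1 p2] [p3 p4].
have mn (x y : int) : exists m, [/\ m <= x, m <= y & m = x \/ m = y].
  by case: (leP x y) => ?; [exists x | exists y]; split; lia.
have mx (x y : int) : exists m, [/\ x <= m, y <= m & m = x \/ m = y].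
  by case: (leP x y) => ?; [exists y | exists x]; split; lia.
have [a [? ? ?]] := mn a1 a2.
have [c [? ? ?]] := mn c1 c2.
have [b [? ? ?]] := mx (a1 + w1%:Z) (a2 + w2%:Z).
have [d [? ? ?]] := mx (c1 + h1%:Z) (c2 + h2%:Z).
exists (a, c, (`|b - a|%N, `|d - c|%N)) => /=; split; [split; lia ..|].
by move=> [[A C] [W H]] /= [? ? ? ?] [? ? ? ?]; split; lia.
Qed.

(** If the site of [r2] given by [close] is outside [r], it serves. Otherwise [r2] crosses a side of
    [r], and two adjacent sites across that side are taken. *)
Lemma close_out (r r2 : rect) : close r r2 -> ~ rsub r2 r ->
  exists x z, [/\ rset r x, rset r2 z, ~ rset r z & near2 x z].
Proof.
case: r => [[a c] [w h]]; case: r2 => [[a2 c2] [w2 h2]].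
move=> [[x1 x2] [[y1 y2] []]]; runfold.
move=> [? ? ? ?] [? ? ? ?] near nsub.
have [[? ? ? ?]|out] := pselect [/\ a <= y1, y1 < a + w%:Z, c <= y2 &
  y2 < c + h%:Z]; last by exists (x1, x2), (y1, y2); split.
have [k1|k1] := leP (a2 + w2%:Z) (a + w%:Z); last first.
  exists (a + w%:Z - 1, y2), (a + w%:Z, y2); split => /=; [split; lia ..| |].
    by move=> [] *; lia.
  by rewrite /near2 /=; lia.
have [k2|k2] := leP a a2; last first.
  exists (a, y2), (a - 1, y2); split => /=; [split; lia ..| |].
    by move=> [] *; lia.
  by rewrite /near2 /=; lia.
have [k3|k3] := leP (c2 + h2%:Z) (c + h%:Z); last first.
  exists (y1, c + h%:Z - 1), (y1, c + h%:Z); split => /=; [split; lia ..| |].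
    by move=> [] *; lia.
  by rewrite /near2 /=; lia.
have [k4|k4] := leP c c2; last first.
  exists (y1, c), (y1, c - 1); split => /=; [split; lia ..| |].
    by move=> [] *; lia.
  by rewrite /near2 /=; lia.
by case: nsub; split; lia.
Qed.

(** [Q] is the hull of [r1] and [r2]. A rectangle strictly between [r1] and [Q] cannot contain [r2],
    so [close_out] finds a site of [r2] by which it grows. *)
Lemma close_span (K : set site) (r1 r2 Q : rect) : stable K ->
  rset r1 `<=` K -> rset r2 `<=` K -> close r1 r2 ->
  rsub r1 Q -> rsub r2 Q ->
  (forall Q', rsub r1 Q' -> rsub r2 Q' -> rsub Q Q') ->
  rset Q `<=` K.
Proof.
move=> sK r1K r2K [x [y [r1x r2y xy]]] r1Q r2Q hQ.
apply: (grow_fill sK r1K r1Q) => r' r1r' r'Q neq r'K.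
have cl : close r' r2 by exists x, y; split => //; exact: rsub_set r1r' _ r1x.
have ns : ~ rsub r2 r'.
  move=> s; apply: neq; apply: rsub_eq => //.
  by have [] := hQ _ r1r' s; rewrite /phi; lia.
have [u [v [r'u r2v nv uv]]] := close_out cl ns.
exists u, v; split => //; first exact: r2K.
exact: rsub_set r2Q _ r2v.
Qed.

(** The generating sites are kept as a list: disjoint lists will be the witnesses of disjoint
    occurrence. *)
Definition spans (xs : seq (int * int)) (r : rect) : Prop :=
  rpos r /\ bootstrap_closure [set` xs] = rset r.

Definition fam_union (fam : seq (seq (int * int) * rect)) : set site :=
  [set z | exists2 f, f \in fam & rset f.2 z].

Lemma fam_union_perm fam fam' : perm_eq fam fam' ->
  fam_union fam = fam_union fam'.
Proof.
move=> p; apply/seteqP; split=> z [f fi fz]; exists f => //.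
  by rewrite -(perm_mem p).
by rewrite (perm_mem p).
Qed.

Lemma perm_two (T : eqType) (s : seq T) (x y : T) : x \in s -> y \in s ->
  x <> y -> exists t, perm_eq s [:: x, y & t].
Proof.
move=> xs ys /eqP xy; exists (rem y (rem x s)).
apply: (perm_trans (perm_to_rem xs)); rewrite perm_cons.
by apply: perm_to_rem; rewrite rem_mem // eq_sym.
Qed.

Lemma near2_common (x y z : site) : neighbours x y -> neighbours x z ->
  near2 y z.
Proof.
move=> /neighboursE xy /neighboursE xz; rewrite /near2; lia.
Qed.

Lemma rset_nonempty r : rpos r -> exists x, rset r x.
Proof. by move=> [? ?]; exists (rx r, ry r); split => /=; lia. Qed.

(** If no two members were close, no site could have neighbours in two of them, so their union would
    be stable and equal to [R]. But a member smaller than [R] is at distance one from the rest of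
    [R], hence close to another member. *)
Lemma close_pair fam (R : rect) : (1 < size fam)%N ->
  (forall f, f \in fam -> rpos f.2) -> rpos R ->
  bootstrap_closure (fam_union fam) = rset R ->
  exists f1 f2 t, perm_eq fam [:: f1, f2 & t] /\ close f1.2 f2.2.
Proof.
move=> sz pf pR clR; apply: contrapT => no.
have nc f1 f2 : f1 \in fam -> f2 \in fam -> close f1.2 f2.2 -> f1 = f2.
  move=> h1 h2 cl; apply: contrapT => ne.
  have [t p] := perm_two h1 h2 ne.
  by apply: no; exists f1, f2, t.
have st : stable (fam_union fam).
  move=> x y z xy xz yz [f1 f1i f1y] [f2 f2i f2z].
  have e : f1 = f2.
    by apply: nc => //; exists y, z; split => //; exact: near2_common xy xz.
  by exists f1 => //; apply: (rset_stable xy xz yz) => //; rewrite e.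
have UR : fam_union fam = rset R.
  rewrite -clR; apply/seteqP; split; first exact: closure_sub.
  exact: closure_min.
case: fam sz pf clR UR no nc st => [//|f1 [//|f2 t]] _ pf clR UR no nc st.
have f1i : f1 \in [:: f1, f2 & t] by rewrite inE eqxx.
have f2i : f2 \in [:: f1, f2 & t] by rewrite !inE eqxx orbT.
have near0 x : near2 x x by rewrite /near2 !subrr.
have f1R : rset f1.2 `<=` rset R by rewrite -UR => z fz; exists f1.
have [x f1x] := rset_nonempty (pf _ f1i).
(* A member containing [R] meets every other one. The first two members are used directly, since
   [nc] would not exclude that they are equal. *)
have [s|ns] := pselect (rsub R f1.2).
  have [y f2y] := rset_nonempty (pf _ f2i).
  apply: no; exists f1, f2, t; split => //; exists y, y; split => //.
  by apply: (rsub_set s); rewrite -UR; exists f2.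
have cl : close f1.2 R by exists x, x; split => //; exact: f1R.
have [u [v [f1u Rv nv uv]]] := close_out cl ns.
have [f fi fv] : fam_union [:: f1, f2 & t] v by rewrite UR.
have e : f1 = f by apply: nc => //; exists u, v.
by apply: nv; rewrite e.
Qed.

(** The rectangles process: two close rectangles are replaced by their hull, spanned by their sites
    together. It is stopped when two are left, which share out all the sites and jointly generate
    [R]. *)
Lemma merge_split n fam (R : rect) : size fam = n.+2 ->
  (forall f, f \in fam -> spans f.1 f.2) -> rpos R ->
  bootstrap_closure (fam_union fam) = rset R ->
  exists xs1 xs2 r1 r2, [/\ spans xs1 r1, spans xs2 r2, close r1 r2,
    perm_eq (xs1 ++ xs2) (flatten (map fst fam)) &
    bootstrap_closure (rset r1 `|` rset r2) = rset R].
Proof.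
elim: n fam => [|n IH] fam sz sp pR clR.
  have [f1 [f2 [t [pe cl]]]] := close_pair (eq_leq (esym sz))
    (fun f fi => (sp f fi).1) pR clR.
  have t0 : t = [::].
    by move/perm_size: (pe); rewrite sz /= => -[] /esym/size0nil.
  rewrite t0 in pe.
  have f1i : f1 \in fam by rewrite (perm_mem pe) inE eqxx.
  have f2i : f2 \in fam by rewrite (perm_mem pe) !inE eqxx orbT.
  exists f1.1, f2.1, f1.2, f2.2; split; [exact: sp|exact: sp|by []|..].
    rewrite perm_sym; have := perm_flatten (perm_map fst pe).
    by rewrite /= cats0.
  rewrite -clR (fam_union_perm pe); congr bootstrap_closure.
  apply/seteqP; split=> z.
    by case=> ?; [exists f1 | exists f2]; rewrite ?inE ?eqxx ?orbT.
  by case=> f; rewrite !inE => /orP[] /eqP ->; [left | right].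
have sz2 : (1 < size fam)%N by rewrite sz.
have [f1 [f2 [t [pe cl]]]] := close_pair sz2 (fun f fi => (sp f fi).1) pR clR.
have f1i : f1 \in fam by rewrite (perm_mem pe) inE eqxx.
have f2i : f2 \in fam by rewrite (perm_mem pe) !inE eqxx orbT.
have [p1 s1] := sp _ f1i; have [p2 s2] := sp _ f2i.
have [Q [pQ q1 q2 qmin]] := hull_ex p1 p2.
pose fam' := (f1.1 ++ f2.1, Q) :: t.
have sQ : bootstrap_closure [set` f1.1 ++ f2.1] = rset Q.
  apply/seteqP; split.
    apply: closure_min; first exact: rset_stable.
    move=> z /=; rewrite mem_cat => /orP[] zi.
      by apply: (rsub_set q1); rewrite -s1; apply: closure_sub.
    by apply: (rsub_set q2); rewrite -s2; apply: closure_sub.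
  apply: (close_span (@closure_stable _) _ _ cl q1 q2 qmin).
    by rewrite -s1; apply: closure_mono => z /= zi; rewrite mem_cat zi.
  by rewrite -s2; apply: closure_mono => z /= zi; rewrite mem_cat zi orbT.
have Hsz : size fam' = n.+2 by move/perm_size: pe; rewrite sz /= => -[] ->.
have [|//||xs1 [xs2 [r1 [r2 [h1 h2 h3 h4 h5]]]]] := IH fam' Hsz.
- move=> f; rewrite inE => /orP[/eqP -> //|ft].
  by apply: sp; rewrite (perm_mem pe) !inE ft !orbT.
- rewrite -clR (fam_union_perm pe); apply/seteqP; split; last first.
    apply: closure_mono => z [f]; rewrite !inE => /or3P[/eqP ->|/eqP ->|ft] fz.
    + by exists (f1.1 ++ f2.1, Q); [rewrite inE eqxx|exact: rsub_set q1 _ fz].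
    + by exists (f1.1 ++ f2.1, Q); [rewrite inE eqxx|exact: rsub_set q2 _ fz].
    + by exists f => //; rewrite inE ft orbT.
  apply: closure_min; first exact: closure_stable.
  move=> z [f]; rewrite inE => /orP[/eqP -> /=|ft fz]; last first.
    by apply: closure_sub; exists f => //; rewrite !inE ft !orbT.
  apply: (close_span (@closure_stable _) _ _ cl q1 q2 qmin).
    by move=> u fu; apply: closure_sub; exists f1; rewrite ?inE ?eqxx.
  by move=> u fu; apply: closure_sub; exists f2; rewrite ?inE ?eqxx ?orbT.
exists xs1, xs2, r1, r2; split => //.
apply: (perm_trans h4); rewrite perm_sym.
by have := perm_flatten (perm_map fst pe); rewrite /= catA.
Qed.

Lemma spans_split (xs : seq (int * int)) (R : rect) : uniq xs -> spans xs R ->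
  (2 < phi R)%N ->
  exists xs1 xs2 r1 r2, [/\ spans xs1 r1 /\ spans xs2 r2, close r1 r2,
    uniq (xs1 ++ xs2), {subset xs1 ++ xs2 <= xs} & [/\
    bootstrap_closure (rset r1 `|` rset r2) = rset R, r1 <> R & r2 <> R]].
Proof.
move: {2}(size xs) (leqnn (size xs)) => n; elim: n xs => [|n IH] xs hn.
  move: hn; rewrite leqn0 => /nilP -> _ [pR e].
  have [x] := rset_nonempty pR; rewrite -e => /(closure_min (K' := set0)).
  by case=> // [? ? ? ? ? ? []|].
move=> ux sx phi2.
(* One may assume that no shorter sublist of [xs] spans [R]. Both final lists are shorter than [xs],
   since neither is empty; this excludes [r1 = R] and [r2 = R]. *)
have [[xs' [h1 h2 h3 h4]]|nmin] := pselect (exists xs', [/\ uniq xs',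
  {subset xs' <= xs}, (size xs' < size xs)%N & spans xs' R]).
  have hn' : (size xs' <= n)%N by lia.
  have [xs1 [xs2 [r1 [r2 [s1 cl u12 sub rest]]]]] := IH xs' hn' h1 h4 phi2.
  exists xs1, xs2, r1, r2; split => //.
  by move=> z /sub /h2.
have [pR e] := sx.
pose fam := [seq ([:: x], (x.1, x.2, (1%N, 1%N))) | x <- xs].
have rs1 (x : int * int) : rset (x.1, x.2, (1%N, 1%N)) = [set x].
  case: x => [x1 x2]; apply/seteqP; split => [[z1 z2] []|[z1 z2] -> ]; runfold.
    by move=> *; congr pair; lia.
  by split; lia.
have fl : flatten (map fst fam) = xs.
  by rewrite -map_comp; elim: (xs) => [//|x s] /= ->.
have Ux : fam_union fam = [set` xs].
  apply/seteqP; split => z /=.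
    by move=> [f /mapP[x xi ->]] /=; rewrite rs1 => ->.
  move=> zi; exists ([:: z], (z.1, z.2, (1%N, 1%N))); last by rewrite rs1.
  by apply/mapP; exists z.
have sz : (1 < size xs)%N.
  case: (xs) e => [|x [|y s]] // e.
    have [x] := rset_nonempty pR; rewrite -e => /(closure_min (K' := set0)).
    by case=> // [? ? ? ? ? ? []|].
  have : rset R `<=` rset (x.1, x.2, (1%N, 1%N)).
    rewrite -e; apply: closure_min; first exact: rset_stable.
    by move=> z /=; rewrite inE => /eqP ->; rewrite rs1.
  by move=> /(rset_sub pR); move: phi2 pR; runfold => ? [? ?] [? ? ? ?]; lia.
have szf : size fam = (size xs - 2).+2 by rewrite size_map; lia.
have [|//||xs1 [xs2 [r1 [r2 [h1 h2 h3 h4 h5]]]]] := merge_split (R := R) szf.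
- move=> f /mapP[x xi ->] /=; split; first by split.
  rewrite rs1; apply/seteqP; split.
    apply: closure_min; first by rewrite -rs1; exact: rset_stable.
    by move=> z /=; rewrite inE => /eqP.
  by move=> z ->; apply: closure_sub; rewrite /= inE.
- by rewrite Ux.
rewrite fl in h4.
have sub : {subset xs1 ++ xs2 <= xs} by move=> z; rewrite (perm_mem h4).
have u12 : uniq (xs1 ++ xs2) by rewrite (perm_uniq h4).
have ne ys r : spans ys r -> (0 < size ys)%N.
  case: ys => // -[pr er]; have [x] := rset_nonempty pr.
  by rewrite -er => /(closure_min (K' := set0)); case=> // [? ? ? ? ? ? []|].
have szs := perm_size h4; rewrite size_cat in szs.
have n1 := ne _ _ h1; have n2 := ne _ _ h2.
have [u1 u2] : uniq xs1 /\ uniq xs2.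
  by move: u12; rewrite cat_uniq => /and3P[? _ ?].
have lt1 : (size xs1 < size xs)%N.
  by rewrite -szs -[X in (X < _)%N]addn0 ltn_add2l.
have lt2 : (size xs2 < size xs)%N.
  by rewrite -szs -[X in (X < _)%N]add0n ltn_add2r.
exists xs1, xs2, r1, r2; split => //; split => // E.
  apply: nmin; exists xs1; split => //; last by rewrite -E.
  by move=> z zi; apply: sub; rewrite mem_cat zi.
apply: nmin; exists xs2; split => //; last by rewrite -E.
by move=> z zi; apply: sub; rewrite mem_cat zi orbT.
Qed.

Definition rsites (r : rect) : seq (int * int) :=
  [seq (rx r + i%:Z, ry r + j%:Z) | i <- iota 0 (rw r), j <- iota 0 (rh r)].

Lemma mem_rsites (r : rect) (z : int * int) : z \in rsites r <-> rset r z.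
Proof.
split.
  move=> /allpairsP[[i j] [/=]]; rewrite !mem_iota => ? ? ->.
  by split => /=; lia.
case: z => [z1 z2] [/= ? ? ? ?].
apply/allpairsP; exists (`|z1 - rx r|%N, `|z2 - ry r|%N) => /=.
by rewrite !mem_iota; split; [lia|lia|congr pair; lia].
Qed.

Lemma uniq_rsites (r : rect) : uniq (rsites r).
Proof.
apply: allpairs_uniq; [exact: iota_uniq|exact: iota_uniq|].
move=> [i j] [i' j'] _ _ /= [] ? ?; congr pair; lia.
Qed.

Lemma size_rsites (r : rect) : size (rsites r) = (rw r * rh r)%N.
Proof. by rewrite size_allpairs !size_iota. Qed.

(** The disjoint occurrence of van den Berg and Kesten, in the form suited to increasing events:
    each event occurs on its own part of the configuration. *)
Definition disjoint_occ (I : Type) (A B : set I -> Prop) (Y : set I) : Prop :=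
  exists Y1 Y2, [/\ Y1 `<=` Y, Y2 `<=` Y, Y1 `&` Y2 = set0, A Y1 & B Y2].

Notation spanned r := (fun Y : set site => internally_spanned Y (rset r)).

Lemma spanned_split (Y : set site) (R : rect) : rpos R -> (2 < phi R)%N ->
  internally_spanned Y (rset R) ->
  exists r1 r2, [/\ [/\ rpos r1, rpos r2, rsub r1 R & rsub r2 R],
    (phi r1 < phi R)%N /\ (phi r2 < phi R)%N,
    (rw R <= rw r1 + rw r2 + 1)%N, (rh R <= rh r1 + rh r2 + 1)%N &
    disjoint_occ (spanned r1) (spanned r2) Y].
Proof.
move=> pR phi2 sR.
pose xs := [seq z <- rsites R | `[< Y z >]].
have xsE : [set` xs] = Y `&` rset R.
  apply/seteqP; split => z /=.
    by rewrite mem_filter => /andP[/asboolP ? /mem_rsites].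
  by move=> [? ?]; rewrite mem_filter; apply/andP; split;
    [apply/asboolP | apply/mem_rsites].
have sx : spans xs R by split => //; rewrite xsE.
have ux : uniq xs by apply: filter_uniq; exact: uniq_rsites.
have [xs1 [xs2 [r1 [r2 [[[p1 s1] [p2 s2]] cl u12 sub [e n1 n2]]]]]] :=
  spans_split ux sx phi2.
have q1 : rsub r1 R.
  by apply: rset_sub => // z z1; rewrite -e; apply: closure_sub; left.
have q2 : rsub r2 R.
  by apply: rset_sub => // z z2; rewrite -e; apply: closure_sub; right.
have [Q [pQ h1 h2 hQ]] := hull_ex p1 p2.
have RQ : rsub R Q.
  apply: rset_sub => //; rewrite -e; apply: closure_min.
    exact: rset_stable.
  by move=> z [] ?; [apply: (rsub_set h1) | apply: (rsub_set h2)].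
have QR := hQ _ q1 q2.
have dim : (rw R <= rw r1 + rw r2 + 1)%N /\ (rh R <= rh r1 + rh r2 + 1)%N.
  move: cl QR RQ h1 h2 p1 p2 (hQ) => [[x1 x2] [[y1 y2] []]].
  rewrite /near2; move: R r1 r2 Q {pR phi2 sR xs xsE sx ux n1 n2 s1 s2 hQ pQ e u12 sub q1 q2}.
  move=> [[a c] [w h]] [[a1 c1] [w1 h1]] [[a2 c2] [w2 h2]] [[A C] [W H]].
  runfold => -[? ? ? ?] [? ? ? ?] ? [? ? ? ?] [? ? ? ?] [? ? ? ?] [? ? ? ?].
  move=> [? ?] [? ?] hQ.
  have mn (x y : int) : exists m, [/\ m <= x, m <= y & m = x \/ m = y].
    by case: (leP x y) => ?; [exists x | exists y]; split; lia.
  have mx (x y : int) : exists m, [/\ x <= m, y <= m & m = x \/ m = y].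
    by case: (leP x y) => ?; [exists y | exists x]; split; lia.
  have [l [? ? ?]] := mn a1 a2.
  have [b [? ? ?]] := mn c1 c2.
  have [r [? ? ?]] := mx (a1 + w1%:Z) (a2 + w2%:Z).
  have [t [? ? ?]] := mx (c1 + h1%:Z) (c2 + h2%:Z).
  have := hQ (l, b, (`|r - l|%N, `|t - b|%N)) => /=.
  case; [by split; lia|by split; lia|] => ? ? ? ?; lia.
exists r1, r2; split; [by split| |by case: dim|by case: dim|].
  have lt r : rsub r R -> r <> R -> (phi r < phi R)%N.
    by move=> s n; rewrite ltnNge; apply/negP => /(rsub_eq s).
  by split; apply: lt.
have subY : [set` xs1 ++ xs2] `<=` Y.
  by move=> z /sub zi; have : [set` xs] z by []; rewrite xsE => -[].
have sp ys r : bootstrap_closure [set` ys] = rset r ->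
    internally_spanned [set` ys] (rset r).
  move=> er; rewrite /internally_spanned.
  have -> : [set` ys] `&` rset r = [set` ys]; last by [].
  by apply/setIidPl; rewrite -er; exact: closure_sub.
exists [set` xs1], [set` xs2]; split; [| | |exact: sp|exact: sp].
- by move=> z /= zi; apply: subY; rewrite /= mem_cat zi.
- by move=> z /= zi; apply: subY; rewrite /= mem_cat zi orbT.
- apply/seteqP; split => // z [/= z1 z2].
  by move: u12; rewrite cat_uniq => /and3P[_ /hasPn /(_ _ z2) /=]; rewrite z1.
Qed.

(** * Growth and descent of spanned rectangles *)

(** Removing two adjacent columns from [R] leaves a stable set: a site of these columns has at most
    one neighbour in what remains. If both columns were empty, the closure would be confined to this
    set. *)
Lemma spanned_no_col_gap (X : set site) (R : rect) (c : int) : rpos R ->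
  internally_spanned X (rset R) -> rx R <= c -> c + 1 < rx R + (rw R)%:Z ->
  exists z, [/\ X z, rset R z & z.1 = c \/ z.1 = c + 1].
Proof.
move=> pR sR c1 c2; apply: contrapT => no.
pose K := [set z | rset R z /\ ~ (z.1 = c \/ z.1 = c + 1)].
have sK : stable K.
  move=> x y z xy xz yz [Ry ny] [Rz nz]; split.
    exact: (rset_stable xy xz yz).
  move: xy xz => /neighboursE xy /neighboursE xz h.
  apply: yz; apply/eqP; rewrite -pair_eqE /pair_eq; move: h ny nz xy xz.
  move: c1 c2; move: (x.1) (x.2) (y.1) (y.2) (z.1) (z.2); lia.
have := closure_min sK (K := X `&` rset R); rewrite sR => H.
have hc : rset R (c, ry R).
  by case: pR => ? ?; split => /=; lia.
have [|_] := H _ _ hc.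
  by move=> z [Xz Rz]; split => // h; apply: no; exists z.
by apply; left.
Qed.

Lemma spanned_no_row_gap (X : set site) (R : rect) (c : int) : rpos R ->
  internally_spanned X (rset R) -> ry R <= c -> c + 1 < ry R + (rh R)%:Z ->
  exists z, [/\ X z, rset R z & z.2 = c \/ z.2 = c + 1].
Proof.
move=> pR sR c1 c2; apply: contrapT => no.
pose K := [set z | rset R z /\ ~ (z.2 = c \/ z.2 = c + 1)].
have sK : stable K.
  move=> x y z xy xz yz [Ry ny] [Rz nz]; split.
    exact: (rset_stable xy xz yz).
  move: xy xz => /neighboursE xy /neighboursE xz h.
  apply: yz; apply/eqP; rewrite -pair_eqE /pair_eq; move: h ny nz xy xz.
  move: c1 c2; move: (x.1) (x.2) (y.1) (y.2) (z.1) (z.2); lia.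
have := closure_min sK (K := X `&` rset R); rewrite sR => H.
have hc : rset R (rx R, c).
  by case: pR => ? ?; split => /=; lia.
have [|_] := H _ _ hc.
  by move=> z [Xz Rz]; split => // h; apply: no; exists z.
by apply; left.
Qed.

(** Sufficient for crossing [j] lines. The last line must be hit so that growth ends exactly there,
    without looking further; the necessary condition [nogap_from] has no such clause. *)
Definition crossing (j : nat) (N : set nat) : Prop :=
  [/\ forall i, (i.+1 < j)%N -> N i \/ N i.+1 & (0 < j)%N -> N j.-1].

(** An empty column is jumped over: the next one is hit, at distance two from the rectangle. *)
Lemma crossing_right (K : set site) (a c : int) (w h j : nat) : stable K ->
  (0 < w)%N -> (0 < h)%N ->
  rset (a, c, (w, h)) `<=` K ->
  crossing j [set i | exists z, [/\ K z, z.1 = a + (w + i)%N%:Z, c <= z.2 &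
    z.2 < c + h%:Z]] ->
  rset (a, c, ((w + j)%N, h)) `<=` K.
Proof.
move=> sK w0 h0 rK [gap last].
have rQ : rsub (a, c, (w, h)) (a, c, ((w + j)%N, h)) by runfold; split; lia.
apply: (grow_fill sK rK rQ) => -[[a' c'] [w' h']].
runfold => -[? ? ? ?] [? ? ? ?] neq r'K.
have e1 : a' = a by lia.
have e2 : c' = c by lia.
have e3 : h' = h by lia.
rewrite {}e1 {}e2 {}e3 in neq r'K *.
have lt : (w' < w + j)%N.
  rewrite ltn_neqAle; apply/andP; split; last lia.
  by apply/eqP => e; apply: neq; rewrite e.
have [[z [Kz z1 z2 z3]]|n0] := pselect (exists z, [/\ K z,
    z.1 = a + w'%:Z, c <= z.2 & z.2 < c + h%:Z]).
  exists (a + w'%:Z - 1, z.2), z; split => //=.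
  - by split; lia.
  - by split; lia.
  - by move=> [] *; lia.
  - by rewrite /near2 /=; lia.
have e : (w + (w' - w))%N = w' by lia.
have [i1|i1] := ltnP (w' - w).+1 j; last first.
  have [|z [Kz z1 z2 z3]] := last; first lia.
  by case: n0; exists z; split => //; rewrite z1; lia.
have [[z [Kz z1 z2 z3]]|[z [Kz z1 z2 z3]]] := gap _ i1.
  by case: n0; exists z; split => //; rewrite z1 e.
exists (a + w'%:Z - 1, z.2), z; split => //=.
- by split; lia.
- by split; lia.
- by move=> [] *; lia.
- by rewrite /near2 /=; lia.
Qed.

Lemma crossing_up (K : set site) (a c : int) (w h j : nat) : stable K ->
  (0 < w)%N -> (0 < h)%N ->
  rset (a, c, (w, h)) `<=` K ->
  crossing j [set i | exists z, [/\ K z, z.2 = c + (h + i)%N%:Z, a <= z.1 &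
    z.1 < a + w%:Z]] ->
  rset (a, c, (w, (h + j)%N)) `<=` K.
Proof.
move=> sK w0 h0 rK [gap last].
have rQ : rsub (a, c, (w, h)) (a, c, (w, (h + j)%N)) by runfold; split; lia.
apply: (grow_fill sK rK rQ) => -[[a' c'] [w' h']].
runfold => -[? ? ? ?] [? ? ? ?] neq r'K.
have e1 : a' = a by lia.
have e2 : c' = c by lia.
have e3 : w' = w by lia.
rewrite {}e1 {}e2 {}e3 in neq r'K *.
have lt : (h' < h + j)%N.
  rewrite ltn_neqAle; apply/andP; split; last lia.
  by apply/eqP => e; apply: neq; rewrite e.
have [[z [Kz z1 z2 z3]]|n0] := pselect (exists z, [/\ K z,
    z.2 = c + h'%:Z, a <= z.1 & z.1 < a + w%:Z]).
  exists (z.1, c + h'%:Z - 1), z; split => //=.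
  - by split; lia.
  - by split; lia.
  - by move=> [] *; lia.
  - by rewrite /near2 /=; lia.
have e : (h + (h' - h))%N = h' by lia.
have [i1|i1] := ltnP (h' - h).+1 j; last first.
  have [|z [Kz z1 z2 z3]] := last; first lia.
  by case: n0; exists z; split => //; rewrite z1; lia.
have [[z [Kz z1 z2 z3]]|[z [Kz z1 z2 z3]]] := gap _ i1.
  by case: n0; exists z; split => //; rewrite z1 e.
exists (z.1, c + h'%:Z - 1), z; split => //=.
- by split; lia.
- by split; lia.
- by move=> [] *; lia.
- by rewrite /near2 /=; lia.
Qed.

Lemma nucleus_fill (K : set site) (r Q : rect) (M : nat) : stable K ->
  rset r `<=` K -> rsub r Q -> (0 < M)%N -> (M <= rw r)%N -> (M <= rh r)%N ->
  (forall x y, rsub (x, y, (M, 1%N)) Q ->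
     exists z, K z /\ rset (x, y, (M, 1%N)) z) ->
  (forall x y, rsub (x, y, (1%N, M)) Q ->
     exists z, K z /\ rset (x, y, (1%N, M)) z) ->
  rset Q `<=` K.
Proof.
move=> sK rK rQ M0 Mw Mh hor ver.
apply: (grow_fill sK rK rQ) => -[[a c] [w h]].
move: r Q rK rQ Mw Mh hor ver => [[a0 c0] [w0 h0]] [[A C] [W H]].
runfold => rK [? ? ? ?] ? ? hor ver [? ? ? ?] [? ? ? ?] neq r'K.
have [k1|k1] := ltP (a + w%:Z) (A + W%:Z).
  have [|z [Kz [/= ? ? ? ?]]] := ver (a + w%:Z) c; first by split; lia.
  exists (a + w%:Z - 1, z.2), z; split => //=; try by split; lia.
    by move=> [] *; lia.
  by rewrite /near2 /=; lia.
have [k2|k2] := ltP A a.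
  have [|z [Kz [/= ? ? ? ?]]] := ver (a - 1) c; first by split; lia.
  exists (a, z.2), z; split => //=; try by split; lia.
    by move=> [] *; lia.
  by rewrite /near2 /=; lia.
have [k3|k3] := ltP (c + h%:Z) (C + H%:Z).
  have [|z [Kz [/= ? ? ? ?]]] := hor a (c + h%:Z); first by split; lia.
  exists (z.1, c + h%:Z - 1), z; split => //=; try by split; lia.
    by move=> [] *; lia.
  by rewrite /near2 /=; lia.
have [k4|k4] := ltP C c.
  have [|z [Kz [/= ? ? ? ?]]] := hor a (c - 1); first by split; lia.
  exists (z.1, c), z; split => //=; try by split; lia.
    by move=> [] *; lia.
  by rewrite /near2 /=; lia.
case: neq; have -> : a = A by lia.
have -> : c = C by lia.
have -> : w = W by lia.
by have -> : h = H by lia.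
Qed.

(* The Aizenman--Lebowitz lemma. *)
Lemma spanned_scale (X : set site) (R : rect) (k : nat) : rpos R ->
  (0 < k)%N -> internally_spanned X (rset R) -> (k <= maxn (rw R) (rh R))%N ->
  exists r, [/\ rpos r, rsub r R, internally_spanned X (rset r),
    (k <= maxn (rw r) (rh r))%N & (maxn (rw r) (rh r) <= k.*2)%N].
Proof.
move: {2}(phi R) (leqnn (phi R)) => n; elim: n R => [|n IH] R hn pR k0 sR kR.
  by move: hn pR; rewrite /phi; case; lia.
have [le|gt] := leqP (maxn (rw R) (rh R)) k.*2.
  by exists R; split => //; exact: rsub_refl.
have phi2 : (2 < phi R)%N by move: gt pR; rewrite /phi /rpos; lia.
have [r1 [r2 [[p1 p2 s1 s2] [l1 l2] hw hh [Y1 [Y2 [Y1X Y2X _ t1 t2]]]]]] :=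
  spanned_split pR phi2 sR.
(* If both parts had sides below [k], those of [R] would be at most [2 (k - 1) + 1 < 2 k]. *)
have [h|h] := leqP k (maxn (rw r1) (rh r1)).
  have [||r [? rr ? ? ?]] := IH r1 _ p1 k0 (spanned_mono Y1X t1); [lia|by []|].
  by exists r; split => //; exact: rsub_trans rr s1.
have h' : (k <= maxn (rw r2) (rh r2))%N by lia.
have [||r [? rr ? ? ?]] := IH r2 _ p2 k0 (spanned_mono Y2X t2); [lia|by []|].
by exists r; split => //; exact: rsub_trans rr s2.
Qed.

(* In the second alternative [S] is a smallest spanned one among those whose
   semi-perimeter is within [T] of that of [R]. *)
Lemma spanned_descent (X : set site) (R : rect) (T : nat) : rpos R ->
  (0 < T)%N -> (T + 2 <= phi R)%N -> internally_spanned X (rset R) ->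
  (exists S, [/\ rpos S, rsub S R, internally_spanned X (rset S),
      (phi S + T <= phi R)%N & (phi R <= phi S + T.*2)%N]) \/
  (exists S r1 r2, [/\ [/\ rpos S, rsub S R & (phi R < phi S + T)%N],
    [/\ rpos r1, rpos r2, rsub r1 S & rsub r2 S],
    (phi r1 + T.*2 < phi R)%N /\ (phi r2 + T.*2 < phi R)%N,
    (rw S <= rw r1 + rw r2 + 1)%N /\ (rh S <= rh r1 + rh r2 + 1)%N &
    disjoint_occ (spanned r1) (spanned r2) X]).
Proof.
move=> pR T0 TR sR.
pose ok S := [/\ rpos S, rsub S R, internally_spanned X (rset S) &
  (phi R < phi S + T)%N].
have [S [[pS sSR sS hS] minS]] : exists S, ok S /\
    forall S', ok S' -> (phi S <= phi S')%N.
  have okR : exists n, `[< exists S, ok S /\ phi S = n >].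
    exists (phi R); apply/asboolP; exists R; split; last by [].
    by split => //; lia.
  case: (ex_minnP okR) => n /asboolP[S [okS <-]] min.
  exists S; split => // S' okS'; apply: min; apply/asboolP.
  by exists S'.
have phi2 : (2 < phi S)%N by lia.
have [r1 [r2 [[p1 p2 s1 s2] [l1 l2] hw hh dis]]] := spanned_split pS phi2 sS.
have [Y1 [Y2 [Y1X Y2X _ t1 t2]]] := dis.
(* By minimality of [S], a smaller spanned rectangle in it is not [ok], so it lies at least [T]
   below [R]. If one of the two parts lies at most [2 T] below, it gives the first alternative. *)
have sm r Y : rpos r -> rsub r S -> Y `<=` X -> internally_spanned Y (rset r) ->
    (phi r < phi S)%N -> (phi r + T <= phi R)%N.
  move=> pr rS YX tr lt; rewrite leqNgt; apply/negP => h.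
  have : ok r.
    by split => //; [exact: rsub_trans rS sSR | exact: spanned_mono YX tr].
  by move=> /minS; lia.
have m1 := sm _ _ p1 s1 Y1X t1 l1; have m2 := sm _ _ p2 s2 Y2X t2 l2.
have [g1|g1] := leqP (phi R) (phi r1 + T.*2).
  left; exists r1; split => //; first exact: rsub_trans s1 sSR.
  exact: spanned_mono Y1X t1.
have [g2|g2] := leqP (phi R) (phi r2 + T.*2).
  left; exists r2; split => //; first exact: rsub_trans s2 sSR.
  exact: spanned_mono Y2X t2.
by right; exists S, r1, r2; split.
Qed.

(** * Independent random sets on finitely many sites *)

Section Expectation.
Variables (R : realType) (I : eqType).
Implicit Types (p : I -> R) (s t : seq I) (f g : set I -> R)
  (E A B : set I -> Prop).

(* Expectation of [f] over the random subset of [s] that contains each [x]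
   independently with probability [p x]. *)
Fixpoint Ex p s f : R :=
  if s is x :: s' then
    p x * Ex p s' (fun Y => f (x |` Y)) + (1 - p x) * Ex p s' f
  else f set0.

Definition Pr p s E : R := Ex p s (fun Y => (`[< E Y >])%:R).

Definition dep_on t E : Prop :=
  forall Y Y', (forall x, x \in t -> Y x <-> Y' x) -> E Y -> E Y'.

Lemma Ex_ext p s f g : (forall Y, Y `<=` [set` s] -> f Y = g Y) ->
  Ex p s f = Ex p s g.
Proof.
elim: s f g => [|x s IH] f g h /=; first exact: h.
congr (_ * _ + _ * _); apply: IH => Y Ys; apply: h => y.
  by case=> [->|/Ys /=]; rewrite /= inE ?eqxx // => ->; rewrite orbT.
by move=> /Ys /=; rewrite inE => ->; rewrite orbT.
Qed.

Lemma Ex_const p s c : Ex p s (fun=> c) = c.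
Proof. by elim: s => [|x s IH] //=; rewrite IH; ring. Qed.

Lemma Ex_add p s f g : Ex p s (fun Y => f Y + g Y) = Ex p s f + Ex p s g.
Proof. by elim: s f g => [|x s IH] f g //=; rewrite !IH; ring. Qed.

Lemma Ex_scale p s c f : Ex p s (fun Y => c * f Y) = c * Ex p s f.
Proof. by elim: s f => [|x s IH] f //=; rewrite !IH; ring. Qed.

Lemma Ex_cat p s t f :
  Ex p (s ++ t) f = Ex p s (fun Y => Ex p t (fun Z => f (Y `|` Z))).
Proof.
elim: s f => [|x s IH] f /=.
  by apply: Ex_ext => Y _; rewrite set0U.
rewrite !IH; congr (_ * _ + _ * _); apply: Ex_ext => Y _; apply: Ex_ext => Z _.
by rewrite setUA.
Qed.

Lemma Ex_swap p s t (f : set I -> set I -> R) :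
  Ex p s (fun Y => Ex p t (fun Z => f Y Z)) =
  Ex p t (fun Z => Ex p s (fun Y => f Y Z)).
Proof.
elim: s f => [|x s IH] f //=.
by rewrite !IH Ex_add !Ex_scale.
Qed.

Lemma Ex_perm p s t f : perm_eq s t -> Ex p s f = Ex p t f.
Proof.
move=> st; symmetry; apply: (catCA_perm_ind (P := fun t => Ex p t f = Ex p s f))
  st (erefl _) => s1 s2 s3 <-.
have E3 a b c : Ex p (a ++ b ++ c) f =
    Ex p a (fun Y => Ex p b (fun Z => Ex p c (fun W => f (Y `|` (Z `|` W))))).
  by rewrite Ex_cat; apply: Ex_ext => Y _; rewrite Ex_cat.
rewrite !E3 Ex_swap.
by apply: Ex_ext => Y _; apply: Ex_ext => Z _; apply: Ex_ext => W _; rewrite setUCA.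
Qed.

Lemma dep_on_ind t E Y Y' : dep_on t E -> (forall x, x \in t -> Y x <-> Y' x) ->
  `[< E Y >] = `[< E Y' >].
Proof.
move=> dE h; apply: asbool_equiv_eq; split; first exact: dE.
by apply: dE => x xt; split => /h; apply.
Qed.

Lemma dep_on_sub t t' E : {subset t <= t'} -> dep_on t E -> dep_on t' E.
Proof. by move=> tt' dE Y Y' h; apply: dE => x /tt'; exact: h. Qed.

Lemma dep_on_and t E E' : dep_on t E -> dep_on t E' ->
  dep_on t (fun Y => E Y /\ E' Y).
Proof. by move=> d d' Y Y' h [? ?]; split; [exact: (d Y Y' h)|exact: (d' Y Y' h)]. Qed.

Lemma Pr_cat_indep p s t E E' : (forall x, x \in s -> x \notin t) ->
  dep_on s E -> dep_on t E' ->
  Pr p (s ++ t) (fun Y => E Y /\ E' Y) = Pr p s E * Pr p t E'.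
Proof.
move=> dis dE dE'; rewrite /Pr Ex_cat mulrC -Ex_scale.
apply: Ex_ext => Y Ys; rewrite mulrC -Ex_scale; apply: Ex_ext => Z Zt.
rewrite asbool_and -mulnb natrM; congr ((nat_of_bool _)%:R * (nat_of_bool _)%:R).
  apply: dep_on_ind dE _ => x xs; split => [[//|/Zt /=]|]; last by left.
  by rewrite (negPf (dis _ xs)).
apply: dep_on_ind dE' _ => x xt; split => [[/Ys /= xs|//]|]; last by right.
by move: xt; rewrite (negPf (dis _ xs)).
Qed.

Lemma Pr_cat_l p s t E : (forall x, x \in s -> x \notin t) ->
  dep_on s E -> Pr p (s ++ t) E = Pr p s E.
Proof.
move=> dis dE; rewrite /Pr Ex_cat; apply: Ex_ext => Y Ys.
rewrite -[RHS](Ex_const p t); apply: Ex_ext => Z Zt.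
congr ((nat_of_bool _)%:R).
apply: dep_on_ind dE _ => x xs; split => [[//|/Zt /=]|]; last by left.
by rewrite (negPf (dis _ xs)).
Qed.

Lemma perm_restrict s t : uniq s -> uniq t -> {subset t <= s} ->
  perm_eq s (t ++ [seq x <- s | x \notin t]).
Proof.
move=> us ut ts; apply: uniq_perm => //.
  rewrite cat_uniq ut filter_uniq // andbT.
  by apply/hasPn => x; rewrite mem_filter => /andP[].
move=> x; rewrite mem_cat mem_filter; case: (boolP (x \in t)) => //= xt.
by rewrite ts.
Qed.

Lemma Pr_restrict p s t E : uniq s -> uniq t -> {subset t <= s} ->
  dep_on t E -> Pr p s E = Pr p t E.
Proof.
move=> us ut ts dE; rewrite /Pr (Ex_perm _ _ (perm_restrict us ut ts)).
by apply: Pr_cat_l => // x xt; rewrite mem_filter xt.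
Qed.

Lemma Pr_indep p s t1 t2 E E' : uniq s -> uniq t1 -> uniq t2 ->
  {subset t1 <= s} -> {subset t2 <= s} -> (forall x, x \in t1 -> x \notin t2) ->
  dep_on t1 E -> dep_on t2 E' ->
  Pr p s (fun Y => E Y /\ E' Y) = Pr p s E * Pr p s E'.
Proof.
move=> us u1 u2 s1 s2 dis dE dE'.
rewrite (Pr_restrict p us u1 s1 dE) (Pr_restrict p us u2 s2 dE').
rewrite -(Pr_cat_indep p dis) //; apply: Pr_restrict => //.
- rewrite cat_uniq u1 u2 andbT; apply/hasPn => x x2; apply/negP => x1.
  by move: (dis _ x1); rewrite x2.
- by move=> x; rewrite mem_cat => /orP[/s1|/s2].
- apply: dep_on_and; first apply: dep_on_sub dE.
    by move=> x xt; rewrite mem_cat xt.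
  by apply: dep_on_sub dE' => x xt; rewrite mem_cat xt orbT.
Qed.

Section Bounds.
Variable p : I -> R.
Hypothesis p01 : forall x, 0 <= p x <= 1.

Lemma Ex_le s f g : (forall Y, Y `<=` [set` s] -> f Y <= g Y) ->
  Ex p s f <= Ex p s g.
Proof.
elim: s f g => [|x s IH] f g h /=; first exact: h.
have /andP[p0 p1] := p01 x.
apply: lerD; apply: ler_wpM2l; rewrite ?subr_ge0 //; apply: IH => Y Ys; apply: h => y.
  by case=> [->|/Ys /=]; rewrite /= inE ?eqxx // => ->; rewrite orbT.
by move=> /Ys /=; rewrite inE => ->; rewrite orbT.
Qed.

Lemma Pr_le s E E' : (forall Y, Y `<=` [set` s] -> E Y -> E' Y) ->
  Pr p s E <= Pr p s E'.
Proof.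
move=> h; apply: Ex_le => Y Ys; rewrite ler_nat.
by case: (asboolP (E Y)) => // /(h _ Ys) /asboolT ->.
Qed.

Lemma Pr_ge0 s E : 0 <= Pr p s E.
Proof.
rewrite -(Ex_const p s 0); apply: Ex_le => Y _; exact: ler0n.
Qed.

Lemma Pr_le1 s E : Pr p s E <= 1.
Proof.
rewrite -(Ex_const p s 1); apply: Ex_le => Y _.
by case: asboolP.
Qed.

Lemma Pr_or s E E' : Pr p s (fun Y => E Y \/ E' Y) <= Pr p s E + Pr p s E'.
Proof.
rewrite /Pr -Ex_add; apply: Ex_le => Y _.
by rewrite asbool_or -natrD ler_nat; do 2 case: asboolP => _.
Qed.

Lemma Pr_exists (J : eqType) (js : seq J) s (E : J -> set I -> Prop) c :
  (forall j, j \in js -> Pr p s (E j) <= c) ->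
  Pr p s (fun Y => exists2 j, j \in js & E j Y) <= (size js)%:R * c.
Proof.
elim: js => [|j js IH] h.
  rewrite mul0r -[leRHS](Ex_const p s 0); apply: Ex_le => Y _.
  by case: asboolP => // -[].
rewrite /= -addn1 natrD mulrDl mul1r.
apply: le_trans (Pr_le (E' := fun Y => E j Y \/ exists2 j, j \in js & E j Y) _) _.
  move=> Y _ [i]; rewrite inE => /orP[/eqP -> ?|ii ?]; [by left|by right; exists i].
apply: le_trans (Pr_or _ _ _) _; rewrite addrC; apply: lerD.
  by apply: IH => i ii; apply: h; rewrite inE ii orbT.
by apply: h; rewrite inE eqxx.
Qed.

Lemma Pr_not s E : Pr p s (fun Y => ~ E Y) = 1 - Pr p s E.
Proof.
apply/eqP; rewrite eq_sym subr_eq /Pr -Ex_add -[X in X == _](Ex_const p s 1).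
apply/eqP; apply: Ex_ext => Y _; rewrite asbool_neg.
by case: asboolP; rewrite ?addr0 ?add0r.
Qed.

Definition increasing E := forall Y Y', Y `<=` Y' -> E Y -> E Y'.

(* The van den Berg--Kesten inequality; [p x <= 1 / 2] allows an induction on
   the sites. *)
Lemma Pr_disjoint_occ s A B : (forall x, p x <= 1 / 2%:R) ->
  increasing A -> increasing B ->
  Pr p s (disjoint_occ A B) <= Pr p s A * Pr p s B.
Proof.
move=> p2; elim: s A B => [|x s IH] A B iA iB.
  rewrite /Pr /= -natrM mulnb ler_nat.
  case: asboolP => // -[Y1 [Y2 [h1 h2 _ a b]]].
  by rewrite (asboolT (iA _ _ h1 a)) (asboolT (iB _ _ h2 b)).
pose A1 Y := A (x |` Y); pose B1 Y := B (x |` Y).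
have iA1 : increasing A1 by move=> Y Y' h; apply: iA; exact: setUS.
have iB1 : increasing B1 by move=> Y Y' h; apply: iB; exact: setUS.
have AA1 : Pr p s A <= Pr p s A1.
  by apply: Pr_le => Y _; apply: iA => y; right.
have BB1 : Pr p s B <= Pr p s B1.
  by apply: Pr_le => Y _; apply: iB => y; right.
(* When [x] is infected, at most one of the two witnesses uses it. So the event lies in the union of
   two events that both contain [disjoint_occ A B], and inclusion-exclusion subtracts the latter. *)
have key : Pr p s (fun Y => disjoint_occ A B (x |` Y)) <=
    Pr p s (disjoint_occ A1 B) + Pr p s (disjoint_occ A B1)
    - Pr p s (disjoint_occ A B).
  rewrite -mulN1r /Pr -Ex_scale -!Ex_add; apply: Ex_le => Y _.
  have d1 : disjoint_occ A B (x |` Y) ->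
      disjoint_occ A1 B Y \/ disjoint_occ A B1 Y.
    move=> [Y1 [Y2 [h1 h2 h12 a b]]].
    have [x1|x1] := pselect (Y1 x).
      left; exists (Y1 `\ x), Y2; split => //.
      - by move=> y [/h1[]].
      - move=> y y2; case: (h2 y y2) => // yx.
        rewrite yx in y2; have : (Y1 `&` Y2) x by [].
        by rewrite h12.
      - by apply/seteqP; split => // y [[? _] ?]; rewrite -h12.
      - by rewrite /A1; apply: iA a => y; have [->|?] := pselect (y = x);
          [left|right].
    right; exists Y1, (Y2 `\ x); split => //.
    - by move=> y y1; case: (h1 y y1) => // yx; rewrite yx in y1.
    - by move=> y [/h2[]].
    - by apply/seteqP; split => // y [? [? _]]; rewrite -h12.
    - by rewrite /B1; apply: iB b => y; have [->|?] := pselect (y = x);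
        [left|right].
  have d2 : disjoint_occ A B Y -> disjoint_occ A1 B Y.
    move=> [Y1 [Y2 [h1 h2 h12 a b]]]; exists Y1, Y2; split => //.
    by apply: iA a => y; right.
  have d3 : disjoint_occ A B Y -> disjoint_occ A B1 Y.
    move=> [Y1 [Y2 [h1 h2 h12 a b]]]; exists Y1, Y2; split => //.
    by apply: iB b => y; right.
  case: (asboolP (disjoint_occ A B (x |` Y))) => [/d1 h|_];
  case: (asboolP (disjoint_occ A B Y)) => [h'|_];
  case: (asboolP (disjoint_occ A1 B Y)) => h1;
  case: (asboolP (disjoint_occ A B1 Y)) => h2; rewrite ?mulr1 ?mulr0 /=;
  first [lra | by exfalso; case: h | by exfalso; apply/h1/d2
        | by exfalso; apply/h2/d3].
have k1 := IH _ _ iA1 iB; have k2 := IH _ _ iA iB1; have k0 := IH _ _ iA iB.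
rewrite [in leRHS]/Pr /= -/(Pr _ _ _) -/(Pr p s A) -/(Pr p s B).
rewrite -/(Pr p s A1) -/(Pr p s B1).
have -> : Pr p (x :: s) (disjoint_occ A B) =
  p x * Pr p s (fun Y => disjoint_occ A B (x |` Y)) +
  (1 - p x) * Pr p s (disjoint_occ A B) by [].
have /andP[p0 p1] := p01 x; have px2 := p2 x.
move: key k1 k2 k0 AA1 BB1.
move: (Pr p s (disjoint_occ A B)) (Pr p s (disjoint_occ A1 B))
  (Pr p s (disjoint_occ A B1)) (Pr p s (fun Y => _)) (Pr p s A) (Pr p s B)
  (Pr p s A1) (Pr p s B1) (p x) p0 p1 px2.
move=> o o1 o2 o3 a b a1 b1 q q0 q1 q2 key k1 k2 k0 aa bb.
(* The coefficient [1 - 2 q] of [o] is nonnegative since [q <= 1 / 2], so the three induction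
   hypotheses apply. The right-hand side exceeds what they give by [q ^ 2 (a1 - a) (b1 - b)],
   nonnegative by monotonicity. *)
apply: (@le_trans _ _ ((1 - q * 2%:R) * o + q * o1 + q * o2)); first nra.
have h1 : (1 - q * 2%:R) * o <= (1 - q * 2%:R) * (a * b).
  by apply: ler_wpM2l => //; lra.
have h2 : q * o1 <= q * (a1 * b) by apply: ler_wpM2l.
have h3 : q * o2 <= q * (a * b1) by apply: ler_wpM2l.
have h4 : 0 <= q * q * ((a1 - a) * (b1 - b)).
  by apply: mulr_ge0; apply: mulr_ge0; lra.
lra.
Qed.
End Bounds.

Lemma Ex_empty p s :
  Ex p s (fun Y => (`[< Y = set0 >])%:R) = \prod_(x <- s) (1 - p x).
Proof.
elim: s => [|x s IH] /=; first by rewrite big_nil asboolT.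
rewrite big_cons -IH; set e := Ex p s (fun Y => (`[< x |` Y = set0 >])%:R).
suff -> : e = 0 by rewrite mulr0 add0r.
rewrite -(Ex_const p s 0); apply: Ex_ext => Y _; case: asboolP => // ne.
have h : (x |` Y) x by left.
by rewrite ne in h.
Qed.

Definition hit (c : seq I) (Y : set I) : Prop := exists2 x, x \in c & Y x.

Lemma dep_on_hit c : dep_on c (hit c).
Proof. by move=> Y Y' h [x xc Yx]; exists x => //; apply/(h _ xc). Qed.

Lemma Pr_hit (q : R) c : Pr (fun=> q) c (hit c) = 1 - (1 - q) ^+ size c.
Proof.
have -> : Pr (fun=> q) c (hit c) = 1 - Ex (fun=> q) c (fun Y => (`[< Y = set0 >])%:R).
  apply/eqP; rewrite eq_sym subr_eq /Pr -Ex_add -[X in X == _](Ex_const (fun=> q) c 1).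
  apply/eqP; apply: Ex_ext => Y Yc.
  case: asboolP => [[x xc Yx]|n].
    case: asboolP => [Y0|_]; last by rewrite addr0.
    by move: Yx; rewrite Y0.
  case: asboolP => [Y0|n0]; first by rewrite add0r.
  case: n0; apply/seteqP; split => // x Yx; case: n.
  by exists x => //; exact: Yc.
congr (1 - _); rewrite Ex_empty big_const_seq count_predT.
by elim: (size c) => //= n ->; rewrite exprS.
Qed.
End Expectation.

(* The indices [j] whose event [E j] occurs form a random subset of [s] with
   independent coordinates. *)
Lemma Ex_coarse (R : realType) (I J : eqType) (p : I -> R) (cs : J -> seq I)
    (E : J -> set I -> Prop) (s : seq J) (f : set J -> R) :
  uniq s -> uniq (flatten [seq cs j | j <- s]) ->
  (forall j, j \in s -> dep_on (cs j) (E j)) ->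
  Ex p (flatten [seq cs j | j <- s])
    (fun Y => f [set j | j \in s /\ E j Y]) =
  Ex (fun j => Pr p (cs j) (E j)) s f.
Proof.
elim: s f => [|j s IH] f /=.
  by move=> _ _ _; congr f; apply/seteqP; split => x // [].
move=> /andP[js us]; rewrite cat_uniq => /and3P[_ /hasPn dis uf] dE.
rewrite -(IH (fun Y => f (j |` Y))) // -?(IH f) //; first last.
- by move=> i ii; apply: dE; rewrite inE ii orbT.
- by move=> i ii; apply: dE; rewrite inE ii orbT.
set F := flatten _ in dis uf *.
rewrite Ex_cat.
set a := Ex p F (fun Y => f (j |` _)); set b := Ex p F (fun Y => f _).
have -> : Pr p (cs j) (E j) * a + (1 - Pr p (cs j) (E j)) * b =
    (a - b) * Pr p (cs j) (E j) + b by ring.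
rewrite /Pr -Ex_scale -[X in _ = _ + X](Ex_const p (cs j)) -Ex_add.
apply: Ex_ext => Y Yj.
have EiZ i Z : i \in s -> E i (Y `|` Z) <-> E i Z.
  move=> ii; have di : dep_on (cs i) (E i) by apply: dE; rewrite inE ii orbT.
  have h x : x \in cs i -> (Y `|` Z) x <-> Z x.
    move=> xi; split => [[/Yj /= xj|//]|]; last by right.
    have xF : x \in F by apply/flatten_mapP; exists i.
    by have := dis _ xF; rewrite /= xj.
  by split; apply: di => x /h [? ?]; split.
have EjZ Z : Z `<=` [set` F] -> E j (Y `|` Z) <-> E j Y.
  move=> ZF; have dj : dep_on (cs j) (E j) by apply: dE; rewrite inE eqxx.
  have h x : x \in cs j -> (Y `|` Z) x <-> Y x.
    move=> xj; split => [[//|/ZF /= xF]|]; last by left.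
    by have := dis _ xF; rewrite /= xj.
  by split; apply: dj => x /h [? ?]; split.
case: (asboolP (E j Y)) => EY.
  rewrite mulr1 subrK; apply: Ex_ext => Z ZF; congr f.
  apply/seteqP; split => i /=.
    move=> [+ EiY]; rewrite inE => /orP[/eqP -> |ii]; first by left.
    by right; split => //; apply/(EiZ _ _ ii).
  case=> [->|[ii EZ]]; rewrite inE.
    by split; [rewrite eqxx | apply/EjZ].
  by rewrite ii orbT; split => //; apply/EiZ.
rewrite mulr0 add0r; apply: Ex_ext => Z ZF; congr f.
apply/seteqP; split => i /=.
  move=> [+ EiY]; rewrite inE => /orP[/eqP e|ii].
    by rewrite e in EiY; move/(EjZ _ ZF): EiY.
  by split => //; apply/(EiZ _ _ ii).
by move=> [ii EZ]; rewrite inE ii orbT; split => //; apply/EiZ.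
Qed.

(** * From the probability space to finite sums *)

Section Transfer.
Context (R : realType) (d : measure_display) (T : measurableType d)
  (P : probability T R) (X : T -> set site) (p : R).
Hypothesis hX : bernoulli_set P X p.

(** Independence is given for the events that a site is infected, not for their complements.
    Intersecting with the cylinder over [t] makes room for the induction: the case where [x] is
    healthy is the difference between the cylinders over [t] and over [x :: t]. *)
Lemma transfer_aux (s t : seq (int * int)) (E : set site -> Prop) :
  uniq s -> uniq t -> (forall x, x \in s -> x \notin t) -> dep_on s E ->
  measurable [set w | E (X w)] /\
  P ((\bigcap_(i in [set` t]) [set w | X w i]) `&` [set w | E (X w)]) =
    (p ^+ size t * Pr (fun=> p) s E)%:E.
Proof.
have [mX pX iX] := hX.
have mcap (t' : seq (int * int)) :
    measurable (\bigcap_(i in [set` t']) [set w | X w i]).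
  by apply: fin_bigcap_measurable => // i _; exact: mX.
elim: s t E => [|x s IH] t E.
  move=> _ ut _ dE.
  have EE Y : E Y <-> E set0 by split; apply: dE.
  have [e0|e0] := pselect (E set0).
    have -> : [set w | E (X w)] = setT.
      by apply/seteqP; split => // w _; apply/EE.
    split; first exact: measurableT.
    rewrite setIT iX // /Pr /= asboolT // mulr1.
    elim: (t) => [|y t' IHt]; first by rewrite big_nil.
    by rewrite big_cons IHt pX /= exprS -EFinM.
  have -> : [set w | E (X w)] = set0.
    by apply/seteqP; split => // w /EE.
  split; first exact: measurable0.
  by rewrite setI0 measure0 /Pr /= asboolF // mulr0.
move=> /= /andP[xs us] ut dis dE.
have xt : x \notin t by apply: dis; rewrite inE eqxx.
pose E1 Y := E (x |` Y); pose E0 Y := E (Y `\ x).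
have d1 : dep_on s E1.
  move=> Y Y' h; apply: dE => y; rewrite inE => /orP[/eqP ->|ys].
    by split; left.
  by split=> -[->|yY]; [left | right; apply/h | left | right; apply/h].
have d0 : dep_on s E0.
  move=> Y Y' h; apply: dE => y; rewrite inE => /orP[/eqP ->|ys].
    by split=> -[_ []].
  by split=> -[yY n]; split => //; apply/h.
have decE : [set w | E (X w)] = ([set w | X w x] `&` [set w | E1 (X w)]) `|`
    (~` [set w | X w x] `&` [set w | E0 (X w)]).
  have e1 Y : Y x -> (x |` Y) = Y.
    by move=> Yx; apply/seteqP; split => y; [case=> [->|]|right].
  have e0 Y : ~ Y x -> Y `\ x = Y.
    move=> Yx; apply/seteqP; split => y; first by case.
    by move=> Yy; split => // e; apply: Yx; rewrite -e.
  apply/seteqP; split => w /=.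
    have [h|h] := pselect (X w x); [left|right]; split => //.
      by rewrite /E1 e1.
    by rewrite /E0 e0.
  by case=> -[h]; rewrite /E1 /E0 ?e1 ?e0.
have ds y : y \in s -> y \notin t by move=> ys; apply: dis; rewrite inE ys orbT.
have ds' y : y \in s -> y \notin x :: t.
  move=> ys; rewrite inE negb_or ds // andbT.
  by apply: contraNneq xs => <-.
have uxt : uniq (x :: t) by rewrite /= xt ut.
have [m1 _] := IH t E1 us ut ds d1.
have [_ P1] := IH (x :: t) E1 us uxt ds' d1.
have [m0 P0] := IH t E0 us ut ds d0.
have [_ P0'] := IH (x :: t) E0 us uxt ds' d0.
have capx : \bigcap_(i in [set` x :: t]) [set w | X w i] =
    [set w | X w x] `&` \bigcap_(i in [set` t]) [set w | X w i].
  apply/seteqP; split => w /=.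
    move=> h; split; first by apply: h; rewrite /= inE eqxx.
    by move=> i /= it; apply: h; rewrite /= inE it orbT.
  by move=> [hx ht] i /=; rewrite inE => /orP[/eqP ->|/ht].
have mx := mX x; have mt := mcap t.
split.
  rewrite decE; apply: measurableU; apply: measurableI => //.
  exact: measurableC.
set A := \bigcap_(i in [set` t]) _ in P0 mt capx *.
rewrite capx in P1 P0'.
have -> : A `&` [set w | E (X w)] =
    (([set w | X w x] `&` A) `&` [set w | E1 (X w)]) `|`
    ((A `&` [set w | E0 (X w)]) `\` (([set w | X w x] `&` A) `&` [set w | E0 (X w)])).
  rewrite decE; apply/seteqP; split => w.
    move=> [Aw [[h1 h2]|[h1 h2]]]; [by left|right].
    by split => // -[[]].
  move=> [[[h1 h2] h3]|[[h1 h2] h3]].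
    by split => //; left.
  split => //; right; split => // h; exact: h3.
have mA0 : measurable (A `&` [set w | E0 (X w)]) by exact: measurableI.
have mxA : measurable ([set w | X w x] `&` A) by exact: measurableI.
rewrite measureU; first last.
- apply/seteqP; split => // w [[[h1 h2] h3] [[h4 h5] h6]].
  by apply: h6.
- by apply: measurableD => //; exact: measurableI.
- exact: measurableI.
rewrite measureD //; [|exact: measurableI|]; last first.
  by rewrite ltey_eq fin_num_measure.
have -> : (A `&` [set w | E0 (X w)]) `&`
    (([set w | X w x] `&` A) `&` [set w | E0 (X w)]) =
    ([set w | X w x] `&` A) `&` [set w | E0 (X w)].
  by apply/seteqP; split => w; [move=> [_ //]|move=> [[? ?] ?]; split].
transitivity ((p ^+ size (x :: t) * Pr (fun=> p) s E1)%:E +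
    ((p ^+ size t * Pr (fun=> p) s E0)%:E -
     (p ^+ size (x :: t) * Pr (fun=> p) s E0)%:E))%E.
  by congr (_ + (_ - _))%E; [exact: P1|exact: P0|exact: P0'].
rewrite -EFinB -EFinD; congr EFin.
have -> : Pr (fun=> p) s E0 = Pr (fun=> p) s E.
  apply: Ex_ext => Y Ys; congr ((nat_of_bool (asbool (E _)))%:R).
  apply/seteqP; split => y; first by case.
  move=> Yy; split => // e; move: xs; have := Ys _ Yy.
  by rewrite /= e => ->.
rewrite {4}/Pr /= -/(Pr _ s E1) -/(Pr _ s E) exprS.
by ring.
Qed.

Lemma transfer (s : seq (int * int)) (E : set site -> Prop) :
  uniq s -> dep_on s E ->
  P [set w | E (X w)] = (Pr (fun=> p) s E)%:E.
Proof.
move=> us dE; have [_] := @transfer_aux s [::] E us isT (fun _ _ => isT) dE.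
by rewrite /= set_nil bigcap_set0 setTI mul1r.
Qed.
End Transfer.

(** * The cost of a line *)

Section Calculus.
Context {R : realType}.
Implicit Types (f g : R -> R) (x a b : R).

Lemma der_id x : is_derive x 1 (fun y : R => y) 1.
Proof. exact: is_derive_id. Qed.

Lemma der_cst c x : is_derive x 1 (fun=> c : R) 0.
Proof. exact: is_derive_cst. Qed.

Lemma der_add f g x a b : is_derive x 1 f a -> is_derive x 1 g b ->
  is_derive x 1 (fun y => f y + g y) (a + b).
Proof. by move=> ? ?; exact: is_deriveD. Qed.

Lemma der_opp f x a : is_derive x 1 f a -> is_derive x 1 (fun y => - f y) (- a).
Proof. by move=> ?; exact: is_deriveN. Qed.

Lemma der_sub f g x a b : is_derive x 1 f a -> is_derive x 1 g b ->
  is_derive x 1 (fun y => f y - g y) (a - b).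
Proof. by move=> ? ?; exact: is_deriveB. Qed.

Lemma der_mul f g x a b : is_derive x 1 f a -> is_derive x 1 g b ->
  is_derive x 1 (fun y => f y * g y) (f x * b + g x * a).
Proof. by move=> ? ?; exact: is_deriveM. Qed.

Lemma der_scale c f x a : is_derive x 1 f a ->
  is_derive x 1 (fun y => c * f y) (c * a).
Proof.
move=> h; apply: (is_derive_eq (der_mul (der_cst c x) h)).
by rewrite mulr0 addr0.
Qed.

Lemma der_comp f g x a b : is_derive x 1 g b -> is_derive (g x) 1 f a ->
  is_derive x 1 (fun y => f (g y)) (a * b).
Proof. by move=> ? ?; exact: is_derive1_comp. Qed.

Lemma der_exp n x : is_derive x 1 (fun y : R => y ^+ n) (n%:R * x ^+ n.-1).
Proof.
elim: n => [|n IH].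
  by apply: (is_derive_eq (der_cst 1 x)); rewrite mul0r.
have := der_mul (der_id x) IH.
rewrite (_ : (fun y => y * y ^+ n) = (fun y : R => y ^+ n.+1)); last first.
  by apply/funext => y; rewrite exprS.
move=> h; apply: (is_derive_eq h).
case: n {IH h} => [|n] /=; first by rewrite !expr0; ring.
by rewrite exprS -[in RHS]natr1; ring.
Qed.

Lemma der_ln f x a : is_derive x 1 f a -> 0 < f x ->
  is_derive x 1 (fun y => ln (f y)) (a / f x).
Proof.
move=> h fx; rewrite mulrC.
by apply: (der_comp h); exact: is_derive1_ln.
Qed.

Lemma der_cont f x a : is_derive x 1 f a -> {for x, continuous f}.
Proof.
by move=> h; apply/differentiable_continuous/derivable1_diffP.
Qed.

(** The derivative is only asked in the open interval: [param_G] is differentiated below 1 and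
    merely continuous at 1. *)
Lemma mono_le f (df : R -> R) a b : a <= b ->
  (forall x, a < x < b -> is_derive x 1 f (df x) /\ 0 <= df x) ->
  (forall x, a <= x <= b -> {for x, continuous f}) -> f a <= f b.
Proof.
move=> ab d c; move: ab; rewrite le_eqVlt => /orP[/eqP -> //|ab].
have [||z zi e] := @MVT R f df a b ab.
- by move=> x; rewrite in_itv /= => xi; apply: (d x xi).1.
- apply: continuous_in_subspaceT => x; rewrite inE /= in_itv /= => xi.
  exact: c.
move: zi; rewrite in_itv /= => zi.
by rewrite -subr_ge0 e mulr_ge0 ?subr_ge0 ?(ltW ab) // (d z zi).2.
Qed.

Lemma mono_le_der f (df : R -> R) a b : a <= b ->
  (forall x, a <= x <= b -> is_derive x 1 f (df x) /\ 0 <= df x) -> f a <= f b.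
Proof.
move=> ab d; apply: (mono_le ab (df := df)) => x xi.
  by apply: d; move/andP: xi => [? ?]; rewrite !ltW.
exact: der_cont (d x xi).1.
Qed.
End Calculus.

Section Beta.
Context {R : realType}.
Implicit Types u b x z r : R.

(* The larger root of [b ^ 2 = u b + u (1 - u)]: among independent events of
   probability [u], the probability that no two consecutive ones fail decays
   like powers of [beta u]. *)
Definition beta u : R := (u + Num.sqrt (u * (4%:R - 3%:R * u))) / 2%:R.

Lemma beta_eq u : 0 <= u <= 1 -> beta u ^+ 2 = u * beta u + u * (1 - u).
Proof.
move=> /andP[u0 u1]; rewrite /beta; set s := Num.sqrt _.
have : s ^+ 2 = u * (4%:R - 3%:R * u).
  by apply: sqr_sqrtr; apply: mulr_ge0 => //; lra.
by move: s => s e; field: e.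
Qed.

Lemma beta_gt0 u : 0 < u -> 0 < beta u.
Proof. by move=> u0; rewrite /beta divr_gt0 // ltr_wpDr // sqrtr_ge0. Qed.

Lemma beta_uniq u b : 0 < u <= 1 -> 0 < b -> b ^+ 2 = u * b + u * (1 - u) ->
  b = beta u.
Proof.
move=> /andP[u0 u1] b0 eb.
have eB : beta u ^+ 2 = u * beta u + u * (1 - u) by apply: beta_eq; lra.
have B0 := beta_gt0 u0.
have /eqP : (b - beta u) * (b + beta u - u) = 0 by ring: eb eB.
rewrite mulf_eq0 => /orP[/eqP|/eqP] h; first lra.
by have h2 : b * beta u = - (u * (1 - u)); nra.
Qed.

Lemma beta_ge u : 0 <= u <= 1 -> u <= beta u.
Proof.
move=> /andP[u0 u1]; rewrite /beta ler_pdivlMr //.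
suff : u <= Num.sqrt (u * (4%:R - 3%:R * u)) by lra.
by rewrite -{1}(ger0_norm u0) -sqrtr_sqr ler_wsqrtr //; nra.
Qed.

Lemma beta_lt1 u : 0 < u < 1 -> beta u < 1.
Proof.
move=> /andP[u0 u1]; rewrite ltNge; apply/negP => b1.
have := @beta_eq u; rewrite !ltW // => /(_ isT) e; nra.
Qed.

Lemma beta_le1 u : 0 <= u <= 1 -> beta u <= 1.
Proof.
move=> /andP[u0 u1]; rewrite leNgt; apply/negP => b1.
have := @beta_eq u; rewrite u0 u1 => /(_ isT) e; nra.
Qed.

Lemma beta_le u v : 0 < u -> u <= v -> v <= 1 -> beta u <= beta v.
Proof.
move=> u0 uv v1; rewrite leNgt; apply/negP => lt.
have e1 : beta u ^+ 2 = u * beta u + u * (1 - u) by apply: beta_eq; lra.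
have e2 : beta v ^+ 2 = v * beta v + v * (1 - v) by apply: beta_eq; lra.
have h1 : beta u <= 1 by apply: beta_le1; lra.
have h2 : v <= beta v by apply: beta_ge; lra.
have h3 : 0 < beta u by apply: beta_gt0.
move: e1 e2 h1 h2 h3 lt; move: (beta u) (beta v) => b c e1 e2 h1 h2 h3 lt.
have : (b - c) * (b + c - u) = (u - v) * (c + 1 - u - v) by ring: e1 e2.
have k1 : 0 < (b - c) * (b + c - u) by apply: mulr_gt0; lra.
nra.
Qed.

Lemma beta_sqr_le u : 0 <= u <= 1 -> beta u ^+ 2 <= 2%:R * u.
Proof.
move=> /[dup] /andP[u0 u1] h; rewrite beta_eq //.
have := beta_le1 h; have := beta_ge h; nra.
Qed.

Definition cost z : R := - ln (beta (1 - expR (- z))).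

Lemma expRN_bd z : 0 < z -> 0 < 1 - expR (- z) < 1.
Proof.
move=> z0; have := expR_gt0 (- z).
have : expR (- z) < 1 by rewrite expR_lt1; lra.
lra.
Qed.

(* With [x = exp (- z)] and [y = beta (1 - x)], the ratio [r = y / x] is a
   rational parameter; [param_s] is [z] and [param_t] is [- ln y = cost z]. *)
Definition param_x r : R := (1 + r) / (1 + r + r ^+ 2).
Definition param_s r : R := ln (1 + r + r ^+ 2) - ln (1 + r).
Definition param_t r : R := param_s r - ln r.

Lemma param_den r : 0 < r -> 0 < 1 + r + r ^+ 2.
Proof. by move=> r0; nra. Qed.

Lemma param_x_bd r : 0 < r -> 0 < param_x r < 1.
Proof.
move=> r0; have d := param_den r0; rewrite /param_x; apply/andP; split.
  by apply: divr_gt0 => //; lra.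
by rewrite ltr_pdivrMr //; nra.
Qed.

Lemma param_sE r : 0 < r -> param_s r = - ln (param_x r).
Proof.
move=> r0; have d := param_den r0.
by rewrite /param_x ln_div ?posrE ?opprB //; lra.
Qed.

Lemma param_tE r : 0 < r -> param_t r = - ln (r * param_x r).
Proof.
move=> r0; have /andP[x0 _] := param_x_bd r0.
by rewrite /param_t param_sE // lnM ?posrE //; lra.
Qed.

Lemma param_s_gt0 r : 0 < r -> 0 < param_s r.
Proof. by move=> r0; rewrite param_sE // oppr_gt0 ln_lt0 // param_x_bd. Qed.

Lemma expR_param r : 0 < r -> expR (- param_s r) = param_x r.
Proof.
by move=> r0; have /andP[x0 _] := param_x_bd r0; rewrite param_sE // opprK lnK.
Qed.

(** The origin of [param_x]: with [y = r x], the equation [y ^ 2 = (1 - x) y + (1 - x) x] divided by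
    [x] becomes linear in [x]. *)
Lemma beta_param r : 0 < r -> beta (1 - param_x r) = r * param_x r.
Proof.
move=> r0; have /andP[x0 x1] := param_x_bd r0; symmetry; apply: beta_uniq.
- by lra.
- exact: mulr_gt0.
- have d := param_den r0; rewrite /param_x; field.
  by rewrite gt_eqF.
Qed.

Lemma cost_param r : 0 < r -> cost (param_s r) = param_t r.
Proof. by move=> r0; rewrite /cost expR_param // beta_param // param_tE. Qed.

Lemma param_exists z : 0 < z -> exists2 r, 0 < r & param_s r = z.
Proof.
move=> z0; set x := expR (- z); have x0 : 0 < x by exact: expR_gt0.
have x1 : x < 1 by rewrite expR_lt1; lra.
have b0 : 0 < beta (1 - x) by apply: beta_gt0; lra.
have be : beta (1 - x) ^+ 2 = (1 - x) * beta (1 - x) + (1 - x) * (1 - (1 - x)).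
  by apply: beta_eq; lra.
have p0 : 0 < beta (1 - x) / x by exact: divr_gt0.
exists (beta (1 - x) / x) => //.
rewrite param_sE // -[RHS]opprK; congr (- _).
rewrite -[RHS]expRK -/x; congr ln.
move: b0 be; set b := beta _ => b0 be.
have d : 0 < x ^+ 2 + x * b + b ^+ 2 by nra.
have -> : param_x (b / x) = x * (x + b) / (x ^+ 2 + x * b + b ^+ 2).
  rewrite /param_x; field; rewrite !gt_eqF //; nra.
have -> : x ^+ 2 + x * b + b ^+ 2 = x + b by ring: be.
by rewrite mulfK // gt_eqF //; lra.
Qed.

Lemma param_x_anti r r' : 0 < r -> r < r' -> param_x r' < param_x r.
Proof.
move=> r0 rr; have d := param_den r0.
have d' : 0 < 1 + r' + r' ^+ 2 by apply: param_den; lra.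
rewrite /param_x ltr_pdivrMr // mulrAC ltr_pdivlMr //.
have : 0 < (r' - r) * (r + r' + r * r') by apply: mulr_gt0; nra.
nra.
Qed.

Lemma param_s_mono r r' : 0 < r -> 0 < r' -> (param_s r <= param_s r') = (r <= r').
Proof.
move=> r0 r0'; have /andP[x0 _] := param_x_bd r0.
have /andP[x0' _] := param_x_bd r0'.
rewrite !param_sE // lerN2 ler_ln ?posrE //.
apply/idP/idP.
  by rewrite leNgt => h; rewrite leNgt; apply: contra h => /(param_x_anti r0').
by rewrite le_eqVlt => /orP[/eqP ->//|/(param_x_anti r0)/ltW].
Qed.

(** The equation between [x] and [y] reads [x ^ 2 + x y + y ^ 2 = x + y]. Its symmetry exchanges [r]
    and [1 / r], and this makes [cost] an involution. *)
Lemma param_x_inv r : 0 < r -> param_x r^-1 = r * param_x r.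
Proof.
move=> r0; have d := param_den r0.
by rewrite /param_x; field; rewrite !gt_eqF //; nra.
Qed.

Lemma param_s_inv r : 0 < r -> param_s r^-1 = param_t r.
Proof. by move=> r0; rewrite param_sE ?invr_gt0 // param_x_inv // param_tE. Qed.

Lemma param_t_inv r : 0 < r -> param_t r^-1 = param_s r.
Proof. by move=> r0; rewrite -param_s_inv ?invr_gt0 // invrK. Qed.

Lemma param_t_anti r r' : 0 < r -> r <= r' -> param_t r' <= param_t r.
Proof.
move=> r0 rr; have r0' : 0 < r' by lra.
by rewrite -!param_s_inv // param_s_mono ?invr_gt0 // lef_pV2.
Qed.

Lemma cost_gt0 z : 0 < z -> 0 < cost z.
Proof.
move=> z0; have h := expRN_bd z0; rewrite oppr_gt0 ln_lt0 //.
by rewrite beta_lt1 // beta_gt0 //; lra.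
Qed.

Lemma cost_anti z z' : 0 < z -> z <= z' -> cost z' <= cost z.
Proof.
move=> z0 zz; have z0' : 0 < z' by lra.
have [r r0 e] := param_exists z0; have [r' r0' e'] := param_exists z0'.
rewrite -e -e' in zz *.
by rewrite !cost_param // param_t_anti // -param_s_mono.
Qed.

Lemma costK z : 0 < z -> cost (cost z) = z.
Proof.
move=> z0; have [r r0 <-] := param_exists z0.
by rewrite cost_param // -param_s_inv // cost_param ?invr_gt0 // param_t_inv.
Qed.

(** Logarithmic divergence at 0: short lines are as costly as desired, whence the choice of [zeta]
    in [rect_estimate]. *)
Lemma cost_ge z : 0 < z -> - ln (2%:R * z) / 2%:R <= cost z.
Proof.
move=> z0; have h := expRN_bd z0; have b0 : 0 < beta (1 - expR (- z)) by
  apply: beta_gt0; lra.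
rewrite ler_pdivrMr // /cost mulNr lerN2 mulr_natr -lnXn // ler_ln ?posrE.
- apply: (le_trans (beta_sqr_le _)); first lra.
  by have := expR_ge1Dx (- z); lra.
- exact: exprn_gt0.
- lra.
Qed.

Lemma der_param_s r : 0 < r ->
  is_derive r 1 param_s
    ((2%:R * r + r ^+ 2) / ((1 + r) * (1 + r + r ^+ 2))).
Proof.
move=> r0; have d := param_den r0; have d' : 0 < 1 + r by lra.
have h1 := der_add (der_cst (1 : R) r) (der_id r).
have h2 := der_add h1 (der_exp 2 r).
apply: (is_derive_eq (der_sub (der_ln h2 d) (der_ln h1 d'))).
rewrite expr1; field; rewrite !gt_eqF //; lra.
Qed.

Lemma der_param_t r : 0 < r ->
  is_derive r 1 param_t
    ((2%:R * r + r ^+ 2) / ((1 + r) * (1 + r + r ^+ 2)) - r^-1).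
Proof.
move=> r0; apply: der_sub; first exact: der_param_s.
exact: is_derive1_ln.
Qed.

(** The slope [d param_t / d param_s], that is, the derivative of [cost] at [param_s r]. *)
Definition param_m r : R := - ((2%:R * r + 1) / (r ^+ 2 * (r + 2%:R))).

Lemma param_m_mono r r' : 0 < r -> r <= r' -> param_m r <= param_m r'.
Proof.
move=> r0 rr; have r0' : 0 < r' by lra.
rewrite /param_m lerN2 ler_pdivrMr; last by apply: mulr_gt0; [exact: exprn_gt0|lra].
rewrite mulrAC ler_pdivlMr; last by apply: mulr_gt0; [exact: exprn_gt0|lra].
have h1 : r ^+ 2 <= r' ^+ 2 by rewrite ler_pXn2r ?nnegrE //; lra.
have h2 : (2%:R * r' + 1) * (r + 2%:R) <= (2%:R * r + 1) * (r' + 2%:R) * (r' / r).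
  rewrite -ler_pdivrMr ?invr_gt0; last by apply: divr_gt0.
  rewrite invf_div mulrA ler_pdivrMr //.
  have k1 : 0 <= r * r' * (r' - r) by apply: mulr_ge0; [apply: mulr_ge0|]; lra.
  have k2 : 0 <= (r' - r) * (r' + r) by apply: mulr_ge0; lra.
  by lra.
have -> : (2%:R * r' + 1) * (r ^+ 2 * (r + 2%:R)) =
  ((2%:R * r' + 1) * (r + 2%:R)) * r ^+ 2 by ring.
apply: (le_trans (ler_wpM2r _ h2)); first exact: sqr_ge0.
have -> : (2%:R * r + 1) * (r' + 2%:R) * (r' / r) * r ^+ 2 =
  (2%:R * r + 1) * (r' + 2%:R) * (r' * r) by field; lra.
have -> : (2%:R * r + 1) * (r' ^+ 2 * (r' + 2%:R)) =
  (2%:R * r + 1) * (r' + 2%:R) * (r' * r') by ring.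
by apply: ler_wpM2l; [apply: mulr_ge0; lra|apply: ler_wpM2l; lra].
Qed.

Lemma der_param_tm r c : 0 < r ->
  is_derive r 1 (fun y => param_t y - c * param_s y)
    ((param_m r - c) * ((2%:R * r + r ^+ 2) / ((1 + r) * (1 + r + r ^+ 2)))).
Proof.
move=> r0; have d := param_den r0.
apply: (is_derive_eq (der_sub (der_param_t r0) (der_scale c (der_param_s r0)))).
rewrite /param_m; field; rewrite !gt_eqF //; nra.
Qed.

(** Convexity without second derivatives: by [der_param_tm] and [param_m_mono],
    [param_t - param_m r0 * param_s] decreases up to [r0] and increases afterwards. *)
Lemma param_tangent r0 r : 0 < r0 -> 0 < r ->
  param_t r0 + param_m r0 * (param_s r - param_s r0) <= param_t r.
Proof.
move=> p0 p.
suff : param_t r0 - param_m r0 * param_s r0 <= param_t r - param_m r0 * param_s r.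
  by lra.
have pos x : 0 < x -> 0 <= (2%:R * x + x ^+ 2) / ((1 + x) * (1 + x + x ^+ 2)).
  by move=> x0; apply: divr_ge0; [nra|apply: mulr_ge0; nra].
pose F := fun y => param_t y - param_m r0 * param_s y.
have [rr|rr] := leP r0 r.
  apply: (@mono_le_der R F _ r0 r rr) => x /andP[x1 x2].
  have x0 : 0 < x by lra.
  split; first exact: der_param_tm.
  by rewrite mulr_ge0 ?pos // subr_ge0 param_m_mono.
rewrite -lerN2; have rr' := ltW rr.
apply: (@mono_le_der R (fun y => - F y) _ r r0 rr') => x /andP[x1 x2].
have x0 : 0 < x by lra.
split; first by apply: der_opp; exact: der_param_tm.
by rewrite /= oppr_ge0 mulr_le0_ge0 ?pos // subr_le0 param_m_mono.
Qed.

(* [cost] is convex, as the slope [param_m] is increasing. *)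
Lemma cost_midpoint z h : 0 < z - h -> 0 <= h ->
  2%:R * cost z <= cost (z - h) + cost (z + h).
Proof.
move=> zh h0; have zh0 : 0 < z by lra.
have zh' : 0 < z + h by lra.
have [r r0 e] := param_exists zh0; have [r1 r10 e1] := param_exists zh.
have [r2 r20 e2] := param_exists zh'.
have := param_tangent r0 r10; have := param_tangent r0 r20.
by rewrite -!cost_param // e e1 e2; lra.
Qed.
End Beta.

(** * The sum of the inverse squares *)

Section Basel.
Context {R : realType}.
Implicit Types x : R.

Lemma sin_le_id x : 0 <= x -> sin x <= x.
Proof.
move=> x0; rewrite -subr_ge0.
have -> : 0 = 0 - sin 0 :> R by rewrite sin0 subr0.
apply: (@mono_le_der R (fun y => y - sin y) (fun y => 1 - cos y) 0 x x0) => y _.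
split; last by rewrite subr_ge0 cos_le1.
by apply: der_sub; exact: der_id.
Qed.

Lemma id_le_tan x : 0 <= x <= pi / 2%:R -> x * cos x <= sin x.
Proof.
move=> /andP[x0 xp]; rewrite -subr_ge0.
have -> : 0 = sin 0 - 0 * cos 0 :> R by rewrite sin0 mul0r subr0.
apply: (@mono_le_der R (fun y => sin y - y * cos y) (fun y => y * sin y) 0 x x0).
move=> y /andP[y0 yx]; split; last first.
  by rewrite mulr_ge0 // sin_ge0_pi //; have := @pi_gt0 R; lra.
apply: (is_derive_eq (der_sub (is_derive_sin y)
  (der_mul (der_id y) (is_derive_cos y)))).
by ring.
Qed.

Lemma sin_half x : 0 < x < pi ->
  (sin x ^+ 2)^-1 = ((sin (x / 2%:R) ^+ 2)^-1 + (sin ((pi - x) / 2%:R) ^+ 2)^-1) / 4%:R.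
Proof.
move=> /andP[x0 xp]; set y := x / 2%:R.
have e : (pi - x) / 2%:R = pi / 2%:R - y by rewrite /y; field.
have y0 : 0 < y by rewrite /y; lra.
have y1 : y < pi / 2%:R by rewrite /y; lra.
have s0 : 0 < sin y by apply: sin_gt0_pi; have := @pi_gt0 R; lra.
have c0 : 0 < cos y by apply: cos_gt0_pihalf; have := @pi_gt0 R; lra.
rewrite e sinB sin_pihalf cos_pihalf mul1r mul0r subr0.
have -> : x = y *+ 2 by rewrite /y; field.
rewrite sin_mulr2n; have := cos2Dsin2 y; move: s0 c0.
move: (sin y) (cos y) => s c s0 c0 e1.
have -> : (s ^+ 2)^-1 + (c ^+ 2)^-1 = (c ^+ 2 + s ^+ 2) / (s * c) ^+ 2.
  by field; rewrite !gt_eqF.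
by rewrite e1; field; rewrite !gt_eqF.
Qed.

(** Hofbauer's computation of the sum: iterating [sin_half] from [pi / 2] produces the odd multiples
    of [pi / 2 ^ (n + 2)] below [pi / 2]. *)
Definition hof_angle (n k : nat) : R := (2 * k + 1)%:R * pi / (2 ^ n.+2)%:R.

Lemma hof_angle_bd n k : (k < 2 ^ n)%N -> 0 < hof_angle n k < pi / 2%:R.
Proof.
move=> kn; have P : 0 < (2 ^ n.+2)%:R :> R by rewrite ltr0n expn_gt0.
have p0 := @pi_gt0 R; rewrite /hof_angle; apply/andP; split.
  by apply: divr_gt0 => //; apply: mulr_gt0 => //; rewrite ltr0n; lia.
rewrite ltr_pdivrMr //.
have -> : pi / 2%:R * (2 ^ n.+2)%:R = (2 * 2 ^ n)%:R * pi :> R.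
  by rewrite !expnS !natrM; field.
rewrite ltr_pM2r // ltr_nat; lia.
Qed.

Lemma hof_sum n :
  \sum_(k < 2 ^ n) (sin (hof_angle n k) ^+ 2)^-1 = 2%:R * 4%:R ^+ n :> R.
Proof.
elim: n => [|n IH].
  rewrite expn0 big_ord1 expr0 mulr1.
  have -> : hof_angle 0 0 = pi / 2%:R / 2%:R.
    by rewrite /hof_angle; field.
  have p0 := @pi_gt0 R.
  have := @sin_half (pi / 2%:R); rewrite sin_pihalf expr1n invr1.
  have -> : (pi - pi / 2%:R) / 2%:R = pi / 2%:R / 2%:R :> R by field.
  by move=> h; have {h} := h ltac:(lra); lra.
rewrite exprS mulrCA -IH mulr_sumr expnS mul2n -addnn big_split_ord /=.
(* The two halves of angle number [k] have indices [k] and [2 ^ (n + 1) - 1 - k]; reversing the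
   second half of the sum pairs them. *)
rewrite [X in _ + X](reindex_inj rev_ord_inj) /= -big_split /=.
apply: eq_bigr => k _.
have kn := ltn_ord k; have /andP[a0 a1] := hof_angle_bd kn.
have P : (2 ^ n)%:R != 0 :> R by rewrite pnatr_eq0 -lt0n expn_gt0.
rewrite [in RHS]sin_half; last by lra.
have -> : hof_angle n k / 2%:R = hof_angle n.+1 k.
  by rewrite /hof_angle !expnS !natrM; field.
have -> : (pi - hof_angle n k) / 2%:R = hof_angle n.+1 (2 ^ n + (2 ^ n - k.+1)).
  rewrite /hof_angle.
  have -> : (2 * (2 ^ n + (2 ^ n - k.+1)) + 1 = 4 * 2 ^ n - (2 * k + 1))%N by lia.
  rewrite natrB; last by lia.
  by rewrite !expnS !natrM; field.
by rewrite [RHS]mulrC divfK.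
Qed.

(* Squeezed by [sin a <= a <= tan a]. *)
Lemma odd_sum_bd n :
  (@pi R) ^+ 2 / 8%:R * (1 - (2 ^ n.+1)%:R^-1) <=
  \sum_(k < 2 ^ n) ((2 * k + 1)%:R ^+ 2)^-1 <= (@pi R) ^+ 2 / 8%:R.
Proof.
have p0 := @pi_gt0 R.
have P : 0 < (2 ^ n)%:R :> R by rewrite ltr0n expn_gt0.
have E4 : 4%:R ^+ n = (2 ^ n)%:R ^+ 2 :> R.
  by rewrite -!natrX -expnM mulnC expnM.
have EA (k : nat) : ((2 * k + 1)%:R ^+ 2)^-1 =
    (hof_angle n k ^+ 2)^-1 * (pi ^+ 2 / 16%:R / (2 ^ n)%:R ^+ 2).
  have K : 0 < (2 * k + 1)%:R :> R by rewrite ltr0n; lia.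
  rewrite /hof_angle !expnS !(natrM, natrD).
  move: K P p0; rewrite !(natrM, natrD); move: (2 ^ n)%:R (@pi R) (k%:R : R).
  move=> m q k' K P p0.
  by field; rewrite !gt_eqF.
under eq_bigr do rewrite EA.
rewrite -mulr_suml.
have up : \sum_(k < 2 ^ n) (hof_angle n k ^+ 2)^-1 <=
    \sum_(k < 2 ^ n) (sin (hof_angle n k) ^+ 2)^-1.
  apply: ler_sum => k _; have /andP[a0 a1] := hof_angle_bd (ltn_ord k).
  have s0 : 0 < sin (hof_angle n k) by apply: sin_gt0_pi; lra.
  rewrite lef_pV2 ?posrE ?exprn_gt0 //.
  have h := sin_le_id (ltW a0).
  by rewrite ler_pXn2r ?nnegrE //; lra.
have lo : \sum_(k < 2 ^ n) ((sin (hof_angle n k) ^+ 2)^-1 - 1) <=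
    \sum_(k < 2 ^ n) (hof_angle n k ^+ 2)^-1.
  apply: ler_sum => k _; have /andP[a0 a1] := hof_angle_bd (ltn_ord k).
  have s0 : 0 < sin (hof_angle n k) by apply: sin_gt0_pi; lra.
  have c0 : 0 < cos (hof_angle n k) by apply: cos_gt0_pihalf; lra.
  have := @id_le_tan (hof_angle n k); rewrite (ltW a0) (ltW a1) => /(_ isT).
  have := cos2Dsin2 (hof_angle n k).
  move: (hof_angle n k) s0 c0 a0 => a; move: (sin a) (cos a) => s c.
  move=> s0 c0 a0 e1 h.
  have -> : (s ^+ 2)^-1 - 1 = c ^+ 2 / s ^+ 2.
    have -> : c ^+ 2 = 1 - s ^+ 2 by lra.
    by field; rewrite gt_eqF.
  rewrite ler_pdivrMr ?exprn_gt0 // mulrC ler_pdivlMr ?exprn_gt0 //.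
  have ac : 0 <= a * c by apply: mulr_ge0; lra.
  by rewrite -exprMn ler_pXn2r ?nnegrE //; lra.
rewrite hof_sum E4 in up.
rewrite sumrB hof_sum sumr_const card_ord E4 in lo.
set S := \sum_(k < 2 ^ n) (hof_angle n k ^+ 2)^-1 in up lo *.
rewrite expnS natrM mulrA; set c := pi ^+ 2 / 16%:R.
have c0 : 0 < c by apply: divr_gt0 => //; exact: exprn_gt0.
have -> : pi ^+ 2 / 8%:R = 2%:R * c by rewrite /c; field.
move: up lo; set m := (2 ^ n)%:R in P *; move=> up lo.
apply/andP; split.
  rewrite ler_pdivlMr ?exprn_gt0 //.
  have -> : 2%:R * c * (1 - (2%:R * m)^-1) * m ^+ 2 = (2%:R * m ^+ 2 - m) * c.
    by field; rewrite gt_eqF.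
  by apply: ler_wpM2r; [exact: ltW|lra].
rewrite ler_pdivrMr ?exprn_gt0 //.
have -> : 2%:R * c * m ^+ 2 = 2%:R * m ^+ 2 * c by ring.
by apply: ler_wpM2r; [exact: ltW|lra].
Qed.

Definition zsum (n : nat) : R := \sum_(0 <= k < n) (k.+1%:R ^+ 2)^-1.

Lemma zsum_mono m n : (m <= n)%N -> zsum m <= zsum n.
Proof.
move=> mn; rewrite /zsum (big_cat_nat _ mn) //= lerDl sumr_ge0 //.
Qed.

Lemma zsum_double n :
  zsum n.*2 = \sum_(0 <= k < n) ((2 * k + 1)%:R ^+ 2)^-1 + zsum n / 4%:R.
Proof.
elim: n => [|n IH]; first by rewrite /zsum !big_geq // mul0r addr0.
have zS m : zsum m.+1 = zsum m + (m.+1%:R ^+ 2)^-1.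
  by rewrite /zsum big_nat_recr.
rewrite doubleS !zS IH big_nat_recr //=.
have -> : n.*2.+1%:R = (2 * n + 1)%:R :> R by congr (_%:R); lia.
have -> : n.*2.+2%:R = 2%:R * n.+1%:R :> R by rewrite -natrM; congr (_%:R); lia.
have n0 : n.+1%:R != 0 :> R by rewrite pnatr_eq0.
have n1 : (2 * n + 1)%:R != 0 :> R by rewrite pnatr_eq0; lia.
move: n0 n1; move: (n.+1%:R : R) ((2 * n + 1)%:R : R) => a b a0 b0.
by field; rewrite a0 b0.
Qed.

Lemma zsum_pow2 n : zsum (2 ^ n.+1) =
  \sum_(k < 2 ^ n) ((2 * k + 1)%:R ^+ 2)^-1 + zsum (2 ^ n) / 4%:R.
Proof. by rewrite expnS mul2n zsum_double big_mkord. Qed.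

Lemma zsum_le n : zsum n <= pi ^+ 2 / 6%:R.
Proof.
have H m : zsum (2 ^ m) <= pi ^+ 2 / 6%:R.
  elim: m => [|m IH].
    rewrite expn0 /zsum big_nat1 expr1n invr1.
    have /andP[_] := odd_sum_bd 0; rewrite expn0 big_ord1 expr1n invr1; lra.
  rewrite zsum_pow2; have /andP[_ h] := odd_sum_bd m; lra.
apply: le_trans (H n); apply: zsum_mono; apply: ltnW; exact: ltn_expl.
Qed.

Lemma zsum_ge n : pi ^+ 2 / 6%:R - pi ^+ 2 / 4%:R / (2 ^ n)%:R <= zsum (2 ^ n).
Proof.
elim: n => [|n IH].
  rewrite expn0 /zsum big_nat1 expr1n invr1.
  have : 0 <= (@pi R) ^+ 2 by exact: sqr_ge0.
  by lra.
rewrite zsum_pow2; have /andP[h _] := odd_sum_bd n.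
have P : 0 < (2 ^ n)%:R :> R by rewrite ltr0n expn_gt0.
move: h IH; rewrite expnS natrM invfM.
set m := (2 ^ n)%:R^-1; set p2 := pi ^+ 2; set S := \sum_(_ < _) _.
have p0 : 0 <= p2 by exact: exprn_ge0 (ltW (@pi_gt0 R)).
have m0 : 0 <= m by rewrite invr_ge0 ltW.
have pm : 0 <= p2 * m by exact: mulr_ge0.
by lra.
Qed.

Lemma zsum_near (e : R) : 0 < e -> exists n, pi ^+ 2 / 6%:R - e < zsum n.
Proof.
move=> e0; set c := pi ^+ 2 / 4%:R : R.
have c0 : 0 < c by apply: divr_gt0 => //; apply: exprn_gt0; exact: pi_gt0.
pose n := (Num.truncn (c / e)).+1.
exists (2 ^ n)%N; apply: lt_le_trans (zsum_ge n); rewrite -/c.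
rewrite ltrD2l ltrN2 ltr_pdivrMr ?ltr0n ?expn_gt0 // mulrC -ltr_pdivrMr //.
apply: (@lt_trans _ _ n%:R); last by rewrite ltr_nat ltn_expl.
exact: truncnS_gt.
Qed.
End Basel.

(** * The integral of the cost *)

Section Dilogarithm.
Context {R : realType}.
Implicit Types x r y e : R.

(** At 0 the convention [0^-1 = 0] removes the constant term. *)
Definition dilog_coef (n : nat) : R := (n%:R ^+ 2)^-1.

(** The series serves below 1 only. The constant value from 1 on is its sum at 1, so that continuity
    at 1 is a matter of the left limit. *)
Definition dilog x : R :=
  if x < 1 then limn (pseries dilog_coef x) else pi ^+ 2 / 6%:R.

Lemma series_geom_cvg (u : nat -> R) x : 0 <= x < 1 ->
  (forall n, 0 <= u n <= 1) -> cvgn (pseries u x).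
Proof.
move=> /andP[x0 x1] u01; apply: (@series_le_cvg _ _ (geometric 1 x)).
- by move=> n; have /andP[? _] := u01 n; rewrite mulr_ge0 // exprn_ge0.
- by move=> n; rewrite /geometric /= mul1r exprn_ge0.
- move=> n; have /andP[? ?] := u01 n.
  by rewrite /geometric /= ler_wpM2r // exprn_ge0.
- by apply: is_cvg_geometric_series; rewrite ger0_norm.
Qed.

Lemma dilog_coef_bd n : 0 <= dilog_coef n <= 1.
Proof.
rewrite /dilog_coef; case: n => [|n]; first by rewrite expr0n /= invr0 lexx ler01.
rewrite invr_ge0 exprn_ge0 // invf_le1 ?exprn_gt0 //.
by rewrite exprn_ege1 // ler1n.
Qed.

Lemma diffs_dilog n : pseries_diffs dilog_coef n = n.+1%:R^-1.
Proof.
have n0 : n.+1%:R != 0 :> R by rewrite pnatr_eq0.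
by rewrite /pseries_diffs /dilog_coef; field; rewrite addrC natr1.
Qed.

Lemma diffs2_dilog n :
  0 <= pseries_diffs (pseries_diffs dilog_coef) n <= 1.
Proof.
have -> : pseries_diffs (pseries_diffs dilog_coef) n =
  n.+1%:R * pseries_diffs dilog_coef n.+1 by [].
rewrite diffs_dilog.
rewrite divr_ge0 //= ler_pdivrMr // mul1r ler_nat //.
Qed.

Lemma dilog_partial x n : 0 <= x < 1 ->
  \sum_(0 <= k < n) dilog_coef k * x ^+ k <= dilog x.
Proof.
move=> /[dup] x01 /andP[x0 x1]; rewrite /dilog x1.
apply: (@nondecreasing_cvgn_le _ (pseries dilog_coef x)).
  apply: nondecreasing_series => k _ _.
  by have /andP[? _] := dilog_coef_bd k; rewrite mulr_ge0 // exprn_ge0.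
exact: series_geom_cvg x01 dilog_coef_bd.
Qed.

Lemma dilog_le x : 0 <= x < 1 -> dilog x <= x * (pi ^+ 2 / 6%:R).
Proof.
move=> /[dup] x01 /andP[x0 x1]; rewrite /dilog x1.
suff H n : \sum_(0 <= k < n) dilog_coef k * x ^+ k <= x * (pi ^+ 2 / 6%:R).
  apply: limr_le; first exact: series_geom_cvg x01 dilog_coef_bd.
  by near=> n; exact: H.
apply: (@le_trans _ _ (x * zsum n)); last first.
  by rewrite ler_wpM2l // zsum_le.
case: n => [|n]; first by rewrite /zsum !big_geq // mulr0.
rewrite big_nat_recl //= {1}/dilog_coef expr0n /= invr0 mul0r add0r.
apply: (@le_trans _ _ (x * zsum n)); last first.
  by rewrite ler_wpM2l // zsum_mono.
rewrite /zsum mulr_sumr; apply: ler_sum => k _.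
rewrite /dilog_coef mulrC; apply: ler_wpM2r.
  by rewrite invr_ge0 exprn_ge0.
by rewrite exprS ler_piMr // exprn_ile1 // ltW.
Unshelve. all: by end_near. Qed.

Lemma dilog_ge0 x : 0 <= x < 1 -> 0 <= dilog x.
Proof. by move=> /(dilog_partial 0); rewrite big_geq. Qed.

(** The remainder [D] has derivative [y ^ n / (1 - y)], the tail of the geometric series, which
    increases on [0, x]. *)
Lemma log_series x n : 0 <= x < 1 ->
  0 <= - ln (1 - x) - x * \sum_(0 <= k < n) k.+1%:R^-1 * x ^+ k
    <= x ^+ n / (1 - x).
Proof.
move=> /andP[x0 x1].
pose D y := - ln (1 - y) - \sum_(0 <= k < n) k.+1%:R^-1 * y ^+ k.+1.
have DE y : - ln (1 - y) - y * \sum_(0 <= k < n) k.+1%:R^-1 * y ^+ k = D y.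
  rewrite /D; congr (_ - _); rewrite mulr_sumr; apply: eq_bigr => k _.
  by rewrite exprS mulrCA.
have D0 : D 0 = 0.
  rewrite /D subr0 ln1 oppr0 sub0r big1 ?oppr0 // => k _.
  by rewrite expr0n /= mulr0.
have dD y : 0 <= y < 1 -> is_derive y 1 D (y ^+ n / (1 - y)).
  move=> /andP[y0 y1].
  have dS m : is_derive y 1 (fun y => \sum_(0 <= k < m) k.+1%:R^-1 * y ^+ k.+1)
      ((1 - y ^+ m) / (1 - y)).
    elim: m => [|m IH].
      rewrite (_ : (fun y => _) = fun=> 0); last first.
        by apply/funext => z; rewrite big_geq.
      by rewrite expr0 subrr mul0r; exact: der_cst.
    rewrite (_ : (fun y => _) = fun y =>
      (\sum_(0 <= k < m) k.+1%:R^-1 * y ^+ k.+1) + m.+1%:R^-1 * y ^+ m.+1);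
      last by apply/funext => z; rewrite big_nat_recr.
    have m0 : m.+1%:R != 0 :> R by rewrite pnatr_eq0.
    apply: (is_derive_eq (der_add IH (der_scale m.+1%:R^-1 (der_exp m.+1 y)))).
    rewrite mulrA mulVf // mul1r /= exprS.
    by field; rewrite subr_eq0 gt_eqF.
  have y1' : 0 < 1 - y by lra.
  apply: (is_derive_eq (der_sub (der_opp (der_ln
    (der_sub (der_cst (1 : R) y) (der_id y)) y1')) (dS n))).
  by field; rewrite subr_eq0 gt_eqF.
rewrite DE; apply/andP; split.
  rewrite -D0; apply: (@mono_le_der R D (fun y => y ^+ n / (1 - y)) 0 x x0).
  move=> y /andP[y0 yx]; split; first by apply: dD; lra.
  by apply: divr_ge0; [exact: exprn_ge0|lra].
pose E y := x ^+ n / (1 - x) * y - D y.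
have : E 0 <= E x.
  apply: (@mono_le_der R E (fun y => x ^+ n / (1 - x) * 1 - y ^+ n / (1 - y)) 0 x x0).
  move=> y /andP[y0 yx]; split.
    have y01 : 0 <= y < 1 by lra.
    exact: (der_sub (der_scale (x ^+ n / (1 - x)) (der_id y)) (dD y y01)).
  rewrite mulr1 subr_ge0.
  rewrite ler_pM ?exprn_ge0 ?invr_ge0 //; try lra.
    by rewrite lerXn2r ?nnegrE.
  by rewrite lef_pV2 ?posrE; lra.
rewrite /E D0 mulr0 subr0 subr_ge0 => /le_trans; apply.
by rewrite ler_piMr; [|apply: divr_ge0; [exact: exprn_ge0|lra]|lra].
Qed.

Lemma lim_log_series x : 0 < x < 1 ->
  limn (pseries (pseries_diffs dilog_coef) x) = - ln (1 - x) / x.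
Proof.
move=> /andP[x0 x1]; apply: cvg_lim => //.
have gc : ((x ^+ n / (1 - x) / x) @[n --> \oo] --> (0 : R)).
  have : ((1 - x)^-1 / x * x ^+ n) @[n --> \oo] --> ((1 - x)^-1 / x * 0 : R).
    by apply: cvgM; [exact: cvg_cst|apply: cvg_expr; rewrite ger0_norm ?ltW].
  rewrite mulr0; apply: cvg_trans; apply: near_eq_cvg; near=> n.
  by rewrite mulrC -mulrA mulrC.
have lo : ((- ln (1 - x) / x - x ^+ n / (1 - x) / x) @[n --> \oo] -->
    (- ln (1 - x) / x : R)).
  by rewrite -[X in _ --> X]subr0; apply: cvgB => //; exact: cvg_cst.
apply: (squeeze_cvgr _ lo (cvg_cst _)).
near=> n; rewrite /pseries /series /=.
have -> : \sum_(0 <= k < n) pseries_diffs dilog_coef k * x ^+ k =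
    \sum_(0 <= k < n) k.+1%:R^-1 * x ^+ k.
  by apply: eq_bigr => k _; rewrite diffs_dilog.
have := @log_series x n; rewrite ltW // x1 => /(_ isT) /andP[h1 h2].
by apply/andP; split;
  [rewrite -mulrBl ler_pdivrMr | rewrite ler_pdivlMr] => //; lra.
Unshelve. all: by end_near. Qed.

Lemma der_dilog x : 0 < x < 1 -> is_derive x 1 dilog (- ln (1 - x) / x).
Proof.
move=> /[dup] x01 /andP[x0 x1].
pose K := (x + 1) / 2%:R.
have K01 : 0 <= K < 1 by rewrite /K; lra.
apply: (@near_eq_is_derive _ _ _ (fun y => limn (pseries dilog_coef y))).
  near=> y; rewrite /dilog ifT //.
  by near: y; exact: lt_nbhsl.
rewrite -lim_log_series //; apply: (@pseries_snd_diffs _ _ K).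
- exact: series_geom_cvg dilog_coef_bd.
- apply: series_geom_cvg => // n; rewrite diffs_dilog.
  by rewrite invr_ge0 ler0n invf_le1 ?ler1n ?ltr0n.
- exact: series_geom_cvg diffs2_dilog.
- by rewrite !ger0_norm //; rewrite /K; lra.
Unshelve. all: by end_near. Qed.

Lemma bernoulli_ineq x n : 0 <= x <= 1 -> 1 - n%:R * (1 - x) <= x ^+ n.
Proof.
move=> /andP[x0 x1]; elim: n => [|n IH]; first by rewrite expr0 mul0r subr0.
rewrite exprS -natr1; have n0 : 0 <= n%:R :> R by [].
have : x * (1 - n%:R * (1 - x)) <= x * x ^+ n by exact: ler_wpM2l.
have : 0 <= n%:R * (1 - x) * (1 - x) by apply: mulr_ge0; [apply: mulr_ge0|]; lra.
by lra.
Qed.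

(** By Bernoulli's inequality, replacing 1 by [y] costs each term at most [1 - y], so [n] terms stay
    within [n (1 - y)] of [zsum n], itself close to the full sum. *)
Lemma dilog_cont1 : {for 1, continuous dilog}.
Proof.
have d1 : dilog 1 = pi ^+ 2 / 6%:R by rewrite /dilog ltxx.
apply/cvgrPdist_le => e e0; rewrite d1.
have [n hn] := @zsum_near R (e / 2%:R) ltac:(lra).
pose d := Num.min (1 / 2%:R) (e / 2%:R / n.+1%:R).
have d0 : 0 < d.
  by rewrite /d lt_min; apply/andP; split; [lra|]; apply: divr_gt0 => //; lra.
near=> y.
have yd : `|1 - y| < d by near: y; exact: (@nbhsx_ballx _ _ (1 : R) d d0).
have [y1|y1] := ltP y 1; last first.
  by rewrite /dilog ltNge y1 subrr normr0 ltW.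
have dh : d <= 1 / 2%:R by rewrite /d ge_min lexx.
have dn : d <= e / 2%:R / n.+1%:R by rewrite /d ge_min lexx orbT.
have yd' : 1 - y < d by move: yd; rewrite ger0_norm //; lra.
have y0 : 0 <= y by lra.
have y01 : 0 <= y < 1 by rewrite y0 y1.
rewrite ger0_norm; last first.
  rewrite subr_ge0; apply: (le_trans (dilog_le y01)).
  rewrite ler_piMl // ?(ltW y1) // divr_ge0 // exprn_ge0 // pi_ge0 //.
have := dilog_partial n.+1 y01; rewrite big_nat_recl //= {1}/dilog_coef.
rewrite expr0n /= invr0 mul0r add0r => h.
suff : zsum n - n%:R * (1 - y) <=
    \sum_(0 <= i < n) dilog_coef i.+1 * y ^+ i.+1.
  have : n%:R * (1 - y) <= e / 2%:R.
    apply: (@le_trans _ _ (n.+1%:R * d)).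
      by apply: ler_pM => //; [lra|rewrite ler_nat|lra].
    by rewrite mulrC -ler_pdivlMr.
  by lra.
have -> : n%:R * (1 - y) = \sum_(0 <= i < n) (1 - y).
  by rewrite sumr_const_nat subn0 mulr_natl.
rewrite /zsum -sumrB; apply: ler_sum => i _.
rewrite /dilog_coef; have i0 : 1 <= i.+1%:R :> R by rewrite ler1n.
have b : 1 - i.+1%:R * (1 - y) <= y ^+ i.+1.
  by apply: bernoulli_ineq; rewrite y0 ltW.
move: i0 b; move: (i.+1%:R : R) => m m1 b.
have m0 : 0 < m by lra.
rewrite mulrC ler_pdivlMr ?exprn_gt0 //.
apply: le_trans b; rewrite mulrBl mulVf; last by rewrite gt_eqF // exprn_gt0.
have : 0 <= (m - 1) * m * (1 - y) by do 2?[apply: mulr_ge0]; lra.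
by lra.
Unshelve. all: by end_near. Qed.
End Dilogarithm.

Section CostIntegral.
Context {R : realType}.
Implicit Types r z e h d : R.

Definition param_ds r : R :=
  (2%:R * r + r ^+ 2) / ((1 + r) * (1 + r + r ^+ 2)).

(* A primitive of [param_t d(param_s)] on (0, 1]. *)
Definition param_G r : R := - (param_s r * ln r) + param_s r ^+ 2 / 2%:R
  + dilog (r ^+ 2) / 2%:R - dilog (r ^+ 3) / 3%:R.

Lemma param_ds_ge0 r : 0 < r -> 0 <= param_ds r.
Proof.
move=> r0; have d := param_den r0; apply: divr_ge0; last by apply: mulr_ge0; lra.
by have : 0 <= r ^+ 2 := sqr_ge0 r; lra.
Qed.

(** Integrating [- ln r d(param_s)] by parts leaves the integrand [param_s r / r]. Since [param_s r
    = ln (1 - r ^ 3) - ln (1 - r ^ 2)], the two dilogarithms are its primitive; the terms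
    [ln (1 - r)] cancel. *)
Lemma der_param_G r : 0 < r < 1 ->
  is_derive r 1 param_G (param_t r * param_ds r).
Proof.
move=> /andP[r0 r1]; have d := param_den r0.
have r2 : 0 < r ^+ 2 < 1 by rewrite exprn_gt0 // exprn_ilt1 // ltW.
have r3 : 0 < r ^+ 3 < 1 by rewrite exprn_gt0 // exprn_ilt1 // ltW.
have ds := der_param_s r0.
have dln : is_derive r 1 (@ln R) r^-1 by exact: is_derive1_ln.
have d1 := der_opp (der_mul ds dln).
have d2 := der_scale 2%:R^-1 (der_mul ds ds).
have d3 := der_scale 2%:R^-1 (der_comp (der_exp 2 r) (der_dilog r2)).
have d4 := der_scale 3%:R^-1 (der_comp (der_exp 3 r) (der_dilog r3)).
have E : param_G = fun y => - (param_s y * ln y) + 2%:R^-1 * (param_s y * param_s y)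
    + 2%:R^-1 * dilog (y ^+ 2) - 3%:R^-1 * dilog (y ^+ 3).
  by apply/funext => y; rewrite /param_G; field.
rewrite E; apply: (is_derive_eq (der_sub (der_add (der_add d1 d2) d3) d4)).
rewrite -/(param_ds r) /param_t /=.
have e2 : ln (1 - r ^+ 2) = ln (1 - r) + ln (1 + r).
  by rewrite -lnM ?posrE; [congr ln; ring|lra|lra].
have e3 : ln (1 - r ^+ 3) = ln (1 - r) + ln (1 + r + r ^+ 2).
  by rewrite -lnM ?posrE //; [congr ln; ring|lra].
rewrite e2 e3 /param_s.
move: (ln (1 - r)) (ln (1 + r)) (ln (1 + r + r ^+ 2)) (ln r) (param_ds r).
by move=> a b c e f; field; rewrite gt_eqF.
Qed.

Lemma param_G_cont r : 0 < r <= 1 -> {for r, continuous param_G}.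
Proof.
move=> /andP[r0]; rewrite le_eqVlt => /orP[/eqP ->|r1]; last first.
  by apply: (der_cont (der_param_G _)); rewrite r0 r1.
have c1 : {for 1, continuous (@param_s R)} := der_cont (der_param_s ltr01).
have c2 : {for (1 : R), continuous (@ln R)} by apply: continuous_ln.
have ce n : {for (1 : R), continuous (fun y : R => y ^+ n)} :=
  der_cont (der_exp n (1 : R)).
have cd n : {for (1 : R), continuous (fun y : R => dilog (y ^+ n))}.
  apply: (@continuous_comp _ _ _ (fun y : R => y ^+ n) (@dilog R) 1 (ce n)).
  by rewrite expr1n; exact: dilog_cont1.
rewrite /param_G; apply: cvgB; last first.
  by apply: cvgM; [exact: cd|exact: cvg_cst].
apply: cvgD; last by apply: cvgM; [exact: cd|exact: cvg_cst].
apply: cvgD.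
  by apply: cvgN; apply: cvgM.
by apply: cvgM; [|exact: cvg_cst]; rewrite expr2; apply: cvgM.
Qed.

(** Does the work of an integral: as [param_t] decreases, the increment of the primitive lies
    between two rectangles, which is what Riemann sums require. *)
Lemma param_G_bounds r1 r2 : 0 < r1 -> r1 <= r2 -> r2 <= 1 ->
  param_t r2 * (param_s r2 - param_s r1) <= param_G r2 - param_G r1
    <= param_t r1 * (param_s r2 - param_s r1).
Proof.
move=> r10 r12 r21.
have cs (c y : R) : r1 <= y <= r2 -> {for y, continuous (fun y => c * param_s y)}.
  move=> /andP[? ?]; have y0 : 0 < y by lra.
  exact: (der_cont (der_scale c (der_param_s y0))).
have cG (y : R) : r1 <= y <= r2 -> {for y, continuous param_G}.
  by move=> /andP[? ?]; apply: param_G_cont; lra.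
pose E (y : R) := param_t r1 * param_s y - param_G y.
pose F (y : R) := param_G y - param_t r2 * param_s y.
have hE : E r1 <= E r2.
  apply: (@mono_le R E (fun y => param_t r1 * param_ds y - param_t y * param_ds y)
    r1 r2 r12) => y hy.
    have y0 : 0 < y by lra.
    have y01 : 0 < y < 1 by lra.
    split; first exact: (der_sub (der_scale _ (der_param_s y0)) (der_param_G y01)).
    rewrite -mulrBl mulr_ge0 ?param_ds_ge0 // subr_ge0 param_t_anti //; lra.
  by apply: cvgB; [exact: cs|exact: cG].
have hF : F r1 <= F r2.
  apply: (@mono_le R F (fun y => param_t y * param_ds y - param_t r2 * param_ds y)
    r1 r2 r12) => y hy.
    have y0 : 0 < y by lra.
    have y01 : 0 < y < 1 by lra.
    split; first exact: (der_sub (der_param_G y01) (der_scale _ (der_param_s y0))).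
    rewrite -mulrBl mulr_ge0 ?param_ds_ge0 // subr_ge0 param_t_anti //; lra.
  by apply: cvgB; [exact: cG|exact: cs].
by move: hE hF; rewrite /E /F; lra.
Qed.

Lemma param_s_le r : 0 < r -> param_s r <= r ^+ 2.
Proof.
move=> r0; have d := param_den r0; have r2 : 0 < r ^+ 2 := exprn_gt0 2 r0.
rewrite /param_s -ln_div ?posrE //; last by lra.
have -> : (1 + r + r ^+ 2) / (1 + r) = 1 + r ^+ 2 / (1 + r).
  by field; rewrite gt_eqF //; lra.
have q0 : 0 < r ^+ 2 / (1 + r) by apply: divr_gt0; lra.
apply: (le_trans (le_ln1Dx _)); first lra.
by rewrite ler_pdivrMr; nra.
Qed.

Lemma param_G_small r : 0 < r < 1 -> `|param_G r| <= (2%:R + pi ^+ 2) * r.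
Proof.
move=> /andP[r0 r1]; have s0 := param_s_gt0 r0; have sr := param_s_le r0.
have r2 : 0 < r ^+ 2 := exprn_gt0 2 r0; have r3 : 0 < r ^+ 3 := exprn_gt0 3 r0.
have r2r : r ^+ 2 <= r by rewrite expr2; nra.
have r3r : r ^+ 3 <= r by rewrite exprS; nra.
have lr : - ln r <= r^-1.
  by rewrite -lnV ?posrE //; apply/ltW/ln_sublinear; rewrite invr_gt0.
have lr0 : 0 <= - ln r by rewrite oppr_ge0 ln_le0 // ltW.
have k1 : 0 <= - (param_s r * ln r) <= r.
  rewrite -mulrN; apply/andP; split; first by apply: mulr_ge0 => //; exact: ltW.
  rewrite [leRHS](_ : r = r ^+ 2 * r^-1); last by field; rewrite gt_eqF.
  by apply: ler_pM => //; exact: ltW.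
have k2 : 0 <= param_s r ^+ 2 <= r.
  rewrite sqr_ge0 expr2 /=; nra.
have [h2 h2'] : 0 <= dilog (r ^+ 2) /\ dilog (r ^+ 2) <= r * (pi ^+ 2 / 6%:R).
  have b : 0 <= r ^+ 2 < 1 by lra.
  split; first exact: dilog_ge0.
  apply: (le_trans (dilog_le b)); apply: ler_wpM2r => //.
  by apply: divr_ge0 => //; exact: sqr_ge0.
have [h3 h3'] : 0 <= dilog (r ^+ 3) /\ dilog (r ^+ 3) <= r * (pi ^+ 2 / 6%:R).
  have b : 0 <= r ^+ 3 < 1 by lra.
  split; first exact: dilog_ge0.
  apply: (le_trans (dilog_le b)); apply: ler_wpM2r => //.
  by apply: divr_ge0 => //; exact: sqr_ge0.
have pp : 0 <= r * (pi ^+ 2 / 6%:R) :> R.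
  by apply: mulr_ge0; [lra|]; apply: divr_ge0 => //; exact: sqr_ge0.
have e : (2%:R + pi ^+ 2) * r = 2%:R * r + 6%:R * (r * (pi ^+ 2 / 6%:R)) by field.
by rewrite /param_G ler_norml e; apply/andP; split; lra.
Qed.

Definition lambda : R := pi ^+ 2 / 18%:R.

(** The origin of [pi ^ 2 / 18]: the dilogarithms give [(1 / 2 - 1 / 3) pi ^ 2 / 6 = lambda / 2].
    This is the area left of the fixed point of [cost]; twice it, minus the square of side
    [param_s 1] counted twice by the symmetry, is [lambda]. *)
Lemma param_G1 : param_G 1 = lambda / 2%:R + param_s 1 ^+ 2 / 2%:R.
Proof.
rewrite /param_G ln1 mulr0 oppr0 add0r !expr1n /dilog ltxx /lambda.
by field.
Qed.

Definition cost_fix : R := param_s 1.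
Definition param_ratio z : R := beta (1 - expR (- z)) / expR (- z).
Definition prim_left z : R := param_G (param_ratio z).

Lemma cost_fix_gt0 : 0 < cost_fix. Proof. exact: param_s_gt0. Qed.

Lemma cost_fixE : cost cost_fix = cost_fix.
Proof. by rewrite cost_param // /param_t ln1 subr0. Qed.

Lemma param_ratioE r : 0 < r -> param_ratio (param_s r) = r.
Proof.
move=> r0; have /andP[x0 _] := param_x_bd r0.
by rewrite /param_ratio expR_param // beta_param // mulfK // gt_eqF.
Qed.

Lemma prim_left_bounds z1 z2 : 0 < z1 -> z1 <= z2 -> z2 <= cost_fix ->
  cost z2 * (z2 - z1) <= prim_left z2 - prim_left z1 <= cost z1 * (z2 - z1).
Proof.
move=> z10 z12 z2z; have z20 : 0 < z2 by apply: lt_le_trans z12.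
have [r1 p1 e1] := param_exists z10; have [r2 p2 e2] := param_exists z20.
rewrite /prim_left -e1 -e2 !param_ratioE // !cost_param //.
apply: param_G_bounds => //; first by rewrite -param_s_mono // e1 e2.
by rewrite -param_s_mono // e2.
Qed.

Lemma prim_left_small e : 0 < e ->
  exists2 d, 0 < d & forall z, 0 < z < d -> `|prim_left z| <= e.
Proof.
move=> e0; pose C : R := 2%:R + pi ^+ 2.
have C0 : 0 < C by have : 0 <= (@pi R) ^+ 2 := sqr_ge0 _; rewrite /C; lra.
pose r := Num.min (1 / 2%:R) (e / C).
have r0 : 0 < r by rewrite lt_min divr_gt0 ?divr_gt0.
exists (param_s r); first exact: param_s_gt0.
move=> z /andP[zp zr]; have [y y0 ey] := param_exists zp.
rewrite /prim_left -ey param_ratioE //.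
have yr : y <= r by rewrite -param_s_mono // ey ltW.
have rh : r <= 1 / 2%:R by rewrite /r ge_min lexx.
have re : r <= e / C by rewrite /r ge_min lexx orbT.
apply: (le_trans (param_G_small _)).
  by rewrite y0 /=; move: (le_trans yr rh) => h; clear -h; lra.
by rewrite -/C mulrC -ler_pdivlMr // (le_trans yr).
Qed.

Lemma prim_left_fix :
  prim_left cost_fix = lambda / 2%:R + cost_fix ^+ 2 / 2%:R.
Proof. by rewrite /prim_left param_ratioE // param_G1. Qed.

(** The rectangle with corner on the decreasing graph lies below it. The primitive is known near 0
    only up to a small error, so the comparison starts from a small [y] and not from 0. *)
Lemma prim_left_ge z : 0 < z <= cost_fix -> z * cost z <= prim_left z.
Proof.
move=> /andP[zp zz]; rewrite leNgt; apply/negP => lt.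
have c0 := cost_gt0 zp.
pose e := (z * cost z - prim_left z) / 3%:R.
have e0 : 0 < e by rewrite /e divr_gt0 // subr_gt0.
have [d d0 hd] := prim_left_small e0.
pose y := Num.min (d / 2%:R) (Num.min z (e / cost z)).
have y0 : 0 < y.
  rewrite !lt_min zp (divr_gt0 d0) ?ltr0n //=.
  exact: divr_gt0.
have yd : y <= d / 2%:R by rewrite /y ge_min lexx.
have yz : y <= z by rewrite /y !ge_min lexx orbT.
have ye : y * cost z <= e.
  by rewrite -ler_pdivlMr // /y !ge_min lexx !orbT.
have /andP[h _] := prim_left_bounds y0 yz zz.
have yd' : y < d by clear -yd d0; lra.
have := hd y; rewrite y0 yd' => /(_ isT); rewrite ler_norml => /andP[k _].
have e3 : 3%:R * e = z * cost z - prim_left z by rewrite /e; field.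
clearbody y e; move: e0 ye e3 k h.
move: (prim_left z) (prim_left y); move: (cost z); clear.
by move=> *; lra.
Qed.

(** The area left of [z]. For large [z] it is the total minus the area beyond [z], which after
    reflection is [prim_left (cost z) - z * cost z]. *)
Definition cost_prim z : R := if z <= cost_fix then prim_left z
  else lambda - prim_left (cost z) + z * cost z.

Lemma cost_le_fix z : cost_fix <= z -> cost z <= cost_fix.
Proof. by move=> h; rewrite -cost_fixE cost_anti // cost_fix_gt0. Qed.

Lemma cost_primE z : cost_fix <= z ->
  cost_prim z = lambda - prim_left (cost z) + z * cost z.
Proof.
rewrite le_eqVlt => /orP[/eqP <-|lt]; last by rewrite /cost_prim leNgt lt.
by rewrite /cost_prim lexx cost_fixE prim_left_fix; field.
Qed.

(* [cost] is an involution, so beyond its fixed point the area under its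
   graph is read off the reflected graph. *)
Lemma cost_prim_right z1 z2 : cost_fix <= z1 -> z1 <= z2 ->
  cost z2 * (z2 - z1) <= cost_prim z2 - cost_prim z1 <= cost z1 * (z2 - z1).
Proof.
move=> z10 z12; have p1 : 0 < z1 by apply: lt_le_trans z10; exact: cost_fix_gt0.
have p2 : 0 < z2 by apply: lt_le_trans z12.
rewrite !cost_primE //; last by apply: le_trans z12.
have := prim_left_bounds (cost_gt0 p2) (cost_anti p1 z12) (cost_le_fix z10).
rewrite !costK //.
move: (prim_left (cost z1)) (prim_left (cost z2)).
move: (cost z1) (cost z2) lambda; clear; move=> c1 c2 l h1 h2 /andP[a b].
rewrite -subr_ge0 in a; rewrite -subr_ge0 in b.
apply/andP; split; rewrite -subr_ge0.
  rewrite [leRHS](_ : _ = h1 - h2 - z1 * (c1 - c2)) //; ring.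
rewrite [leRHS](_ : _ = z2 * (c1 - c2) - (h1 - h2)) //; ring.
Qed.

Lemma cost_prim_bounds z1 z2 : 0 < z1 -> z1 <= z2 ->
  cost z2 * (z2 - z1) <= cost_prim z2 - cost_prim z1 <= cost z1 * (z2 - z1).
Proof.
move=> z10 z12; have [h2|h2] := leP z2 cost_fix.
  by rewrite /cost_prim h2 (le_trans z12 h2); exact: prim_left_bounds.
have [h1|h1] := leP cost_fix z1; first exact: cost_prim_right.
have a := prim_left_bounds z10 (ltW h1) (lexx _).
have b := cost_prim_right (lexx _) (ltW h2).
have G1 : cost_prim z1 = prim_left z1 by rewrite /cost_prim ltW.
have G0 : cost_prim cost_fix = prim_left cost_fix by rewrite /cost_prim lexx.
rewrite G1; rewrite G0 in b.
have k1 := cost_anti z10 (ltW h1); have k2 := cost_anti cost_fix_gt0 (ltW h2).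
have d1 : 0 <= cost_fix - z1 by rewrite subr_ge0 ltW.
have d2 : 0 <= z2 - cost_fix by rewrite subr_ge0 ltW.
have m1 := ler_wpM2r d1 k2; have m2 := ler_wpM2r d2 k1.
move: a b m1 m2; clear.
move: (cost_prim z2) (prim_left cost_fix) (prim_left z1) (cost z1) (cost z2).
move: (cost cost_fix) cost_fix => c0 z0 g2 g0 g1 c1 c2.
by move=> /andP[? ?] /andP[? ?] ? ?; apply/andP; split; lra.
Qed.

Lemma cost_prim_at0 e : 0 < e ->
  exists2 d, 0 < d & forall z, 0 < z < d -> `|cost_prim z| <= e.
Proof.
move=> e0; have [d d0 hd] := prim_left_small e0.
exists (Num.min d cost_fix); first by rewrite lt_min d0 cost_fix_gt0.
move=> z /andP[zp]; rewrite lt_min => /andP[zd zz].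
by rewrite /cost_prim (ltW zz) hd // zp.
Qed.

Lemma cost_prim_infty e : 0 < e ->
  exists2 M, 0 < M & forall z, M <= z -> `|cost_prim z - lambda| <= e.
Proof.
move=> e0; have [d d0 hd] := prim_left_small e0.
exists (Num.max cost_fix (cost (d / 2%:R))); first by rewrite lt_max cost_fix_gt0.
move=> z; rewrite ge_max => /andP[zz zd].
have zp : 0 < z by apply: lt_le_trans zz; exact: cost_fix_gt0.
have d2 : 0 < d / 2%:R by rewrite divr_gt0.
have cd : cost z <= d / 2%:R by rewrite -(costK d2) cost_anti // cost_gt0.
rewrite cost_primE //.
have cp := cost_gt0 zp.
have l := @prim_left_ge (cost z); rewrite cp cost_le_fix // costK // in l.
have {}l := l isT.
have cd' : cost z < d by clear -cd d0; lra.
have := hd (cost z); rewrite cp cd' => /(_ isT).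
rewrite !ler_norml => /andP[h1 h2].
have m : 0 <= cost z * z by apply: mulr_ge0; exact: ltW.
move: l h1 h2 m; clear; move: (prim_left (cost z)); move: (cost z) lambda.
by move=> c la h l h1 h2 m; apply/andP; split; lra.
Qed.

Lemma cost_prim_le_lambda z : 0 < z -> cost_prim z <= lambda.
Proof.
move=> zp; apply/ler_addgt0Pr => e e0.
have [M M0 hM] := cost_prim_infty e0; pose w := Num.max z M.
have zw : z <= w by rewrite /w le_max lexx.
have Mw : M <= w by rewrite /w le_max lexx orbT.
have wp : 0 < w by apply: lt_le_trans zw.
have /andP[k _] := cost_prim_bounds zp zw.
have cw : 0 <= cost w * (w - z).
  by apply: mulr_ge0; [exact: ltW (cost_gt0 wp)|rewrite subr_ge0].
have := hM w Mw; rewrite ler_norml => /andP[_].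
by move: k cw; clear; lra.
Qed.

Lemma cost_riemann_prim h n : 0 < h ->
  \sum_(1 <= i < n.+2) h * cost (i%:R * h) <= cost_prim (n.+1%:R * h).
Proof.
move=> h0; elim: n => [|n IH].
  rewrite big_nat1 mul1r; apply/ler_addgt0Pr => e e0.
  have e20 : 0 < e / 2%:R by rewrite divr_gt0.
  have [d d0 hd] := cost_prim_at0 e20.
  have c0 : 0 < cost h by exact: cost_gt0.
  pose y := Num.min (d / 2%:R) (Num.min h (e / 2%:R / cost h)).
  have y0 : 0 < y.
    rewrite !lt_min h0 (divr_gt0 d0) ?ltr0n //=.
    exact: divr_gt0.
  have yd : y <= d / 2%:R by rewrite /y ge_min lexx.
  have yh : y <= h by rewrite /y !ge_min lexx orbT.
  have ye : y * cost h <= e / 2%:R by rewrite -ler_pdivlMr // /y !ge_min lexx !orbT.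
  have /andP[k _] := cost_prim_bounds y0 yh.
  have yd' : y < d by clear -yd d0; lra.
  have := hd y; rewrite y0 yd' => /(_ isT); rewrite ler_norml => /andP[k1 _].
  clearbody y; move: k k1 ye; clear; lra.
rewrite big_nat_recr //=.
have n0 : 0 < n.+1%:R * h by apply: mulr_gt0.
have n1 : n.+1%:R * h <= n.+2%:R * h by rewrite ler_pM2r // ler_nat.
have /andP[k _] := cost_prim_bounds n0 n1.
have e1 : n.+2%:R * h - n.+1%:R * h = h by rewrite -[n.+2]addn1 natrD; ring.
by rewrite e1 in k; move: k IH; clear; lra.
Qed.

Lemma cost_riemann_le h (N : nat) : 0 < h ->
  \sum_(1 <= i < N.+1) h * cost (i%:R * h) <= lambda.
Proof.
move=> h0; case: N => [|n].
  by rewrite big_geq //; apply: divr_ge0 => //; exact: sqr_ge0.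
by rewrite (le_trans (cost_riemann_prim _ _)) // cost_prim_le_lambda // mulr_gt0.
Qed.

Lemma cost_riemann_small e : 0 < e -> exists2 d, 0 < d &
  forall h (N : nat), 0 < h -> N%:R * h < d ->
    \sum_(1 <= i < N.+1) h * cost (i%:R * h) <= e.
Proof.
move=> e0; have [d d0 hd] := cost_prim_at0 e0; exists d => // h [|n] h0 hn.
  by rewrite big_geq // ltW.
apply: le_trans (cost_riemann_prim _ h0) _.
have := hd (n.+1%:R * h); rewrite hn mulr_gt0 // => /(_ isT).
by rewrite ler_norml => /andP[].
Qed.

(** The shift [eta] is that of [cut_cost]. The area lost near 0 is controlled by [d], the one lost
    at infinity by [b]. *)
Lemma cost_riemann_ge e : 0 < e -> exists d b, [/\ 0 < d, 0 < b &
  forall q eta (n : nat), 0 < q -> 0 < eta -> q + eta <= d -> b <= n%:R * q ->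
    lambda - e <= \sum_(1 <= k < n.+1) q * cost (k%:R * q + eta)].
Proof.
move=> e0; have e20 : 0 < e / 2%:R by lra.
have [d d0 hd] := cost_prim_at0 e20; have [M M0 hM] := cost_prim_infty e20.
exists (d / 2%:R), M; split => //; first lra.
move=> q eta n q0 eta0 qd Mn.
have key m : cost_prim (m.+1%:R * q + eta) - cost_prim (q + eta) <=
    \sum_(1 <= k < m.+1) q * cost (k%:R * q + eta).
  elim: m => [|m IH]; first by rewrite big_geq // mul1r subrr.
  rewrite big_nat_recr //=.
  have m0 : 0 < m.+1%:R * q by apply: mulr_gt0.
  have p : 0 < m.+1%:R * q + eta by lra.
  have e1 : m.+2%:R * q = m.+1%:R * q + q by rewrite -[m.+2]addn1 natrD; ring.
  have l : m.+1%:R * q + eta <= m.+2%:R * q + eta by lra.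
  have /andP[_ k] := cost_prim_bounds p l.
  have e2 : m.+2%:R * q + eta - (m.+1%:R * q + eta) = q by lra.
  by rewrite e2 in k; lra.
have k1 := hd (q + eta) ltac:(lra).
have k2 : M <= n.+1%:R * q + eta by rewrite -[n.+1]addn1 natrD mulrDl; lra.
have {}k2 := hM _ k2.
move: k1 k2; rewrite !ler_norml => /andP[_ k1] /andP[k2 _].
by have := key n; lra.
Qed.
End CostIntegral.

(** * Lower bound on the spanning probability *)

Section Lines.
Context {R : realType}.
Implicit Types (u p : R).

Definition crossing_from (m l : nat) (N : set nat) : Prop :=
  (forall i, (m <= i)%N -> (i.+1 < m + l)%N -> N i \/ N i.+1) /\
  ((0 < l)%N -> N (m + l).-1).

(** Conditioning on the first two lines gives [x_(l + 2) >= u x_(l + 1) + u (1 - u) x_l], whose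
    positive characteristic root is [beta u]. The factor [u] is needed for [l = 1]. *)
Lemma Pr_crossing_from u l m : 0 < u <= 1 ->
  u * beta u ^+ l <= Pr (fun=> u) (iota m l) (crossing_from m l).
Proof.
move=> /andP[u0 u1]; have u01 : forall n : nat, 0 <= (fun=> u) n <= 1.
  by move=> _ /=; rewrite ltW.
have b0 := beta_gt0 u0; have b1 : beta u <= 1 by apply: beta_le1; rewrite ltW.
have be : beta u ^+ 2 = u * beta u + u * (1 - u) by apply: beta_eq; rewrite ltW.
suff H : forall k, (k <= l)%N -> forall m,
    u * beta u ^+ k <= Pr (fun=> u) (iota m k) (crossing_from m k) by exact: H.
elim: l {m} => [|l IH] k.
  rewrite leqn0 => /eqP -> m; rewrite expr0 mulr1.
  by rewrite /Pr /= asboolT //; split => // i mi; rewrite addn0 => il; exfalso; lia.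
case: k => [_|[_|k kl]] m; first exact: IH.
  rewrite expr1 /Pr /= asboolT; last first.
    by split => [i mi il|_]; [exfalso; lia|left; rewrite addn1].
  rewrite mulr1 -[leLHS]addr0 lerD //; first by rewrite ler_piMr // ltW.
  by rewrite mulr_ge0 // subr_ge0.
have k1 := IH k.+1 ltac:(lia) m.+1; have k2 := IH k ltac:(lia) m.+2.
have -> : Pr (fun=> u) (iota m k.+2) (crossing_from m k.+2) =
    u * Pr (fun=> u) (iota m.+1 k.+1) (fun N => crossing_from m k.+2 (m |` N)) +
    (1 - u) * (u * Pr (fun=> u) (iota m.+2 k) (fun N => crossing_from m k.+2 (m.+1 |` N)) +
    (1 - u) * Pr (fun=> u) (iota m.+2 k) (crossing_from m k.+2)) by [].
have h1 : Pr (fun=> u) (iota m.+1 k.+1) (crossing_from m.+1 k.+1) <=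
    Pr (fun=> u) (iota m.+1 k.+1) (fun N => crossing_from m k.+2 (m |` N)).
  apply: Pr_le => // N _ [g la]; split; last first.
    move=> _; right; have -> : (m + k.+2).-1 = (m.+1 + k.+1).-1 by lia.
    exact: la.
  move=> i mi il; have [->|ne] := pselect (i = m); first by left; left.
  by have [|||] := g i; [lia|lia|left; right|right; right].
have h2 : Pr (fun=> u) (iota m.+2 k) (crossing_from m.+2 k) <=
    Pr (fun=> u) (iota m.+2 k) (fun N => crossing_from m k.+2 (m.+1 |` N)).
  apply: Pr_le => // N _ [g la]; split; last first.
    move=> _; case: k g la {kl k1 k2 h1} => [|k] g la.
      by left => /=; lia.
    right; have -> : (m + k.+3).-1 = (m.+2 + k.+1).-1 by lia.
    exact: la.
  move=> i mi il; have [->|ne] := pselect (i = m); first by right; left.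
  have [->|ne'] := pselect (i = m.+1); first by left; left.
  by have [|||] := g i; [lia|lia|left; right|right; right].
have h3 := Pr_ge0 u01 (iota m.+2 k) (crossing_from m k.+2).
rewrite (exprD _ 2 k) be.
have -> : u * ((u * beta u + u * (1 - u)) * beta u ^+ k) =
  u * (u * beta u ^+ k.+1) + (1 - u) * (u * (u * beta u ^+ k)) by rewrite exprS; ring.
have u1' : 0 <= 1 - u by rewrite subr_ge0.
apply: lerD; apply: ler_wpM2l => //; try exact: ltW.
  exact: le_trans h1.
apply: (@le_trans _ _ (u * Pr (fun=> u) (iota m.+2 k)
    (fun N => crossing_from m k.+2 (m.+1 |` N)))).
  by apply: ler_wpM2l; [exact: ltW|exact: le_trans h2].
by rewrite lerDl mulr_ge0.
Qed.

Lemma crossing_fromE l N : crossing_from 0 l N <-> crossing l N.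
Proof.
split=> -[g la]; split => // i; first by move=> il; apply: g.
by move=> _ il; apply: g.
Qed.

Lemma Pr_iff (I : eqType) (q : I -> R) s (E E' : set I -> Prop) :
  (forall Y, Y `<=` [set` s] -> E Y <-> E' Y) -> Pr q s E = Pr q s E'.
Proof.
move=> h; apply: Ex_ext => Y Ys; congr ((nat_of_bool _)%:R).
exact: asbool_equiv_eq (h Y Ys).
Qed.

Lemma Pr_crossing u l : 0 < u <= 1 ->
  u * beta u ^+ l <= Pr (fun=> u) (iota 0 l) (crossing l).
Proof.
move=> u01; apply: le_trans (Pr_crossing_from l 0 u01) _.
by rewrite (Pr_iff _ (fun N _ => crossing_fromE l N)).
Qed.

Lemma Pr_crossing1 u : 0 <= u <= 1 -> u <= Pr (fun=> u) (iota 0 1) (crossing 1).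
Proof.
move=> /andP[u0 u1]; rewrite /Pr /= asboolT; last by split => // _; left.
by rewrite mulr1 lerDl mulr_ge0 // subr_ge0.
Qed.
End Lines.

Lemma uniq_flatten_key (I J : eqType) (cs : J -> seq I) (key : I -> J) (s : seq J) :
  uniq s -> (forall j, j \in s -> uniq (cs j)) ->
  (forall j x, j \in s -> x \in cs j -> key x = j) ->
  uniq (flatten [seq cs j | j <- s]).
Proof.
elim: s => [|j s IH] //= /andP[js us] uc k; rewrite cat_uniq.
rewrite uc ?inE ?eqxx //= IH //; last first.
- by move=> i x ii; apply: k; rewrite inE ii orbT.
- by move=> i ii; apply: uc; rewrite inE ii orbT.
rewrite andbT; apply/hasPn => x /flatten_mapP[i ii xi]; apply/negP => xj.
have e1 : key x = j by apply: k => //; rewrite inE eqxx.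
have e2 : key x = i by apply: k => //; rewrite inE ii orbT.
by move: js; rewrite -e1 e2 ii.
Qed.

Lemma dep_on_spanned r : dep_on (rsites r) (spanned r).
Proof.
move=> Y Y' h; rewrite /internally_spanned => e; rewrite -[RHS]e; congr bootstrap_closure.
by apply/seteqP; split=> z [Yz rz];
  have [h1 h2] := h z ((mem_rsites r z).2 rz); split; [auto|by []|auto|by []].
Qed.

Definition col (a c : int) (h i : nat) : seq (int * int) :=
  rsites (a + i%:Z, c, (1%N, h)).
Definition row (a c : int) (w i : nat) : seq (int * int) :=
  rsites (a, c + i%:Z, (w, 1%N)).

Lemma mem_col a c h i z : z \in col a c h i <->
  [/\ z.1 = a + i%:Z, c <= z.2 & z.2 < c + h%:Z].
Proof.
rewrite mem_rsites; case: z => z1 z2; runfold.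
by split=> -[*]; split; lia.
Qed.

Lemma mem_row a c w i z : z \in row a c w i <->
  [/\ z.2 = c + i%:Z, a <= z.1 & z.1 < a + w%:Z].
Proof.
rewrite mem_rsites; case: z => z1 z2; runfold.
by split=> -[*]; split; lia.
Qed.

Definition cols a c h (s : seq nat) := flatten [seq col a c h i | i <- s].
Definition rows a c w (s : seq nat) := flatten [seq row a c w i | i <- s].

Lemma uniq_cols a c h s : uniq s -> uniq (cols a c h s).
Proof.
move=> us; apply: (@uniq_flatten_key _ _ _ (fun z => `|z.1 - a|%N)) => //.
- by move=> *; exact: uniq_rsites.
- by move=> j x _ /mem_col[-> _ _]; lia.
Qed.

Lemma uniq_rows a c w s : uniq s -> uniq (rows a c w s).
Proof.
move=> us; apply: (@uniq_flatten_key _ _ _ (fun z => `|z.2 - c|%N)) => //.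
- by move=> *; exact: uniq_rsites.
- by move=> j x _ /mem_row[-> _ _]; lia.
Qed.

Section LineEvents.
Context {R : realType}.
Variable p : R.

Lemma Ex_lines (cs : nat -> seq (int * int)) (n : nat) (s : seq nat)
    (f : set nat -> R) : uniq s -> uniq (flatten [seq cs i | i <- s]) ->
  (forall i, size (cs i) = n) ->
  Ex (fun=> p) (flatten [seq cs i | i <- s])
     (fun Y => f [set i | i \in s /\ hit (cs i) Y]) =
  Ex (fun=> 1 - (1 - p) ^+ n) s f.
Proof.
move=> us uf sz; rewrite (@Ex_coarse _ _ _ _ cs (fun i => hit (cs i))) //.
  by congr Ex; apply/funext => i; rewrite Pr_hit sz.
by move=> *; exact: dep_on_hit.
Qed.
End LineEvents.

Definition hit_set (cs : nat -> seq (int * int)) (s : seq nat) (Y : set site) : set nat :=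
  [set i | i \in s /\ hit (cs i) Y].

Lemma dep_on_hit_set (E : set nat -> Prop) cs s :
  dep_on (flatten [seq cs i | i <- s]) (fun Y => E (hit_set cs s Y)).
Proof.
move=> Y Y' h; suff -> : hit_set cs s Y = hit_set cs s Y' by [].
apply/seteqP; split=> i [si [x xi Yx]]; split => //; exists x => //;
  by apply/h => //; apply/flatten_mapP; exists i.
Qed.

Lemma crossing_mono j (N N' : set nat) : N `<=` N' -> crossing j N -> crossing j N'.
Proof.
move=> h [g l]; split; last by move=> j0; apply: h; apply: l.
by move=> i ij; have [?|?] := g i ij; [left|right]; apply: h.
Qed.

Section GrowSquare.
Context {R : realType}.
Variable p : R.
Hypothesis p01 : 0 <= p <= 1.

Definition span_prob (r : rect) : R := Pr (fun=> p) (rsites r) (spanned r).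

Let p01' : forall x : int * int, 0 <= (fun=> p) x <= 1.
Proof. by []. Qed.

(** The square grows to the right, then upwards. Of the new rows only the first [k] sites are
    examined, so that both strips and the small square are disjoint and the three events
    independent. *)
Lemma grow_square (a c : int) (k j : nat) : (0 < k)%N ->
  span_prob (a, c, (k, k)) *
    (Pr (fun=> 1 - (1 - p) ^+ k) (iota 0 j) (crossing j)) ^+ 2
  <= span_prob (a, c, ((k + j)%N, (k + j)%N)).
Proof.
move=> k0; set C := Pr _ _ _.
set small : rect := (a, c, (k, k)); set big : rect := (a, c, _).
pose cs i := col (a + k%:Z) c k i; pose rs i := row a (c + k%:Z) k i.
pose E1 Y := crossing j (hit_set cs (iota 0 j) Y).
pose E2 Y := crossing j (hit_set rs (iota 0 j) Y).
pose s1 := cols (a + k%:Z) c k (iota 0 j).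
pose s2 := rows a (c + k%:Z) k (iota 0 j).
have d1 : dep_on s1 E1 := @dep_on_hit_set (crossing j) cs (iota 0 j).
have d2 : dep_on s2 E2 := @dep_on_hit_set (crossing j) rs (iota 0 j).
have u1 : uniq s1 by apply: uniq_cols; exact: iota_uniq.
have u2 : uniq s2 by apply: uniq_rows; exact: iota_uniq.
have P1 : Pr (fun=> p) s1 E1 = C.
  apply: (@Ex_lines R p cs k (iota 0 j) (fun N => (`[< crossing j N >])%:R)) => //.
    exact: iota_uniq.
  by move=> i; rewrite size_rsites mul1n.
have P2 : Pr (fun=> p) s2 E2 = C.
  apply: (@Ex_lines R p rs k (iota 0 j) (fun N => (`[< crossing j N >])%:R)) => //.
    exact: iota_uniq.
  by move=> i; rewrite size_rsites muln1.
have m1 z : z \in s1 -> [/\ a + k%:Z <= z.1, z.1 < a + (k + j)%N%:Z, c <= z.2 & z.2 < c + k%:Z].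
  by move=> /flatten_mapP[i]; rewrite mem_iota => ij /mem_col[-> ? ?]; split => //; lia.
have m2 z : z \in s2 -> [/\ c + k%:Z <= z.2, z.2 < c + (k + j)%N%:Z, a <= z.1 & z.1 < a + k%:Z].
  by move=> /flatten_mapP[i]; rewrite mem_iota => ij /mem_row[-> ? ?]; split => //; lia.
have b1 : {subset s1 <= rsites big}.
  by move=> [z1 z2] /m1[/= ? ? ? ?]; apply/mem_rsites; split; rewrite /rx /ry /rw /rh /=; lia.
have b2 : {subset s2 <= rsites big}.
  by move=> [z1 z2] /m2[/= ? ? ? ?]; apply/mem_rsites; split; rewrite /rx /ry /rw /rh /=; lia.
have b0 : {subset rsites small <= rsites big}.
  move=> [z1 z2] /mem_rsites[]; rewrite /rx /ry /rw /rh /= => ? ? ? ?.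
  by apply/mem_rsites; split; rewrite /rx /ry /rw /rh /=; lia.
have ub := uniq_rsites big; have us := uniq_rsites small.
have P12 : Pr (fun=> p) (rsites big) (fun Y => E1 Y /\ E2 Y) = C ^+ 2.
  rewrite (Pr_indep _ ub u1 u2 b1 b2 _ d1 d2); last first.
    by move=> [z1 z2] /m1[/= ? ? ? ?]; apply/negP => /m2[/= ? ? ? ?]; lia.
  by rewrite (Pr_restrict _ ub u1 b1 d1) (Pr_restrict _ ub u2 b2 d2) P1 P2 expr2.
have d12 : dep_on (s1 ++ s2) (fun Y => E1 Y /\ E2 Y).
  apply: dep_on_and; first apply: dep_on_sub d1.
    by move=> x xt; rewrite mem_cat xt.
  by apply: dep_on_sub d2 => x xt; rewrite mem_cat xt orbT.
have u12 : uniq (s1 ++ s2).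
  rewrite cat_uniq u1 u2 andbT /=; apply/hasPn => -[z1 z2] /m2[/= ? ? ? ?].
  by apply/negP => /m1[/= ? ? ? ?]; lia.
have b12 : {subset s1 ++ s2 <= rsites big}.
  by move=> z; rewrite mem_cat => /orP[/b1|/b2].
rewrite /span_prob -(Pr_restrict _ ub us b0 (@dep_on_spanned small)) -P12.
rewrite -(Pr_indep _ ub us u12 b0 b12 _ (@dep_on_spanned small) d12); last first.
  move=> [z1 z2] /mem_rsites[]; rewrite /rx /ry /rw /rh /= => ? ? ? ?.
  rewrite mem_cat negb_or; apply/andP.
  by split; apply/negP; [move=> /m1[/= *]|move=> /m2[/= *]]; lia.
apply: Pr_le => // Y _ [sm [cr1 cr2]].
apply/seteqP; split; first exact: closure_rect.
pose K := bootstrap_closure (Y `&` rset big).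
have sK : stable K by exact: closure_stable.
have subK z : Y z -> rset big z -> K z by move=> Yz bz; apply: closure_sub.
have smb : rset small `<=` rset big.
  by move=> z /mem_rsites /b0 /mem_rsites.
have smK : rset small `<=` K.
  by rewrite -[X in X `<=` _]sm; apply: closure_mono => z [? ?]; split => //; exact: smb.
have step1 : rset (a, c, ((k + j)%N, k)) `<=` K.
  apply: (crossing_right sK k0 k0 smK); apply: crossing_mono cr1.
  move=> i [ij [z zi Yz]];
  have zs : z \in s1 by apply/flatten_mapP; exists i.
  move/mem_col: zi => [e ? ?]; exists z; split => //.
    by apply: subK => //; apply/mem_rsites; exact: b1.
  by rewrite e PoszD addrA.
have kj0 : (0 < k + j)%N by lia.
apply: (crossing_up sK kj0 k0 step1); apply: crossing_mono cr2.
move=> i [ij [z zi Yz]].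
have zs : z \in s2 by apply/flatten_mapP; exists i.
move/mem_row: zi => [e ? zk]; exists z; split => //.
- by apply: subK => //; apply/mem_rsites; exact: b2.
- by rewrite e PoszD addrA.
- by apply: lt_le_trans zk _; rewrite PoszD addrA lerDl.
Qed.

Lemma span_prob1 (a c : int) : p <= span_prob (a, c, (1%N, 1%N)).
Proof.
rewrite /span_prob /Pr /= asboolT; last first.
  rewrite /internally_spanned.
  have -> : ((a + 0, c + 0) |` set0) `&` rset (a, c, (1%N, 1%N)) = rset (a, c, (1%N, 1%N)).
    apply/seteqP; split=> -[z1 z2]; first by case.
    move=> [] + + + +; runfold => *; split; last by split.
    by left; rewrite /=; congr pair; lia.
  apply/seteqP; split; last exact: closure_sub.
  by apply: closure_min => //; exact: rset_stable.
rewrite mulr1 lerDl mulr_ge0 //; have /andP[_ p1] := p01.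
by rewrite subr_ge0.
Qed.
End GrowSquare.

(** * Growth of a square from one site *)

Section Nucleation.
Context {R : realType}.
Implicit Types (p x e : R).

Lemma expRN_le x : 0 <= x -> expR (- x) <= (1 + x)^-1.
Proof.
move=> x0; rewrite expRN lef_pV2 ?posrE ?expR_gt0 ?expR_ge1Dx //; lra.
Qed.

Lemma expR_half x : 0 <= x <= 1 / 2%:R -> expR (- (2%:R * x)) <= 1 - x.
Proof.
move=> /andP[x0 x1]; apply: le_trans (expRN_le _) _; first lra.
rewrite -[leLHS]mul1r ler_pdivrMr; last by lra.
have : 0 <= x * (1 / 2%:R - x) by apply: mulr_ge0; lra.
by lra.
Qed.

Section Steps.
Variables (p : R) (a c : int).
Hypothesis p01 : 0 < p < 1.
(** A lower bound for the probability [1 - (1 - p) ^ k] that a line of [k] sites is hit, chosen so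
    that [beta (v k) = exp (- cost (k p))]. *)
Let v (k : nat) : R := 1 - expR (- (k%:R * p)).
Let Q k := span_prob p (a, c, (k, k)).

Let p01' : 0 <= p <= 1. Proof. by move/andP: p01 => [? ?]; rewrite !ltW. Qed.

Lemma hit_prob_ge (k : nat) : v k <= 1 - (1 - p) ^+ k.
Proof.
rewrite /v lerD2l lerN2 -mulrN expRM_natl lerXn2r ?nnegrE ?expR_ge0 //.
  by move/andP: p01' => [? ?]; lra.
exact: expR_ge1Dx.
Qed.

Lemma v_bd (k : nat) : (0 < k)%N -> 0 < v k < 1.
Proof.
by move=> k0; apply: expRN_bd; rewrite mulr_gt0 ?ltr0n //; move/andP: p01 => [].
Qed.

Lemma hit_prob_le1 (k : nat) : 1 - (1 - p) ^+ k <= 1.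
Proof. by rewrite gerBl exprn_ge0 // subr_ge0; move/andP: p01' => []. Qed.

Lemma Q_ge0 k : 0 <= Q k. Proof. by apply: Pr_ge0. Qed.

Lemma Q_step k : (0 < k)%N -> Q k * v k ^+ 2 <= Q k.+1.
Proof.
move=> k0; have /andP[v0 _] := v_bd k0; have vu := hit_prob_ge k.
have := @grow_square R p p01' a c k 1 k0; rewrite addn1 -/(Q k) -/(Q k.+1).
apply: le_trans; apply: ler_wpM2l; first exact: Q_ge0.
rewrite lerXn2r ?nnegrE ?(ltW v0) //.
  by apply: Pr_ge0 => n /=; rewrite hit_prob_le1 andbT (le_trans _ vu) // ltW.
apply: (le_trans vu); apply: Pr_crossing1.
by rewrite hit_prob_le1 (le_trans _ vu) // ltW.
Qed.

Lemma Q_jump k n : (0 < k)%N -> Q k * (v k * beta (v k) ^+ n) ^+ 2 <= Q (k + n)%N.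
Proof.
move=> k0; have /andP[v0 _] := v_bd k0; have vu := hit_prob_ge k.
have := @grow_square R p p01' a c k n k0; rewrite -/(Q k) -/(Q (k + n)%N).
apply: le_trans; apply: ler_wpM2l; first exact: Q_ge0.
have u0 := lt_le_trans v0 vu.
have vb0 := beta_gt0 v0; have ub0 := beta_gt0 u0.
have vb : 0 <= v k * beta (v k) ^+ n by rewrite mulr_ge0 ?exprn_ge0 ?ltW.
rewrite lerXn2r ?nnegrE //.
  by apply: Pr_ge0 => i /=; rewrite hit_prob_le1 andbT ltW.
apply: le_trans (Pr_crossing n (_ : 0 < 1 - (1 - p) ^+ k <= 1)); last first.
  by rewrite u0 hit_prob_le1.
apply: ler_pM => //; [exact: ltW|exact: exprn_ge0 (ltW vb0)|].
rewrite lerXn2r ?nnegrE ?(ltW vb0) ?(ltW ub0) //; apply: beta_le => //.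
exact: hit_prob_le1.
Qed.

Lemma beta_v k : (0 < k)%N -> beta (v k) = expR (- cost (k%:R * p)).
Proof.
move=> k0; have /andP[v0 _] := v_bd k0.
by rewrite /cost opprK lnK // posrE; exact: beta_gt0.
Qed.

Lemma v_ge k : (0 < k)%N -> expR (- (2%:R * cost (k%:R * p) + 1)) <= v k.
Proof.
move=> k0; have := v_bd k0 => /andP[v0 v1].
have h : 0 <= v k <= 1 by rewrite !ltW.
have b2 := beta_sqr_le h; rewrite beta_v // -expRM_natl in b2.
rewrite opprD expRD.
have e2 : expR (- 1) <= 2%:R^-1 :> R.
  by apply: le_trans (expRN_le _) _; rewrite ?ler01 // -natrD.
apply: (@le_trans _ _ (2%:R * v k / 2%:R)); last by rewrite mulrC mulKf.
apply: ler_pM => //; try exact: expR_ge0.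
by rewrite -mulrN.
Qed.

(** Growth by single lines needs each of them to be hit, with a probability bounded through
    [beta ^ 2 <= 2 v]: about twice the right exponent. It is used only up to side [dl / p], where
    the costs add up to little. *)
Lemma Q_phaseA n : (0 < n)%N ->
  p * expR (- \sum_(1 <= k < n) (4%:R * cost (k%:R * p) + 2%:R)) <= Q n.
Proof.
case: n => // n _; elim: n => [|n IH].
  by rewrite big_geq // oppr0 expR0 mulr1; exact: span_prob1.
rewrite big_nat_recr //= opprD expRD mulrA.
apply: le_trans (Q_step _) => //; apply: ler_pM; [|exact: expR_ge0|exact: IH|].
  by apply: mulr_ge0; [move/andP: p01' => []|exact: expR_ge0].
have h := v_ge (ltn0Sn n).
rewrite [leLHS](_ : _ = expR (- (2%:R * cost (n.+1%:R * p) + 1)) ^+ 2).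
  by rewrite lerXn2r ?nnegrE ?expR_ge0 // (le_trans _ h) // expR_ge0.
by rewrite -expRM_natl; congr expR; ring.
Qed.

(** Jumps over [n] lines have the right exponent, [cost] per line. Each is charged at the side where
    it starts, which gives a Riemann sum of mesh [n p]; [D] pays for the factor [u] of [Pr_crossing]
    in each jump. *)
Lemma Q_phaseB n N D : (0 < n)%N -> expR (- D) <= v n ->
  Q n * expR (- \sum_(1 <= i < N.+1) (2%:R * (n%:R * cost (i%:R * (n%:R * p))) + 2%:R * D))
  <= Q (N.+1 * n)%N.
Proof.
move=> n0 Dn; elim: N => [|N IH].
  by rewrite big_geq // oppr0 expR0 mulr1 mul1n.
rewrite big_nat_recr //= opprD expRD mulrA [(N.+2 * n)%N]mulSn addnC.
have Nn0 : (0 < N.+1 * n)%N by rewrite muln_gt0.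
apply: le_trans (Q_jump n Nn0); apply: ler_pM; [|exact: expR_ge0|exact: IH|].
  by apply: mulr_ge0; [exact: Q_ge0|exact: expR_ge0].
rewrite beta_v // natrM -mulrA.
set x := cost _; rewrite [leLHS](_ : _ = (expR (- D) * expR (- x) ^+ n) ^+ 2).
  have vv : v n <= v (N.+1 * n)%N.
    rewrite /v lerD2l !lerN2 ler_expR lerN2 ler_wpM2r //.
      by move/andP: p01' => [].
    by rewrite ler_nat mulSn leq_addr.
  have w0 : 0 <= v (N.+1 * n)%N by apply: le_trans vv; apply: le_trans Dn; exact: expR_ge0.
  have D0 := expR_ge0 (- D); have X0 := exprn_ge0 n (expR_ge0 (- x)).
  rewrite lerXn2r ?nnegrE ?mulr_ge0 //.
  by apply: ler_wpM2r => //; exact: le_trans vv.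
by rewrite -expRM_natl -expRD -expRM_natl; congr expR; ring.
Qed.

(** For sides beyond [m], a line is empty with probability at most [x = exp (- k p) <= 1 / 2], and
    [1 - x >= exp (- 2 x)]. Single lines are affordable again, as [geom_tail] bounds the total by a
    small multiple of [1 / p]. *)
Lemma Q_phaseC m M : (0 < m)%N -> (m <= M)%N -> expR (- (m%:R * p)) <= 1 / 2%:R ->
  Q m * expR (- \sum_(m <= k < M) 4%:R * expR (- (k%:R * p))) <= Q M.
Proof.
move=> m0 /subnKC <-; elim: (M - m)%N => [|d IH] mh.
  by rewrite addn0 big_geq // oppr0 expR0 mulr1.
rewrite addnS big_nat_recr ?leq_addr //= opprD expRD mulrA.
have md : (0 < m + d)%N by rewrite addn_gt0 m0.
apply: le_trans (Q_step md); apply: ler_pM; [|exact: expR_ge0|exact: IH|].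
  by apply: mulr_ge0; [exact: Q_ge0|exact: expR_ge0].
rewrite /v; set x := expR (- ((m + d)%:R * p)).
have x0 : 0 <= x by exact: expR_ge0.
have x1 : x <= 1 / 2%:R.
  apply: le_trans mh; rewrite ler_expR lerN2 ler_wpM2r //.
    by move/andP: p01' => [].
  by rewrite ler_nat leq_addr.
rewrite [leLHS](_ : _ = expR (- (2%:R * x)) ^+ 2); last first.
  by rewrite -expRM_natl; congr expR; ring.
rewrite lerXn2r ?nnegrE ?expR_ge0 //; first lra.
by apply: expR_half; rewrite x0 x1.
Qed.

Lemma geom_tail m M : \sum_(m <= k < M) expR (- (k%:R * p)) <=
  2%:R * expR (- (m%:R * p)) / p.
Proof.
have /andP[p0 p1] := p01.
have [mM|Mm] := leqP m M; last first.
  by rewrite big_geq ?(ltnW Mm) // divr_ge0 ?mulr_ge0 ?expR_ge0 // ltW.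
rewrite ler_pdivlMr //.
have -> : expR (- (m%:R * p)) = expR (- p) ^+ m by rewrite -expRM_natl mulrN.
under eq_bigr => k _ do rewrite -mulrN expRM_natl.
set x := expR (- p); have x0 : 0 < x by exact: expR_gt0.
have xp : p <= 2%:R * (1 - x).
  have : x <= (1 + p)^-1 by apply: expRN_le; exact: ltW.
  have : (1 + p)^-1 <= 1 - p / 2%:R.
    rewrite -[leLHS]mul1r ler_pdivrMr; last by lra.
    have h : 0 <= p * (1 - p) by apply: mulr_ge0; lra.
    by lra.
  lra.
have key d : (\sum_(m <= k < m + d) x ^+ k) * (1 - x) = x ^+ m - x ^+ (m + d).
  elim: d => [|d IH]; first by rewrite addn0 big_geq // mul0r subrr.
  by rewrite addnS big_nat_recr ?leq_addr //= mulrDl IH exprS; ring.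
have S0 : 0 <= \sum_(m <= k < M) x ^+ k.
  by apply: sumr_ge0 => k _; apply: exprn_ge0; exact: ltW.
have := key (M - m)%N; rewrite subnKC // => e.
have xM : 0 <= x ^+ M by apply: exprn_ge0; exact: ltW.
apply: (@le_trans _ _ (2%:R * ((\sum_(m <= k < M) x ^+ k) * (1 - x)))).
  by rewrite mulrCA; apply: ler_wpM2l.
by rewrite ler_wpM2l // e; lra.
Qed.
End Steps.

Lemma nucleation e : 0 < e -> exists p0 c0, [/\ 0 < p0, 0 < c0 &
  forall p, 0 < p < p0 -> forall (M : nat) (a c : int), c0 / p <= M%:R ->
    expR (- ((2%:R * lambda + e) / p)) <= span_prob p (a, c, (M, M))].
Proof.
move=> e0; have e1 : 0 < e / 40%:R by lra.
have [d d0 hd] := cost_riemann_small e1.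
(* Jumps start at side about [dl / p], which is also their length. Below that, [dl < d] bounds the
   sum of costs, and [dl <= e / 40] the additive constants 2 of [Q_phaseA]. *)
pose dl := Num.min (d / 2%:R) (e / 40%:R).
have dl0 : 0 < dl by rewrite lt_min e1 divr_gt0.
have dld : dl < d.
  have : dl <= d / 2%:R by rewrite /dl ge_min lexx.
  by clear -d0; lra.
have dle : dl <= e / 40%:R by rewrite /dl ge_min lexx orbT.
(* [exp (- D)] bounds from below the probability that a line of [n] sites is hit, as
   [n p >= dl / 2]. The number of jumps does not depend on [p], so their total charge in [D] is
   absorbed by taking [p] small. *)
pose D := - ln (1 - expR (- (dl / 2%:R))).
have dl20 : 0 < dl / 2%:R by rewrite divr_gt0.
have w0 := expRN_bd dl20.
have eD : expR (- D) = 1 - expR (- (dl / 2%:R)).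
  by rewrite /D opprK lnK // posrE; move/andP: w0 => [].
have D0 : 0 <= D.
  by rewrite /D oppr_ge0 ln_le0 //; move/andP: w0 => [_ /ltW].
(* From side [Z / p] on, [Q_phaseC] is cheap. [N] is large enough for the jumps to reach it, since
   [(N + 1) dl / 2 > Z]. *)
pose Z := - ln (Num.min (1 / 2%:R) (e / 80%:R)).
have m0 : 0 < Num.min (1 / 2%:R) (e / 80%:R) :> R.
  by rewrite lt_min; apply/andP; split; lra.
have eZ : expR (- Z) = Num.min (1 / 2%:R) (e / 80%:R) by rewrite /Z opprK lnK.
pose N := Num.truncn (2%:R * Z / dl).
have NZ : 2%:R * Z / dl < N.+1%:R by exact: truncnS_gt.
pose p0 := Num.min (dl / 2%:R) (Num.min (e / 10%:R / (2%:R * N%:R * D + 1))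
  (Num.min (1 / 2%:R) ((e / 10%:R) ^+ 2 / 2%:R))).
have nd0 : 0 < 2%:R * N%:R * D + 1 by rewrite ltr_wpDl // !mulr_ge0.
have e10 : 0 < e / 10%:R by lra.
have p00 : 0 < p0.
  rewrite !lt_min dl20 /= divr_gt0 //= divr_gt0 //=.
  by rewrite divr_gt0 // exprn_gt0.
exists p0, (N.+1%:R * dl); split => //; first by rewrite mulr_gt0.
move=> p /andP[pp pp0] M a c cM.
move: pp0; rewrite /p0 !lt_min => /and4P[h1 h2 h3 h4].
have p1 : 0 < p < 1 by rewrite pp /=; clear -h3; lra.
pose n := Num.truncn (dl / p).
have dp0 : 0 <= dl / p by rewrite divr_ge0 // ltW.
have n1 : n%:R * p <= dl.
  by rewrite -ler_pdivlMr // truncn_le.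
have n2 : dl < n.+1%:R * p by rewrite -ltr_pdivrMr // truncnS_gt.
have n3 : dl / 2%:R <= n%:R * p.
  by rewrite -natr1 mulrDl mul1r in n2; move: n2 h1; clear; lra.
have n0 : (0 < n)%N.
  rewrite lt0n; apply/eqP => n00; move: n3; rewrite n00 mul0r.
  by rewrite leNgt dl20.
have np0 : 0 < n%:R * p by rewrite mulr_gt0 // ltr0n.
pose m := (N.+1 * n)%N.
have mM : (m <= M)%N.
  rewrite -(ler_nat R); apply: le_trans cM; rewrite /m natrM -mulrA.
  by apply: ler_wpM2l => //; rewrite ler_pdivlMr.
have mZ : expR (- (m%:R * p)) <= Num.min (1 / 2%:R) (e / 80%:R).
  rewrite -eZ ler_expR lerN2 /m natrM -mulrA.
  apply: (@le_trans _ _ (N.+1%:R * (dl / 2%:R))); last by apply: ler_wpM2l.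
  rewrite ltr_pdivrMr // in NZ; move: NZ; clear; lra.
have mh : expR (- (m%:R * p)) <= 1 / 2%:R by apply: le_trans mZ _; rewrite ge_min lexx.
have me : expR (- (m%:R * p)) <= e / 80%:R.
  by apply: le_trans mZ _; rewrite ge_min lexx orbT.
have mpos : (0 < m)%N by rewrite muln_gt0.
apply: le_trans (Q_phaseC a c p1 mpos mM mh).
have vn : expR (- D) <= 1 - expR (- (n%:R * p)).
  by rewrite eD lerD2l lerN2 ler_expR lerN2.
apply: le_trans (ler_wpM2r (expR_ge0 _) (Q_phaseB a c p1 N n0 vn)).
apply: le_trans (ler_wpM2r (expR_ge0 _)
  (ler_wpM2r (expR_ge0 _) (Q_phaseA a c p1 n0))).
(* The initial site has probability [p], subexponential at the scale [1 / p]: [exp x >= x ^ 2 / 2]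
   suffices. *)
have pe : expR (- (e / 10%:R / p)) <= p.
  rewrite expRN -[leRHS]invrK lef_pV2 ?posrE ?expR_gt0 ?invr_gt0 //.
  have x0 : 0 <= e / 10%:R / p by apply: divr_ge0; exact: ltW.
  apply: le_trans (expR_ge1Dxn 1 x0).
  have -> : (2`!)%:R = 2%:R :> R by [].
  rewrite -[leLHS]add0r lerD // expr_div_n.
  have -> : (e / 10%:R) ^+ 2 / p ^+ 2 / 2%:R = (e / 10%:R) ^+ 2 / 2%:R / p / p.
    by field; rewrite gt_eqF.
  rewrite -[leLHS]mul1r; apply: ler_wpM2r; first by rewrite invr_ge0 ltW.
  by rewrite ler_pdivlMr // mul1r ltW.
rewrite -!mulrA -!expRD.
apply: (@le_trans _ _ (expR (- (e / 10%:R / p)) * expR (- ((2%:R * lambda + 9%:R * e / 10%:R) / p)))).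
  by rewrite -expRD ler_expR -opprD lerN2 -mulrDl ler_pM2r ?invr_gt0 //; lra.
apply: ler_pM; [exact: expR_ge0|exact: expR_ge0|exact: pe|].
rewrite ler_expR -!opprD lerN2 ler_pdivlMr //.
set SA := \sum_(1 <= k < n) _; set SB := \sum_(1 <= i < N.+1) _.
set SC := \sum_(m <= k < M) _.
have hA : SA * p <= e / 10%:R + e / 20%:R.
  have s1 : \sum_(1 <= i < n) p * cost (i%:R * p) <= e / 40%:R.
    case: (n) n1 n0 => // k kp _; apply: hd => //.
    apply: le_lt_trans dld; apply: le_trans kp.
    by rewrite ler_pM2r // ler_nat.
  have -> : SA * p = 4%:R * (\sum_(1 <= i < n) p * cost (i%:R * p)) + (n - 1)%:R * (2%:R * p).
    rewrite /SA big_split /= mulrDl mulr_suml mulr_sumr sumr_const_nat.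
    congr (_ + _); last by rewrite -mulr_natl; ring.
    by apply: eq_bigr => i _; ring.
  have : (n - 1)%:R * (2%:R * p) <= 2%:R * dl.
    rewrite mulrCA; apply: ler_wpM2l => //; apply: le_trans n1.
    by rewrite ler_pM2r // ler_nat leq_subr.
  by move: s1 dle; clear; lra.
have hB : SB * p <= 2%:R * lambda + e / 10%:R.
  have s2 := cost_riemann_le N np0.
  have -> : SB * p = 2%:R * (\sum_(1 <= i < N.+1) n%:R * p * cost (i%:R * (n%:R * p)))
      + (N%:R * (2%:R * D)) * p.
    rewrite /SB big_split /= mulrDl mulr_suml mulr_sumr sumr_const_nat subn1 /=.
    congr (_ + _); last by rewrite -[2%:R * D *+ N]mulr_natl.
    by apply: eq_bigr => i _; ring.
  have : (N%:R * (2%:R * D)) * p <= e / 10%:R.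
    rewrite ltr_pdivlMr // in h2; have : 0 <= p by exact: ltW.
    by move: h2; clear; lra.
  by move: s2; clear; lra.
have hC : SC * p <= e / 10%:R.
  rewrite /SC -mulr_sumr.
  have := geom_tail p1 m M; rewrite ler_pdivlMr //.
  by move: me; clear; lra.
rewrite !mulrDl; move: hA hB hC e0; clear; lra.
Qed.
End Nucleation.

Definition big_square (L : nat) : rect := (1, 1, (L, L)).

Lemma square_rset L : square L = rset (big_square L).
Proof.
apply/seteqP; split=> -[z1 z2]; rewrite /square; runfold.
  by move=> [/andP[? ?] /andP[? ?]]; split; lia.
by move=> [? ? ? ?]; split; apply/andP; split; lia.
Qed.

(** * From one spanned block to the whole square *)

Section LargeSquare.
Context {R : realType}.

Variable p : R.
Hypothesis p01 : 0 <= p <= 1.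

Let p01' : forall x : int * int, 0 <= (fun=> p) x <= 1. Proof. by []. Qed.

Definition block (M : nat) (ij : nat * nat) : rect :=
  (1 + (ij.1 * M)%N%:Z, 1 + (ij.2 * M)%N%:Z, (M, M)).

Lemma block_sub L M m ij : (m * M <= L)%N -> (ij.1 < m)%N -> (ij.2 < m)%N ->
  rsub (block M ij) (big_square L).
Proof.
case: ij => i j /= mL im jm.
have h1 : (i * M + M <= L)%N by rewrite -mulSnr (leq_trans _ mL) // leq_mul2r im orbT.
have h2 : (j * M + M <= L)%N by rewrite -mulSnr (leq_trans _ mL) // leq_mul2r jm orbT.
by rewrite /block /big_square; runfold; split; lia.
Qed.

(** The blocks are disjoint, so by [Ex_coarse] the set of spanned blocks is an independent random
    set, and the event says that it is empty. The key of a site is the index of its block, by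
    integer division. *)
Lemma no_block_spanned L M m (Q0 : R) : (0 < M)%N -> (m * M <= L)%N ->
  0 <= Q0 <= 1 -> (forall a c, Q0 <= span_prob p (a, c, (M, M))) ->
  Pr (fun=> p) (rsites (big_square L))
    (fun Y => forall ij, (ij.1 < m)%N -> (ij.2 < m)%N -> ~ spanned (block M ij) Y)
  <= (1 - Q0) ^+ (m * m).
Proof.
move=> M0 mL /andP[Q00 Q01] hQ.
pose s := [seq (i, j) | i <- iota 0 m, j <- iota 0 m].
have us : uniq s.
  apply: allpairs_uniq; [exact: iota_uniq|exact: iota_uniq|].
  by move=> [? ?] [? ?] _ _ [-> ->].
have ins ij : ij \in s <-> (ij.1 < m)%N /\ (ij.2 < m)%N.
  split; first by move=> /allpairsP[[i j] [/=]]; rewrite !mem_iota !add0n => ? ? ->.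
  case: ij => i j /= [? ?]; apply/allpairsP; exists (i, j).
  by rewrite !mem_iota !add0n.
pose cs ij := rsites (block M ij).
have uf : uniq (flatten [seq cs ij | ij <- s]).
  apply: (@uniq_flatten_key _ _ _
    (fun z : int * int => (`|z.1 - 1|%N %/ M, `|z.2 - 1|%N %/ M)%N)) => //.
    by move=> *; exact: uniq_rsites.
  move=> [i j] [z1 z2] _ /mem_rsites[]; rewrite /block /rx /ry /rw /rh /=.
  move=> h1 h2 h3 h4; congr pair.
    have -> : `|z1 - 1|%N = (i * M + (`|z1 - 1| - i * M))%N by lia.
    by rewrite divnMDl // divn_small ?addn0 //; lia.
  have -> : `|z2 - 1|%N = (j * M + (`|z2 - 1| - j * M))%N by lia.
  by rewrite divnMDl // divn_small ?addn0 //; lia.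
pose E ij := spanned (block M ij).
have dE ij : ij \in s -> dep_on (cs ij) (E ij) by move=> _; exact: dep_on_spanned.
have sub : {subset flatten [seq cs ij | ij <- s] <= rsites (big_square L)}.
  move=> z /flatten_mapP[ij /ins [h1 h2] /mem_rsites zi]; apply/mem_rsites.
  exact: (rsub_set (block_sub mL h1 h2)).
pose F Y := [set ij | ij \in s /\ E ij Y] = set0.
have dF : dep_on (flatten [seq cs ij | ij <- s]) F.
  move=> Y Y' h e; apply/seteqP; split => // ij [ii Ei].
  rewrite -[X in X ij]e; split => //; apply: (dE ij ii) Ei => x xi.
  have [h1 h2] := h x ltac:(by apply/flatten_mapP; exists ij).
  by split.
rewrite (@Pr_iff _ _ _ _ _ F); last first.
  move=> Y _; split.
    by move=> h; apply/seteqP; split => // ij [/ins[h1 h2] /h]; apply.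
  move=> e ij h1 h2 Ei; have : [set ij | ij \in s /\ E ij Y] ij.
    by split => //; apply/ins.
  by rewrite e.
rewrite (Pr_restrict _ (uniq_rsites _) uf sub dF).
rewrite /Pr (@Ex_coarse _ _ _ _ cs E s (fun N => (`[< N = set0 >])%:R) us uf dE).
rewrite Ex_empty.
have -> : (m * m)%N = size s by rewrite size_allpairs !size_iota.
elim: (s) => [|ij t IH]; first by rewrite big_nil.
rewrite big_cons exprS; apply: ler_pM => //.
- by rewrite subr_ge0; apply: Pr_le1.
- by apply: prodr_ge0 => k _; rewrite subr_ge0; apply: Pr_le1.
- by rewrite lerD2l lerN2; exact: hQ.
Qed.

Lemma empty_segment L M (seg : int * int -> rect) :
  (forall z, size (rsites (seg z)) = M) ->
  Pr (fun=> p) (rsites (big_square L))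
    (fun Y => exists2 z, z \in rsites (big_square L) &
      rsub (seg z) (big_square L) /\ ~ hit (rsites (seg z)) Y)
  <= (L * L)%:R * (1 - p) ^+ M.
Proof.
move=> sz; have -> : (L * L)%N = size (rsites (big_square L)).
  by rewrite size_rsites.
have p1 : 0 <= 1 - p by rewrite subr_ge0; move/andP: p01 => [].
apply: Pr_exists => // z _.
have [sb|nsb] := pselect (rsub (seg z) (big_square L)); last first.
  rewrite -[leLHS]addr0; apply: (@le_trans _ _ 0); last exact: exprn_ge0.
  rewrite addr0 -(Ex_const (fun=> p) (rsites (big_square L)) 0).
  by apply: Ex_le => // Y _; case: asboolP => // -[].
apply: (@le_trans _ _ (Pr (fun=> p) (rsites (big_square L))
    (fun Y => ~ hit (rsites (seg z)) Y))).
  by apply: Pr_le => // Y _ [].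
rewrite Pr_not //.
rewrite (Pr_restrict _ (uniq_rsites _) (uniq_rsites (seg z)) _ (@dep_on_hit _ (rsites (seg z)))); last first.
  by move=> x /mem_rsites /(rsub_set sb) /mem_rsites.
by rewrite Pr_hit sz opprB addrC subrK.
Qed.

Lemma large_square_spanned L M m (Q0 : R) : (0 < M)%N -> (m * M <= L)%N ->
  (M <= L)%N -> 0 <= Q0 <= 1 -> (forall a c, Q0 <= span_prob p (a, c, (M, M))) ->
  1 - ((1 - Q0) ^+ (m * m) + 2%:R * (L%:R ^+ 2 * (1 - p) ^+ M)) <=
  span_prob p (big_square L).
Proof.
move=> M0 mL ML Q01 hQ.
have h1 := no_block_spanned M0 mL Q01 hQ.
pose hor (z : int * int) : rect := (z.1, z.2, (M, 1%N)).
pose ver (z : int * int) : rect := (z.1, z.2, (1%N, M)).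
have h2 := @empty_segment L M hor (fun z => etrans (size_rsites (hor z)) (muln1 M)).
have h3 := @empty_segment L M ver (fun z => etrans (size_rsites (ver z)) (mul1n M)).
have ub := uniq_rsites (big_square L).
pose E1 Y := forall ij : nat * nat, (ij.1 < m)%N -> (ij.2 < m)%N -> ~ spanned (block M ij) Y.
pose E2 (seg : int * int -> rect) Y := exists2 z, z \in rsites (big_square L) &
      rsub (seg z) (big_square L) /\ ~ hit (rsites (seg z)) Y.
have : Pr (fun=> p) (rsites (big_square L)) (fun Y => ~ spanned (big_square L) Y) <=
    Pr (fun=> p) (rsites (big_square L)) (fun Y => E1 Y \/ (E2 hor Y \/ E2 ver Y)).
  apply: Pr_le => // Y _ nsp; apply: contrapT => no; apply: nsp.
  have [ij [im jm sp]] : exists ij : nat * nat, [/\ (ij.1 < m)%N, (ij.2 < m)%N & spanned (block M ij) Y].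
    apply: contrapT => n; apply: no; left => ij i1 i2 s; apply: n.
    by exists ij.
  have nh z : z \in rsites (big_square L) -> rsub (hor z) (big_square L) ->
      hit (rsites (hor z)) Y.
    by move=> zi sb; apply: contrapT => n; apply: no; right; left; exists z.
  have nv z : z \in rsites (big_square L) -> rsub (ver z) (big_square L) ->
      hit (rsites (ver z)) Y.
    by move=> zi sb; apply: contrapT => n; apply: no; right; right; exists z.
  apply/seteqP; split; first exact: closure_rect.
  have bs := block_sub mL im jm.
  apply: (@nucleus_fill _ (block M ij) _ M (@closure_stable _) _ bs M0) => //.
  - rewrite -[X in X `<=` _]sp; apply: closure_mono => z [? ?]; split => //.
    exact: rsub_set bs _ _.
  - move=> x y sb; have [||z zi Yz] := nh (x, y) => //.
      by apply/mem_rsites/(rsub_set sb); split => /=; rewrite /rx /ry /rw /rh /=; lia.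
    exists z; have /mem_rsites hz := zi; split => //.
    by apply: closure_sub; split => //; exact: rsub_set sb _ hz.
  - move=> x y sb; have [||z zi Yz] := nv (x, y) => //.
      by apply/mem_rsites/(rsub_set sb); split => /=; rewrite /rx /ry /rw /rh /=; lia.
    exists z; have /mem_rsites hz := zi; split => //.
    by apply: closure_sub; split => //; exact: rsub_set sb _ hz.
rewrite Pr_not // -/(span_prob p (big_square L)).
have o1 := Pr_or p01' (rsites (big_square L)) E1 (fun Y => E2 hor Y \/ E2 ver Y).
have o2 := Pr_or p01' (rsites (big_square L)) (E2 hor) (E2 ver).
rewrite natrM -expr2 in h2; rewrite natrM -expr2 in h3.
move: h1 h2 h3 o1 o2; rewrite -/E1 -/(E2 hor) -/(E2 ver); clear.
set A := Pr _ _ E1; set B := Pr _ _ (E2 hor); set C := Pr _ _ (E2 ver).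
set X := _ ^+ (m * m); set W := _ * (1 - p) ^+ M.
set U := Pr _ _ _; set V := Pr _ _ _; set S := span_prob _ _.
by clearbody A B C X W U V S; lra.
Qed.
End LargeSquare.

(** * The supercritical bound *)

Section Supercritical.
Context {R : realType}.
Implicit Types (p e l : R).

Lemma lambda_gt0 : 0 < lambda :> R.
Proof. by apply: divr_gt0 => //; apply: exprn_gt0; exact: pi_gt0. Qed.

Lemma expR_ge_pow (x : R) n : 0 <= x -> x ^+ n.+1 / (n.+1)`!%:R <= expR x.
Proof. by move=> /(expR_ge1Dxn n); apply: le_trans; rewrite lerDr. Qed.

Lemma supercritical_bound e : 0 < e -> exists p0 K l0, [/\ 0 < p0, 0 < K, 0 < l0 &
  forall p (L : nat), 0 < p < p0 -> l0 <= ln L%:R -> lambda + e <= p * ln L%:R ->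
    1 - K / ln L%:R <= span_prob p (big_square L)].
Proof.
move=> e0; have [p1 [c0 [p10 c00 nuc]]] := nucleation e0.
have l0 := lambda_gt0; set mu := lambda + e; have mu0 : 0 < mu by rewrite addr_gt0.
pose C := 3%:R / mu + 1; have C0 : 0 < C by rewrite addr_gt0 // divr_gt0.
pose ka := e / mu; have ka0 : 0 < ka by rewrite divr_gt0.
(* The expected number of spanned blocks is at least [exp (ka l) / (4 C ^ 2 l ^ 4)] with [l = ln L];
   the term of order 5 of the exponential makes this at least [c l]. *)
pose c := ka ^+ 5 / 120%:R / (4%:R * C ^+ 2).
have c_gt0 : 0 < c.
  rewrite /c; apply: divr_gt0; first by apply: divr_gt0 => //; exact: exprn_gt0.
  by apply: mulr_gt0 => //; exact: exprn_gt0.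
(* The term [c^-1] bounds the absence of spanned blocks, through [exp (- c l) <= 1 / (c l)], and 2
   the empty segments, horizontal and vertical. [l >= 12 C] yields [2 M <= L], and [l >= c0] the
   side required by [nucleation]. *)
exists (Num.min p1 1), (c^-1 + 2%:R), (c0 + 1 + 12%:R * C).
split.
- by rewrite lt_min p10 ltr01.
- by rewrite addr_gt0 ?invr_gt0.
- by rewrite addr_gt0 ?mulr_gt0 // addr_gt0.

move=> p L /andP[pp]; rewrite lt_min => /andP[pp1 p_1] lL pl.
set l := ln L%:R in lL pl *.
have C12 : 0 < 12%:R * C by rewrite mulr_gt0.
have l1 : 1 <= l by move: lL c00 C12; clear; lra.
have lp : 0 < l by apply: lt_le_trans l1.
have Lpos : (0 < L)%N.
  by rewrite lt0n; apply/eqP => L0; move: lp; rewrite /l L0 ln0 // ltxx.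
have LR : 0 < L%:R :> R by rewrite ltr0n.
have eL : expR l = L%:R by rewrite /l lnK // posrE.
(* With the factor 3 a given segment is empty with probability at most [L ^ -3], so that the union
   over [L ^ 2] positions leaves [1 / L]. *)
pose M := (Num.truncn (3%:R * l / p)).+1.
have M1 : 3%:R * l / p < M%:R by exact: truncnS_gt.
have lp0 : 0 <= 3%:R * l / p by rewrite divr_ge0 ?mulr_ge0 ?ltW.
have M2 : M%:R <= 3%:R * l / p + 1.
  by rewrite /M -natr1 lerD2r truncn_le.
have ip : p^-1 <= l / mu.
  by rewrite ler_pdivlMr // mulrC ler_pdivrMr // mulrC.
have MC : M%:R <= C * l ^+ 2.
  apply: (le_trans M2).
  have -> : C * l ^+ 2 = 3%:R * l * (l / mu) + l ^+ 2 by rewrite /C; ring.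
  apply: lerD.
    by apply: ler_wpM2l => //; rewrite mulr_ge0 // ltW.
  by rewrite exprn_ege1.
have M0 : 0 < M%:R :> R by rewrite ltr0n.
have Cl0 : 0 < C * l ^+ 2 by rewrite mulr_gt0 // exprn_gt0.
have L2M : 2%:R * M%:R <= L%:R :> R.
  apply: (@le_trans _ _ (2%:R * (C * l ^+ 2))); first by rewrite ler_wpM2l.
  rewrite -eL; apply: le_trans (@expR_ge_pow l 2 (ltW lp)).
  have -> : (3`!)%:R = 6%:R :> R by [].
  have -> : l ^+ 3 / 6%:R = (l / 6%:R) * l ^+ 2 by rewrite [l ^+ 3]exprS; ring.
  rewrite mulrA ler_wpM2r ?exprn_ge0 ?(ltW lp) //.
  by move: lL c00; clear; lra.
pose m := (L %/ M)%N.
have mML : (m * M <= L)%N by exact: leq_trunc_div.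
have ML : (M <= L)%N.
  by rewrite -(ler_nat R); move: L2M M0; clear; lra.
have mL : L%:R / (2%:R * M%:R) <= m%:R :> R.
  rewrite ler_pdivrMr ?mulr_gt0 //.
  have : (L <= m * M + M)%N by rewrite {1}(divn_eq L M) leq_add2l ltnW // ltn_pmod.
  rewrite -(ler_nat R) natrD natrM; move: L2M; clear.
  by lra.
have np : (1 - p) ^+ M <= expR (- (3%:R * l)).
  have h : 0 <= 1 - p by rewrite subr_ge0 ltW.
  apply: (@le_trans _ _ (expR (- p) ^+ M)).
    by rewrite lerXn2r ?nnegrE ?expR_ge0 // expR_ge1Dx.
  rewrite -expRM_natl ler_expR mulrN lerN2.
  by rewrite -ler_pdivrMr // ltW.
have le0 : 0 <= 2%:R * lambda + e by move: l0 e0; clear; lra.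
pose Q0 := expR (- ((2%:R * lambda + e) / p)).
have c0M : c0 / p <= M%:R.
  apply: le_trans (ltW M1); rewrite ler_pM2r ?invr_gt0 //.
  by move: lL C12 lp; clear; lra.
have pp1' : 0 < p < p1 by rewrite pp.
have Q01 : 0 <= Q0 <= 1.
  by rewrite expR_ge0 /= /Q0 expR_le1 oppr_le0 divr_ge0 // ltW.
have p01 : 0 <= p <= 1 by rewrite !ltW.
have := @large_square_spanned R p p01 L M m Q0 isT mML ML Q01
  (fun a c => nuc p pp1' M a c c0M).
apply: le_trans; rewrite lerD2l lerN2 [leRHS]mulrDl; apply: lerD; last first.
  apply: (@le_trans _ _ (2%:R * expR (- l))).
    rewrite ler_wpM2l // -eL -expRM_natl.
    apply: (@le_trans _ _ (expR (2%:R * l) * expR (- (3%:R * l)))).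
      by rewrite ler_wpM2l ?expR_ge0.
    by rewrite -expRD ler_expR; move: lp; clear; lra.
  rewrite ler_wpM2l // expRN lef_pV2 ?posrE ?expR_gt0 //.
  by apply: le_trans (expR_ge1Dx l); rewrite lerDr.
have Qm : c * l <= Q0 * (m * m)%:R.
  have Q0ge : expR (ka * l) * expR (- (2%:R * l)) <= Q0.
    rewrite -expRD /Q0 ler_expR.
    have e1 : (2%:R * lambda + e) / p <= (2%:R * lambda + e) * (l / mu).
      by rewrite ler_wpM2l.
    have e2 : (2%:R * lambda + e) * (l / mu) = 2%:R * l - ka * l.
      by rewrite /ka /mu; field; rewrite gt_eqF // -/mu.
    by rewrite e2 in e1; move: e1; clear; lra.
  have m2 : expR (2%:R * l) / (4%:R * (C * l ^+ 2) ^+ 2) <= (m * m)%:R.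
    rewrite natrM -expr2; apply: (@le_trans _ _ ((L%:R / (2%:R * M%:R)) ^+ 2)); last first.
      by rewrite lerXn2r ?nnegrE // divr_ge0 ?mulr_ge0.
    rewrite expr_div_n -eL -expRM_natl.
    rewrite ler_wpM2l ?expR_ge0 // lef_pV2 ?posrE ?exprn_gt0 ?mulr_gt0 ?exprn_gt0 ?mulr_gt0 ?exprn_gt0 //.
    rewrite exprMn.
    have -> : (2%:R : R) ^+ 2 = 4%:R by rewrite -natrX.
    by rewrite ler_wpM2l // lerXn2r ?nnegrE // ltW.
  apply: (@le_trans _ _ (expR (ka * l) * expR (- (2%:R * l)) *
    (expR (2%:R * l) / (4%:R * (C * l ^+ 2) ^+ 2)))); last first.
    have h1 : 0 <= expR (ka * l) * expR (- (2%:R * l)) by rewrite mulr_ge0 ?expR_ge0.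
    apply: ler_pM => //; apply: divr_ge0; first exact: expR_ge0.
    by rewrite mulr_ge0 // exprn_ge0 // ltW.
  rewrite mulrA -[_ * _ * expR (2%:R * l)]mulrA -expRD addrC subrr expR0 mulr1.
  rewrite ler_pdivlMr ?mulr_gt0 ?exprn_gt0 ?mulr_gt0 ?exprn_gt0 //.
  have kl0 : 0 <= ka * l by rewrite mulr_ge0 ?ltW.
  apply: le_trans (expR_ge_pow 4 kl0).
  have -> : (5`!)%:R = 120%:R :> R by [].
  rewrite le_eqVlt; apply/orP; left; apply/eqP; rewrite /c; field.
  by rewrite gt_eqF.
apply: (@le_trans _ _ (expR (- (c * l)))).
  apply: (@le_trans _ _ (expR (- Q0) ^+ (m * m))).
    rewrite lerXn2r ?nnegrE ?expR_ge0 ?expR_ge1Dx //.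
    by rewrite subr_ge0; move/andP: Q01 => [].
  by rewrite -expRM_natl ler_expR mulrN lerN2 [leRHS]mulrC.
have cl0 : 0 < c * l by exact: mulr_gt0.
rewrite expRN -invfM lef_pV2 ?posrE ?expR_gt0 //.
by apply: le_trans (expR_ge1Dx (c * l)); rewrite lerDr.
Qed.
End Supercritical.

(** * Upper bound on the spanning probability *)

Definition nogap_from (m l : nat) (N : set nat) : Prop :=
  forall i, (m <= i)%N -> (i.+1 < m + l)%N -> N i \/ N i.+1.

Lemma nogap_mono m l (N N' : set nat) :
  (forall i, (m <= i)%N -> (i < m + l)%N -> N i -> N' i) ->
  nogap_from m l N -> nogap_from m l N'.
Proof.
move=> h g i mi il; have [Ni|Ni] := g i mi il; [left|right]; apply: h => //.
  exact: ltnW.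
exact: leqW.
Qed.

(** * Crossing probabilities from above, with some lines given for free *)

Section NoGap.
Context {R : realType}.
Variables (u : R) (O : set nat).
Hypothesis u01 : 0 < u <= 1.

Let B m l : R := Pr (fun=> u) (iota m l) (fun N => nogap_from m l (N `|` O)).
Let b := beta u.
Let w i : R := if `[< O i >] then b ^- 2 else 1.
Let W m l : R := \prod_(i <- iota m l) w i.

Let u01' : forall n : nat, 0 <= (fun=> u) n <= 1.
Proof. by move=> n /=; move/andP: u01 => [/ltW -> ->]. Qed.

Let b0 : 0 < b. Proof. by apply: beta_gt0; move/andP: u01 => []. Qed.
Let b1 : b <= 1. Proof. by apply: beta_le1; move/andP: u01 => [/ltW -> ->]. Qed.
Let be : b ^+ 2 = u * b + u * (1 - u).
Proof. by apply: beta_eq; move/andP: u01 => [/ltW -> ->]. Qed.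

Lemma nogap_weight_ge1 : 1 <= b ^- 2.
Proof. by rewrite invf_ge1 ?exprn_gt0 // exprn_ile1 // ltW. Qed.

Lemma nogap_w_ge1 i : 1 <= w i.
Proof. by rewrite /w; case: ifP => _ //; exact: nogap_weight_ge1. Qed.

Lemma nogap_W_ge0 m l : 0 <= W m l.
Proof. by apply: prodr_ge0 => i _; apply: le_trans (nogap_w_ge1 i). Qed.

Lemma nogap_drop m l (N : set nat) : nogap_from m l.+1 N -> nogap_from m.+1 l N.
Proof. by move=> g i mi il; apply: g; [exact: ltnW|rewrite -addSnnS]. Qed.

Lemma nogap_irr m l (N : set nat) : nogap_from m.+1 l ((m |` N) `|` O) ->
  nogap_from m.+1 l (N `|` O).
Proof.
apply: nogap_mono => i mi _ [[e|?]|?]; [|by left|by right].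
by move: mi; rewrite e ltnn.
Qed.

Lemma B_drop m l : B m l.+1 <= B m.+1 l.
Proof.
have -> : B m l.+1 = u * Pr (fun=> u) (iota m.+1 l) (fun N => nogap_from m l.+1 ((m |` N) `|` O))
   + (1 - u) * Pr (fun=> u) (iota m.+1 l) (fun N => nogap_from m l.+1 (N `|` O)) by [].
have h1 : Pr (fun=> u) (iota m.+1 l) (fun N => nogap_from m l.+1 ((m |` N) `|` O)) <= B m.+1 l.
  by apply: Pr_le => // N _ /nogap_drop /nogap_irr.
have h2 : Pr (fun=> u) (iota m.+1 l) (fun N => nogap_from m l.+1 (N `|` O)) <= B m.+1 l.
  by apply: Pr_le => // N _ /nogap_drop.
have /andP[u0 u1] := u01.
rewrite [leRHS](_ : _ = u * B m.+1 l + (1 - u) * B m.+1 l); last by ring.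
by apply: lerD; apply: ler_wpM2l; rewrite ?subr_ge0 // ltW.
Qed.

Lemma B_step m l : ~ O m -> ~ O m.+1 ->
  B m l.+2 <= u * B m.+1 l.+1 + (1 - u) * (u * B m.+2 l).
Proof.
move=> Om Om1; have /andP[u0 u1] := u01.
have -> : B m l.+2 = u * Pr (fun=> u) (iota m.+1 l.+1) (fun N => nogap_from m l.+2 ((m |` N) `|` O))
   + (1 - u) * (u * Pr (fun=> u) (iota m.+2 l) (fun N => nogap_from m l.+2 ((m.+1 |` N) `|` O))
     + (1 - u) * Pr (fun=> u) (iota m.+2 l) (fun N => nogap_from m l.+2 (N `|` O))) by [].
have h1 : Pr (fun=> u) (iota m.+1 l.+1) (fun N => nogap_from m l.+2 ((m |` N) `|` O)) <= B m.+1 l.+1.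
  by apply: Pr_le => // N _ /nogap_drop /nogap_irr.
have h2 : Pr (fun=> u) (iota m.+2 l) (fun N => nogap_from m l.+2 ((m.+1 |` N) `|` O)) <= B m.+2 l.
  by apply: Pr_le => // N _ /nogap_drop /nogap_drop /nogap_irr.
have h3 : Pr (fun=> u) (iota m.+2 l) (fun N => nogap_from m l.+2 (N `|` O)) <= 0.
  rewrite -(Ex_const (fun=> u) (iota m.+2 l) 0); apply: Ex_le => // N Ns.
  case: asboolP => // g; exfalso.
  have ml : (m.+1 < m + l.+2)%N by lia.
  by have [[|//]|[|//]] := g m (leqnn m) ml => /Ns /=; rewrite mem_iota; lia.
have u1' : 0 <= 1 - u by rewrite subr_ge0.
apply: lerD; apply: ler_wpM2l => //; first exact: ltW.
rewrite -[leRHS]addr0; apply: lerD; first by apply: ler_wpM2l => //; exact: ltW.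
by rewrite mulr_ge0_le0.
Qed.

Lemma W_cons m l : W m l.+1 = w m * W m.+1 l.
Proof. by rewrite /W /= big_cons. Qed.

(** The recursion of [Pr_crossing_from], now as an upper bound. The lines of [O] count as hit;
    skipping one together with its predecessor drops at most two lines, hence two powers of [b],
    which the weight [b ^- 2] restores. The factor [b] on the left covers [l = 1]. *)
Lemma nogap_bound m l : b * B m l <= b ^+ l * W m l.
Proof.
have /andP[u0 u1] := u01; have b0' := b0.
suff H : forall k, (k <= l)%N -> forall m, b * B m k <= b ^+ k * W m k by exact: H.
elim: l {m} => [|l IH] k.
  rewrite leqn0 => /eqP -> m; rewrite expr0 mul1r /W big_nil.
  rewrite -[leRHS]mul1r; apply: ler_pM; [exact: ltW|exact: Pr_ge0|exact: b1|].
  exact: Pr_le1.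
case: k => [_|[_|k kl]] m; first exact: IH.
  rewrite expr1 W_cons /W big_nil mulr1 ler_wpM2l ?(ltW b0) //.
  by apply: le_trans (nogap_w_ge1 m); exact: Pr_le1.
have k1 := IH k.+1 ltac:(lia) m.+1; have k2 := IH k ltac:(lia) m.+2.
have d1 := B_drop m k.+1; have d2 := B_drop m.+1 k.
have W2 := nogap_W_ge0 m.+2 k; have W1 := nogap_W_ge0 m.+1 k.+1.
have bk : b ^+ k.+2 * b ^- 2 = b ^+ k by rewrite -addn2 exprD mulfK // gt_eqF // exprn_gt0.
have [Om|Om] := pselect (O m).
  rewrite W_cons /w asboolT // mulrA bk.
  apply: (@le_trans _ _ (b * B m.+1 k.+1)); first by rewrite ler_wpM2l // ltW.
  apply: (le_trans k1); apply: ler_wpM2r => //.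
  by rewrite exprS ler_piMl // exprn_ge0 // ltW.
have [Om1|Om1] := pselect (O m.+1).
  rewrite !W_cons /w (asboolF Om) (asboolT Om1) mul1r mulrA bk.
  apply: (@le_trans _ _ (b * B m.+2 k)) => //.
  by apply: ler_wpM2l; [exact: ltW|exact: le_trans d1 d2].
rewrite !W_cons /w (asboolF Om) (asboolF Om1) !mul1r in k1 *.
have st := B_step k Om Om1.
apply: (@le_trans _ _ (b * (u * B m.+1 k.+1 + (1 - u) * (u * B m.+2 k)))).
  by rewrite ler_wpM2l // ltW.
have -> : b * (u * B m.+1 k.+1 + (1 - u) * (u * B m.+2 k)) =
  u * (b * B m.+1 k.+1) + (1 - u) * u * (b * B m.+2 k) by ring.
have -> : b ^+ k.+2 * W m.+2 k = u * (b ^+ k.+1 * W m.+2 k) + (1 - u) * u * (b ^+ k * W m.+2 k).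
  by rewrite -addn2 exprD be exprS; ring.
apply: lerD; apply: ler_wpM2l => //; first exact: ltW.
by rewrite mulr_ge0 ?subr_ge0 // ltW.
Qed.
End NoGap.

Lemma size_col a c h i : size (col a c h i) = h.
Proof. by rewrite size_rsites mul1n. Qed.

Lemma size_row a c w i : size (row a c w i) = w.
Proof. by rewrite size_rsites muln1. Qed.

Lemma mem_cols a c h m l (z : int * int) : z \in cols a c h (iota m l) <->
  [/\ a + m%:Z <= z.1, z.1 < a + (m + l)%N%:Z, c <= z.2 & z.2 < c + h%:Z].
Proof.
split.
  move=> /flatten_mapP[i]; rewrite mem_iota => il /mem_col[].
  by case: z => z1 z2 /= -> ? ?; split => //; lia.
case: z => z1 z2 /= [? ? ? ?]; apply/flatten_mapP; exists `|z1 - a|%N.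
  by rewrite mem_iota; lia.
by apply/mem_col; split => //=; lia.
Qed.

Lemma mem_rows a c w m l (z : int * int) : z \in rows a c w (iota m l) <->
  [/\ c + m%:Z <= z.2, z.2 < c + (m + l)%N%:Z, a <= z.1 & z.1 < a + w%:Z].
Proof.
split.
  move=> /flatten_mapP[i]; rewrite mem_iota => il /mem_row[].
  by case: z => z1 z2 /= -> ? ?; split => //; lia.
case: z => z1 z2 /= [? ? ? ?]; apply/flatten_mapP; exists `|z2 - c|%N.
  by rewrite mem_iota; lia.
by apply/mem_row; split => //=; lia.
Qed.

Definition colhit (r : rect) (Y : set site) : set nat :=
  [set i | exists z, [/\ Y z, rset r z & z.1 = rx r + i%:Z]].
Definition rowhit (r : rect) (Y : set site) : set nat :=
  [set i | exists z, [/\ Y z, rset r z & z.2 = ry r + i%:Z]].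

Lemma spanned_nogap_col r Y : rpos r -> spanned r Y -> nogap_from 0 (rw r) (colhit r Y).
Proof.
move=> pr sp i _; rewrite add0n => il.
have [||z [Yz rz e]] := @spanned_no_col_gap Y r (rx r + i%:Z) pr sp; [lia|lia|].
case: e => e; [left|right]; exists z; split => //; rewrite e; lia.
Qed.

Lemma spanned_nogap_row r Y : rpos r -> spanned r Y -> nogap_from 0 (rh r) (rowhit r Y).
Proof.
move=> pr sp i _; rewrite add0n => il.
have [||z [Yz rz e]] := @spanned_no_row_gap Y r (ry r + i%:Z) pr sp; [lia|lia|].
case: e => e; [left|right]; exists z; split => //; rewrite e; lia.
Qed.

Section Strips.
Context {R : realType}.
Variable p : R.
Hypothesis p01 : 0 < p < 1.

Let p01' : 0 <= p <= 1. Proof. by move/andP: p01 => [/ltW -> /ltW ->]. Qed.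

Definition line_beta (n : nat) : R := beta (1 - (1 - p) ^+ n).

Lemma line_hit_bd n : (0 < n)%N -> 0 < 1 - (1 - p) ^+ n < 1.
Proof.
case: n => // n _; move/andP: p01 => [p0 p1].
have q0 : 0 < 1 - p by rewrite subr_gt0.
rewrite gtrBl exprn_gt0 // andbT subr_gt0 exprn_ilt1 //; first exact: ltW.
by rewrite gtrBl.
Qed.

Lemma line_beta_gt0 n : (0 < n)%N -> 0 < line_beta n.
Proof. by move=> /line_hit_bd /andP[h _]; exact: beta_gt0. Qed.

Lemma line_beta_le1 n : (0 < n)%N -> line_beta n <= 1.
Proof. by move=> /line_hit_bd /andP[h1 h2]; apply: beta_le1; rewrite !ltW. Qed.

Lemma prod_flag (x : R) (O : set nat) s :
  \prod_(i <- s) (if `[< O i >] then x else 1) = x ^+ count (fun i => `[< O i >]) s.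
Proof.
elim: s => [|i s IH]; first by rewrite big_nil.
by rewrite big_cons IH /=; case: ifP => _; rewrite ?exprS ?mul1r.
Qed.

Lemma Pr_strip (cs : nat -> seq (int * int)) n m l (O : set nat) : (0 < n)%N ->
  uniq (flatten [seq cs i | i <- iota m l]) -> (forall i, size (cs i) = n) ->
  line_beta n * Pr (fun=> p) (flatten [seq cs i | i <- iota m l])
    (fun Z => nogap_from m l (hit_set cs (iota m l) Z `|` O)) <=
  line_beta n ^+ l * (line_beta n ^- 2) ^+ count (fun i => `[< O i >]) (iota m l).
Proof.
move=> n0 uf sz.
have := line_hit_bd n0 => /andP[u0 u1].
rewrite /Pr (@Ex_lines R p cs n (iota m l)
  (fun N => (`[< nogap_from m l (N `|` O) >])%:R) (iota_uniq _ _) uf sz).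
rewrite -prod_flag; apply: nogap_bound; rewrite u0 ltW //.
Qed.

Lemma span_prob_cols (r : rect) : rpos r ->
  line_beta (rh r) * span_prob p r <= line_beta (rh r) ^+ rw r.
Proof.
move: r => [[A C] [W H]] [] /=; rewrite /rw /rh /= => W0 H0.
set r : rect := (A, C, (W, H)).
have pr : rpos r by [].
have uc : uniq (cols A C H (iota 0 W)) by apply: uniq_cols; exact: iota_uniq.
have h := @Pr_strip (col A C H) H 0 W set0 H0 uc (size_col A C H).
have c0 : count (fun i => `[< (set0 : set nat) i >]) (iota 0 W) = 0%N.
  by apply/eqP; rewrite -leqn0 leqNgt -has_count; apply/hasPn => i _; rewrite asboolF.
rewrite c0 expr0 mulr1 in h; apply: le_trans h.
rewrite ler_wpM2l //; first exact: ltW (line_beta_gt0 H0).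
have dE := @dep_on_hit_set (fun N => nogap_from 0 W (N `|` set0)) (col A C H) (iota 0 W).
have sub : {subset cols A C H (iota 0 W) <= rsites r}.
  by move=> [z1 z2] /mem_cols[/= ? ? ? ?]; apply/mem_rsites; rewrite /r; runfold; split; lia.
rewrite -(Pr_restrict _ (uniq_rsites r) uc sub dE).
apply: Pr_le => // Y _ /(spanned_nogap_col pr).
apply: nogap_mono => i _ iW [[z1 z2] [Yz]]; rewrite /r; runfold => -[? ? ? ?] e.
left; split; first by rewrite mem_iota.
by exists (z1, z2) => //; apply/mem_col; split => //=; lia.
Qed.

Lemma span_prob_rows (r : rect) : rpos r ->
  line_beta (rw r) * span_prob p r <= line_beta (rw r) ^+ rh r.
Proof.
move: r => [[A C] [W H]] [] /=; rewrite /rw /rh /= => W0 H0.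
set r : rect := (A, C, (W, H)).
have pr : rpos r by [].
have uc : uniq (rows A C W (iota 0 H)) by apply: uniq_rows; exact: iota_uniq.
have h := @Pr_strip (row A C W) W 0 H set0 W0 uc (size_row A C W).
have c0 : count (fun i => `[< (set0 : set nat) i >]) (iota 0 H) = 0%N.
  by apply/eqP; rewrite -leqn0 leqNgt -has_count; apply/hasPn => i _; rewrite asboolF.
rewrite c0 expr0 mulr1 in h; apply: le_trans h.
rewrite ler_wpM2l //; first exact: ltW (line_beta_gt0 W0).
have dE := @dep_on_hit_set (fun N => nogap_from 0 H (N `|` set0)) (row A C W) (iota 0 H).
have sub : {subset rows A C W (iota 0 H) <= rsites r}.
  by move=> [z1 z2] /mem_rows[/= ? ? ? ?]; apply/mem_rsites; rewrite /r; runfold; split; lia.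
rewrite -(Pr_restrict _ (uniq_rsites r) uc sub dE).
apply: Pr_le => // Y _ /(spanned_nogap_row pr).
apply: nogap_mono => i _ iH [[z1 z2] [Yz]]; rewrite /r; runfold => -[? ? ? ?] e.
left; split; first by rewrite mem_iota.
by exists (z1, z2) => //; apply/mem_row; split => //=; lia.
Qed.

(** The generating function of the number of infected sites; it will average the weights of the
    corners. *)
Lemma Ex_pow_count (x : R) (K : seq (int * int)) : uniq K ->
  Ex (fun=> p) K (fun Y => x ^+ count (fun z => `[< Y z >]) K) =
  (1 - p + p * x) ^+ size K.
Proof.
elim: K => [|z K IH] //= /andP[zK uK].
have e1 : Ex (fun=> p) K (fun Y => x ^+ (`[< (z |` Y) z >] + count (fun y => `[< (z |` Y) y >]) K)) =
    x * (1 - p + p * x) ^+ size K.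
  rewrite -IH // -Ex_scale; apply: Ex_ext => Y YK.
  rewrite asboolT; last by left.
  rewrite exprD expr1; congr (_ * _ ^+ _); apply: eq_in_count => y yK.
  apply: asbool_equiv_eq; split => [[e|//]|]; last by right.
  by move: zK; rewrite -e yK.
have e2 : Ex (fun=> p) K (fun Y => x ^+ (`[< Y z >] + count (fun y => `[< Y y >]) K)) =
    (1 - p + p * x) ^+ size K.
  rewrite -IH //; apply: Ex_ext => Y YK; rewrite asboolF // => /YK /=.
  by rewrite (negPf zK).
by rewrite e1 e2 exprS; ring.
Qed.
End Strips.

(** * The frame between two nested rectangles *)

Section StripBound.
Variables (A C : int) (s1 w s2 t1 h t2 : nat).
Hypotheses (w0 : (0 < w)%N) (h0 : (0 < h)%N).

Definition outer : rect := (A, C, ((s1 + w + s2)%N, (t1 + h + t2)%N)).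
Definition inner : rect := (A + s1%:Z, C + t1%:Z, (w, h)).

(** Only rows and columns of [outer] that avoid [inner] are examined, so the event is independent of
    what happens in [inner]. *)
Definition strip_nogap (Y : set site) : Prop :=
  (nogap_from 0 s1 (colhit outer Y) /\ nogap_from (s1 + w) s2 (colhit outer Y)) /\
  (nogap_from 0 t1 (rowhit outer Y) /\ nogap_from (t1 + h) t2 (rowhit outer Y)).

Let Lc := cols A (C + t1%:Z) h (iota 0 s1).
Let Rc := cols A (C + t1%:Z) h (iota (s1 + w) s2).
Let Br := rows (A + s1%:Z) C w (iota 0 t1).
Let Tr := rows (A + s1%:Z) C w (iota (t1 + h) t2).
Let cidx := iota 0 s1 ++ iota (s1 + w) s2.
Let ridx := iota 0 t1 ++ iota (t1 + h) t2.
Let K : seq (int * int) := [seq (A + i%:Z, C + j%:Z) | i <- cidx, j <- ridx].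

Lemma mem_corner (z : int * int) : z \in K <->
  (A <= z.1 /\ z.1 < A + s1%:Z \/ A + (s1 + w)%N%:Z <= z.1 /\ z.1 < A + (s1 + w + s2)%N%:Z) /\
  (C <= z.2 /\ z.2 < C + t1%:Z \/ C + (t1 + h)%N%:Z <= z.2 /\ z.2 < C + (t1 + h + t2)%N%:Z).
Proof.
split.
  move=> /allpairsP[[i j] [/=]]; rewrite !mem_cat !mem_iota !add0n => hi hj -> /=.
  by split; lia.
case: z => z1 z2 /= [hz1 hz2]; apply/allpairsP.
exists (`|z1 - A|%N, `|z2 - C|%N) => /=; rewrite !mem_cat !mem_iota !add0n.
by split; [lia|lia|congr pair; lia].
Qed.

Lemma uniq_corner : uniq K.
Proof.
apply: allpairs_uniq.
- rewrite cat_uniq !iota_uniq andbT /=; apply/hasPn => i; rewrite !mem_iota; lia.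
- rewrite cat_uniq !iota_uniq andbT /=; apply/hasPn => i; rewrite !mem_iota; lia.
- by move=> [i j] [i' j'] _ _ /= [] ? ?; congr pair; lia.
Qed.

Lemma size_corner : size K = ((s1 + s2) * (t1 + t2))%N.
Proof. by rewrite size_allpairs !size_cat !size_iota. Qed.

Definition outer_minus : seq (int * int) :=
  [seq z <- rsites outer | z \notin rsites inner].

Lemma dep_on_strip : dep_on outer_minus strip_nogap.
Proof.
move=> Y Y' hY.
have key z : rset outer z -> ~ rset inner z -> Y z -> Y' z.
  move=> oz iz; apply: (hY z _).1; rewrite mem_filter.
  apply/andP; split; last exact/mem_rsites.
  by apply/negP => /mem_rsites.
have hc i : (i < s1)%N \/ (s1 + w <= i)%N -> colhit outer Y i -> colhit outer Y' i.
  move=> ii [z [Yz oz e]]; exists z; split => //; apply: key => //.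
  by case: z e {oz Yz} => z1 z2; rewrite /inner; runfold => e [? ? ? ?]; lia.
have hr i : (i < t1)%N \/ (t1 + h <= i)%N -> rowhit outer Y i -> rowhit outer Y' i.
  move=> ii [z [Yz oz e]]; exists z; split => //; apply: key => //.
  by case: z e {oz Yz} => z1 z2; rewrite /inner; runfold => e [? ? ? ?]; lia.
move=> [[g1 g2] [g3 g4]]; split; split.
- by apply: nogap_mono g1 => i _; rewrite add0n => il; apply: hc; left.
- by apply: nogap_mono g2 => i il _; apply: hc; right.
- by apply: nogap_mono g3 => i _; rewrite add0n => il; apply: hr; left.
- by apply: nogap_mono g4 => i il _; apply: hr; right.
Qed.

Lemma spanned_strip Y : spanned outer Y -> strip_nogap Y.
Proof.
have po : rpos outer by rewrite /outer; runfold; split; lia.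
move=> sp; have gc := spanned_nogap_col po sp; have gr := spanned_nogap_row po sp.
rewrite /outer /rw /rh /= in gc gr.
split; split=> i mi il; [apply: gc|apply: gc|apply: gr|apply: gr]; lia.
Qed.

(** Distinct free lines come from distinct infected corner sites, [key] mapping a site to its
    line. *)
Lemma count_flag (I : eqType) (key : I -> nat) (Q : seq I) (s : seq nat)
    (Y : set I) (O : set nat) : uniq s ->
  (forall i, O i -> exists z, [/\ z \in Q, Y z & key z = i]) ->
  (count (fun i => `[< O i >]) s <= count (fun z => `[< Y z >]) Q)%N.
Proof.
move=> us H; rewrite -!size_filter -(size_map key); apply: uniq_leq_size.
  exact: filter_uniq.
move=> i; rewrite mem_filter => /andP[/asboolP /H [z [zQ Yz <-]] _].
by apply: map_f; rewrite mem_filter zQ andbT; apply/asboolP.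
Qed.

Let rest := Lc ++ (Rc ++ (Br ++ Tr)).

Lemma mem_rest z : z \in rest <-> [\/ z \in Lc, z \in Rc, z \in Br | z \in Tr].
Proof.
rewrite !mem_cat; split.
  by case/or4P => ?; [apply: Or41|apply: Or42|apply: Or43|apply: Or44].
by case=> ->; rewrite ?orbT.
Qed.

Lemma rest_col (z : int * int) i : z \in rest -> z.1 = A + i%:Z ->
  (i < s1)%N \/ (s1 + w <= i)%N -> z \in col A (C + t1%:Z) h i.
Proof.
move=> /mem_rest zr e ii; apply/mem_col; rewrite e.
case: z e zr => z1 z2 /= e.
by case=> [/mem_cols|/mem_cols|/mem_rows|/mem_rows] [/= ? ? ? ?]; split => //; lia.
Qed.

Lemma rest_row (z : int * int) i : z \in rest -> z.2 = C + i%:Z ->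
  (i < t1)%N \/ (t1 + h <= i)%N -> z \in row (A + s1%:Z) C w i.
Proof.
move=> /mem_rest zr e ii; apply/mem_row; rewrite e.
case: z e zr => z1 z2 /= e.
by case=> [/mem_cols|/mem_cols|/mem_rows|/mem_rows] [/= ? ? ? ?]; split => //; lia.
Qed.

Lemma offsetK (x a : int) (i : nat) : x = a + i%:Z -> `|x - a|%N = i.
Proof. by move=> ->; lia. Qed.

Lemma disj_L z : z \in Lc -> z \notin Rc ++ (Br ++ Tr).
Proof.
case: z => [z1 z2] /mem_cols[/= ? ? ? ?]; rewrite !mem_cat !negb_or.
apply/and3P; split; apply/negP;
  [move=> /mem_cols[/= *]|move=> /mem_rows[/= *]|move=> /mem_rows[/= *]]; lia.
Qed.

Lemma disj_R z : z \in Rc -> z \notin Br ++ Tr.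
Proof.
case: z => [z1 z2] /mem_cols[/= ? ? ? ?]; rewrite !mem_cat !negb_or.
by apply/andP; split; apply/negP => /mem_rows[/= *]; lia.
Qed.

Lemma disj_B z : z \in Br -> z \notin Tr.
Proof.
case: z => [z1 z2] /mem_rows[/= ? ? ? ?]; apply/negP => /mem_rows[/= *]; lia.
Qed.

Lemma uniq_lines m l n k : uniq (iota 0 m ++ iota (m + l) n) /\
  uniq (cols A (C + t1%:Z) h (iota k n)).
Proof.
split; last by apply: uniq_cols; exact: iota_uniq.
rewrite cat_uniq !iota_uniq andbT /=; apply/hasPn => i; rewrite !mem_iota; lia.
Qed.

Lemma uniq_corner_rest : uniq (K ++ rest).
Proof.
rewrite cat_uniq uniq_corner /=; apply/andP; split.
  apply/hasPn => -[z1 z2] /mem_rest zr; apply/negP => /mem_corner /= zK.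
  by case: zr => [/mem_cols|/mem_cols|/mem_rows|/mem_rows] [/= *]; lia.
rewrite cat_uniq uniq_cols ?iota_uniq //=; apply/andP; split.
  by apply/hasPn => z zr; apply/negP => /disj_L; rewrite zr.
rewrite cat_uniq uniq_cols ?iota_uniq //=; apply/andP; split.
  by apply/hasPn => z zr; apply/negP => /disj_R; rewrite zr.
rewrite cat_uniq !uniq_rows ?iota_uniq //= andbT.
by apply/hasPn => z zr; apply/negP => /disj_B; rewrite zr.
Qed.

Lemma corner_rest_sub : {subset K ++ rest <= rsites outer}.
Proof.
move=> [z1 z2]; rewrite mem_cat => /orP[/mem_corner|/mem_rest] zz;
  apply/mem_rsites; rewrite /outer; runfold; move: zz => /=.
  by move=> ?; split; lia.
by case=> [/mem_cols|/mem_cols|/mem_rows|/mem_rows] [/= *]; split; lia.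
Qed.

Lemma dep_on_corner_rest : dep_on (K ++ rest) strip_nogap.
Proof.
apply: dep_on_sub dep_on_strip => -[z1 z2]; rewrite mem_filter => /andP[/negP ni].
move=> /mem_rsites; rewrite /outer; runfold => -[? ? ? ?].
have {}ni : ~ [/\ A + s1%:Z <= z1, z1 < A + s1%:Z + w%:Z, C + t1%:Z <= z2 & z2 < C + t1%:Z + h%:Z].
  by move=> [? ? ? ?]; apply: ni; apply/mem_rsites; rewrite /inner; runfold; split.
rewrite mem_cat; apply/orP.
have [c1|c1] := boolP ((A + s1%:Z <= z1) && (z1 < A + s1%:Z + w%:Z)).
  right; apply/mem_rest.
  have [r1|r1] := boolP (z2 < C + t1%:Z).
    by apply: Or43; apply/mem_rows; split => /=; lia.
  have [r2|r2] := boolP (z2 < C + t1%:Z + h%:Z).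
    by exfalso; apply: ni; split; lia.
  by apply: Or44; apply/mem_rows; split => /=; lia.
have [r1|r1] := boolP ((C + t1%:Z <= z2) && (z2 < C + t1%:Z + h%:Z)).
  right; apply/mem_rest.
  have [c2|c2] := boolP (z1 < A + s1%:Z).
    by apply: Or41; apply/mem_cols; split => /=; lia.
  by apply: Or42; apply/mem_cols; split => /=; lia.
by left; apply/mem_corner => /=; lia.
Qed.

Context {R : realType}.
Variable p : R.
Hypothesis p01 : 0 < p < 1.

Let p01' : 0 <= p <= 1. Proof. by move/andP: p01 => [/ltW -> /ltW ->]. Qed.

(** The horizontal and vertical strips interact only through the corners. Given the infected corner
    sites [Yk], the four remaining strips are independent, and each site of [Yk] makes at most one
    column and one row free. *)
Lemma corner_bound (Yk : set site) :
  line_beta p h ^+ 2 * line_beta p w ^+ 2 *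
    Pr (fun=> p) (rest)
      (fun Z => strip_nogap (Yk `&` [set` K] `|` (Z `&` [set` rest])))
  <= line_beta p h ^+ (s1 + s2) * line_beta p w ^+ (t1 + t2) *
     (line_beta p h ^- 2 * line_beta p w ^- 2) ^+ count (fun z => `[< Yk z >]) K.
Proof.
set bh := line_beta p h; set bw := line_beta p w.
have bh0 : 0 < bh by exact: line_beta_gt0.
have bw0 : 0 < bw by exact: line_beta_gt0.
have bh1 : bh <= 1 by exact: line_beta_le1.
have bw1 : bw <= 1 by exact: line_beta_le1.
pose cs := col A (C + t1%:Z) h; pose rs := row (A + s1%:Z) C w.
pose Oc : set nat := [set i | exists z, [/\ z \in K, Yk z & `|z.1 - A|%N = i]].
pose Or : set nat := [set i | exists z, [/\ z \in K, Yk z & `|z.2 - C|%N = i]].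
pose NL Z := nogap_from 0 s1 (hit_set cs (iota 0 s1) Z `|` Oc).
pose NR Z := nogap_from (s1 + w) s2 (hit_set cs (iota (s1 + w) s2) Z `|` Oc).
pose NB Z := nogap_from 0 t1 (hit_set rs (iota 0 t1) Z `|` Or).
pose NT Z := nogap_from (t1 + h) t2 (hit_set rs (iota (t1 + h) t2) Z `|` Or).
have dL : dep_on Lc NL := @dep_on_hit_set (fun N => nogap_from 0 s1 (N `|` Oc)) cs _.
have dR : dep_on Rc NR := @dep_on_hit_set (fun N => nogap_from (s1 + w) s2 (N `|` Oc)) cs _.
have dB : dep_on Br NB := @dep_on_hit_set (fun N => nogap_from 0 t1 (N `|` Or)) rs _.
have dT : dep_on Tr NT := @dep_on_hit_set (fun N => nogap_from (t1 + h) t2 (N `|` Or)) rs _.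
have uL := uniq_cols A (C + t1%:Z) h (iota_uniq 0 s1).
have uR := uniq_cols A (C + t1%:Z) h (iota_uniq (s1 + w) s2).
have uB := uniq_rows (A + s1%:Z) C w (iota_uniq 0 t1).
have uT := uniq_rows (A + s1%:Z) C w (iota_uniq (t1 + h) t2).
have bL := @Pr_strip R p p01 cs h 0 s1 Oc h0 uL (size_col _ _ _).
have bR := @Pr_strip R p p01 cs h (s1 + w) s2 Oc h0 uR (size_col _ _ _).
have bB := @Pr_strip R p p01 rs w 0 t1 Or w0 uB (size_row _ _ _).
have bT := @Pr_strip R p p01 rs w (t1 + h) t2 Or w0 uT (size_row _ _ _).
have incl : Pr (fun=> p) rest (fun Z => strip_nogap (Yk `&` [set` K] `|` (Z `&` [set` rest])))
    <= Pr (fun=> p) rest (fun Z => NL Z /\ (NR Z /\ (NB Z /\ NT Z))).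
  apply: Pr_le => // Z _ [[g1 g2] [g3 g4]].
  have corner z : Yk z -> z \in K -> forall i, z.1 = A + i%:Z -> Oc i.
    by move=> Yz zK i e; exists z; split => //; exact: offsetK.
  have corner' z : Yk z -> z \in K -> forall i, z.2 = C + i%:Z -> Or i.
    by move=> Yz zK i e; exists z; split => //; exact: offsetK.
  have colR z i : Z z -> z \in rest -> z.1 = A + i%:Z ->
      ((i < s1)%N \/ (s1 + w <= i)%N) -> hit (cs i) Z.
    by move=> Zz zr e ii; exists z => //; exact: rest_col.
  have rowR z i : Z z -> z \in rest -> z.2 = C + i%:Z ->
      ((i < t1)%N \/ (t1 + h <= i)%N) -> hit (rs i) Z.
    by move=> Zz zr e ii; exists z => //; exact: rest_row.
  split; [|split; [|split]].
  - apply: nogap_mono g1 => i mi il [z [[[Yz zK]|[Zz zr]] _ e]].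
      by right; exact: corner Yz zK i e.
    left; split; first by rewrite mem_iota mi.
    by apply: colR Zz zr e _; left; move: il; rewrite add0n.
  - apply: nogap_mono g2 => i mi il [z [[[Yz zK]|[Zz zr]] _ e]].
      by right; exact: corner Yz zK i e.
    left; split; first by rewrite mem_iota mi.
    by apply: colR Zz zr e _; right.
  - apply: nogap_mono g3 => i mi il [z [[[Yz zK]|[Zz zr]] _ e]].
      by right; exact: corner' Yz zK i e.
    left; split; first by rewrite mem_iota mi.
    by apply: rowR Zz zr e _; left; move: il; rewrite add0n.
  - apply: nogap_mono g4 => i mi il [z [[[Yz zK]|[Zz zr]] _ e]].
      by right; exact: corner' Yz zK i e.
    left; split; first by rewrite mem_iota mi.
    by apply: rowR Zz zr e _; right.
have prod : Pr (fun=> p) rest (fun Z => NL Z /\ (NR Z /\ (NB Z /\ NT Z))) =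
    Pr (fun=> p) Lc NL * (Pr (fun=> p) Rc NR * (Pr (fun=> p) Br NB * Pr (fun=> p) Tr NT)).
  have dBT : dep_on (Br ++ Tr) (fun Z => NB Z /\ NT Z).
    apply: dep_on_and; first by apply: dep_on_sub dB => x xt; rewrite mem_cat xt.
    by apply: dep_on_sub dT => x xt; rewrite mem_cat xt orbT.
  have dRBT : dep_on (Rc ++ (Br ++ Tr)) (fun Z => NR Z /\ (NB Z /\ NT Z)).
    apply: dep_on_and; first by apply: dep_on_sub dR => x xt; rewrite mem_cat xt.
    by apply: dep_on_sub dBT => x xt; rewrite mem_cat xt orbT.
  rewrite (Pr_cat_indep _ disj_L dL dRBT); congr (_ * _).
  by rewrite (Pr_cat_indep _ disj_R dR dBT) (Pr_cat_indep _ disj_B dB dT).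
rewrite prod in incl.
have ucx : uniq cidx := (uniq_lines s1 w s2 0).1.
have urx : uniq ridx := (uniq_lines t1 h t2 0).1.
have nc : (count (fun i => `[< Oc i >]) (iota 0 s1) +
    count (fun i => `[< Oc i >]) (iota (s1 + w) s2) <= count (fun z => `[< Yk z >]) K)%N.
  rewrite -count_cat.
  exact: (@count_flag _ (fun z : int * int => `|z.1 - A|%N) K cidx Yk Oc ucx (fun i => id)).
have nr : (count (fun i => `[< Or i >]) (iota 0 t1) +
    count (fun i => `[< Or i >]) (iota (t1 + h) t2) <= count (fun z => `[< Yk z >]) K)%N.
  rewrite -count_cat.
  exact: (@count_flag _ (fun z : int * int => `|z.2 - C|%N) K ridx Yk Or urx (fun i => id)).
have gh : 1 <= bh ^- 2 by rewrite invf_ge1 ?exprn_gt0 // exprn_ile1 // ltW.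
have gw : 1 <= bw ^- 2 by rewrite invf_ge1 ?exprn_gt0 // exprn_ile1 // ltW.
apply: (@le_trans _ _ (bh ^+ 2 * bw ^+ 2 * (Pr (fun=> p) Lc NL * (Pr (fun=> p) Rc NR *
   (Pr (fun=> p) Br NB * Pr (fun=> p) Tr NT))))).
  by apply: ler_wpM2l => //; rewrite mulr_ge0 ?exprn_ge0 // ltW.
have -> : bh ^+ 2 * bw ^+ 2 * (Pr (fun=> p) Lc NL * (Pr (fun=> p) Rc NR *
   (Pr (fun=> p) Br NB * Pr (fun=> p) Tr NT))) =
   ((bh * Pr (fun=> p) Lc NL) * (bh * Pr (fun=> p) Rc NR)) *
   ((bw * Pr (fun=> p) Br NB) * (bw * Pr (fun=> p) Tr NT)) by ring.
have nn (b : R) s E : 0 < b -> 0 <= b * Pr (fun=> p) s E.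
  by move=> b0; rewrite mulr_ge0 ?(ltW b0) //; exact: Pr_ge0.
apply: (@le_trans _ _ ((bh ^+ (s1 + s2) * (bh ^- 2) ^+ count (fun z => `[< Yk z >]) K) *
   (bw ^+ (t1 + t2) * (bw ^- 2) ^+ count (fun z => `[< Yk z >]) K))); last first.
  by rewrite mulrACA -exprMn.
have comb (b x1 x2 : R) l1 l2 c1 c2 c : 0 < b -> 1 <= b ^- 2 -> 0 <= x1 -> 0 <= x2 ->
    (c1 + c2 <= c)%N -> x1 <= b ^+ l1 * (b ^- 2) ^+ c1 -> x2 <= b ^+ l2 * (b ^- 2) ^+ c2 ->
    x1 * x2 <= b ^+ (l1 + l2) * (b ^- 2) ^+ c.
  move=> b0 gb x10 x20 cc l1x l2x; apply: le_trans (ler_pM x10 x20 l1x l2x) _.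
  have -> : b ^+ l1 * b ^- 2 ^+ c1 * (b ^+ l2 * b ^- 2 ^+ c2) =
    b ^+ (l1 + l2) * b ^- 2 ^+ (c1 + c2) by rewrite !exprD; ring.
  apply: ler_wpM2l; first by rewrite exprn_ge0 // ltW.
  exact: ler_weXn2l.
apply: ler_pM.
- by apply: mulr_ge0; exact: nn.
- by apply: mulr_ge0; exact: nn.
- by apply: (comb bh _ _ _ _ _ _ _ bh0 gh _ _ nc bL bR); exact: nn.
- by apply: (comb bw _ _ _ _ _ _ _ bw0 gw _ _ nr bB bT); exact: nn.
Qed.

Lemma strip_prob :
  line_beta p h ^+ 2 * line_beta p w ^+ 2 * Pr (fun=> p) (rsites outer) strip_nogap
  <= line_beta p h ^+ (s1 + s2) * line_beta p w ^+ (t1 + t2) *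
     (1 + p * (line_beta p h ^- 2 * line_beta p w ^- 2)) ^+ ((s1 + s2) * (t1 + t2)).
Proof.
set bh := line_beta p h; set bw := line_beta p w.
have bh0 : 0 < bh by exact: line_beta_gt0.
have bw0 : 0 < bw by exact: line_beta_gt0.
rewrite (Pr_restrict _ (uniq_rsites outer) uniq_corner_rest corner_rest_sub dep_on_corner_rest).
rewrite /Pr Ex_cat -Ex_scale.
set x := bh ^- 2 * bw ^- 2.
have x0 : 0 <= x by rewrite /x mulr_ge0 // invr_ge0 exprn_ge0 // ltW.
have p0 : 0 <= p by move/andP: p01' => [].
apply: (@le_trans _ _ (bh ^+ (s1 + s2) * bw ^+ (t1 + t2) * (1 - p + p * x) ^+ size K)); last first.
  apply: ler_wpM2l; first by rewrite mulr_ge0 ?exprn_ge0 // ltW.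
  rewrite size_corner lerXn2r ?nnegrE //.
  - by apply: addr_ge0; [rewrite subr_ge0; move/andP: p01' => []|exact: mulr_ge0].
  - by apply: addr_ge0; [exact: ler01|exact: mulr_ge0].
  - by rewrite lerD2r gerBl.
rewrite -(Ex_pow_count p x uniq_corner) -Ex_scale; apply: Ex_le => // Yk YK.
apply: le_trans (corner_bound Yk); apply: ler_wpM2l.
  by rewrite mulr_ge0 ?exprn_ge0 // ltW.
rewrite le_eqVlt; apply/orP; left; apply/eqP; apply: Ex_ext => Z ZK.
have eK : Yk `&` [set` K] = Yk by apply/setIidPl.
have eZ : Z `&` [set` rest] = Z by apply/setIidPl.
by rewrite eK eZ.
Qed.
End StripBound.

(** * The least cost of a growth path *)

Section Potential.
Context {R : realType}.
Variable gh : nat -> R.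
Hypothesis gh_ge0 : forall n, 0 <= gh n.
Hypothesis gh_anti : forall m n, (m <= n)%N -> gh n <= gh m.
Hypothesis gh_convex : forall n, 2%:R * gh n.+1 <= gh n + gh n.+2.

(* [path_cost a b c]: a rectangle with sides at least [a] and [b] can be
   reached from nothing at cost at most [c], where widening a rectangle of
   height [b] by one column costs [gh b] and vice versa. *)
Inductive path_cost : nat -> nat -> R -> Prop :=
| path_nil : path_cost 0 0 0
| path_right a b c : path_cost a b c -> path_cost a.+1 b (c + gh b)
| path_up a b c : path_cost a b c -> path_cost a b.+1 (c + gh a)
| path_shrink a b a' b' c : path_cost a b c -> (a' <= a)%N -> (b' <= b)%N ->
    path_cost a' b' c
| path_weaken a b c c' : path_cost a b c -> c <= c' -> path_cost a b c'.

Lemma path_cost_ge0 a b c : path_cost a b c -> 0 <= c.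
Proof.
elim=> {a b c} [//|a b c _ IH|a b c _ IH|//|a b c c' _ IH /(le_trans IH) //].
  exact: addr_ge0.
exact: addr_ge0.
Qed.

(** The second path is run on top of the first: its lines become longer, hence cheaper. *)
Lemma path_cost_add a1 b1 c1 a2 b2 c2 : path_cost a1 b1 c1 ->
  path_cost a2 b2 c2 -> path_cost (a1 + a2) (b1 + b2) (c1 + c2).
Proof.
move=> h1; elim=> {a2 b2 c2} [|a b c _ IH|a b c _ IH|a b a' b' c _ IH la lb|a b c c' _ IH lc].
- by rewrite !addn0 addr0.
- rewrite addnS addrA; apply: path_weaken (path_right IH) _.
  by rewrite lerD2l gh_anti // leq_addl.
- rewrite addnS addrA; apply: path_weaken (path_up IH) _.
  by rewrite lerD2l gh_anti // leq_addl.
- by apply: path_shrink IH _ _; rewrite leq_add2l.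
- by apply: path_weaken IH _; rewrite lerD2l.
Qed.

Lemma path_cost_linear k a b : (forall n, gh n <= k) ->
  path_cost a b (k * (a + b)%:R).
Proof.
move=> hk; elim: a => [|a IH].
  elim: b => [|b IH]; first by rewrite mulr0; exact: path_nil.
  by apply: path_weaken (path_up IH) _; rewrite addnS -[in leRHS]natr1 mulrDr mulr1 lerD2l.
by apply: path_weaken (path_right IH) _; rewrite addSn -[in leRHS]natr1 mulrDr mulr1 lerD2l.
Qed.

Definition pot (a b : nat) : R := inf [set c | path_cost a b c].

Lemma pot_le a b c : path_cost a b c -> pot a b <= c.
Proof.
move=> h; apply: ge_inf => //; exists 0 => x; exact: path_cost_ge0.
Qed.

Lemma path_cost_exists a b : exists c, path_cost a b c.
Proof.
exists (gh 0 * (a + b)%:R); apply: path_cost_linear => n; exact: gh_anti.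
Qed.

Lemma pot_ge a b x : (forall c, path_cost a b c -> x <= c) -> x <= pot a b.
Proof.
by move=> h; apply: lb_le_inf => //; have [c hc] := path_cost_exists a b; exists c.
Qed.

Lemma pot_right a b : pot a.+1 b <= pot a b + gh b.
Proof.
rewrite -lerBlDr; apply: pot_ge => c hc; rewrite lerBlDr.
by apply: pot_le; exact: path_right.
Qed.

Lemma pot_up a b : pot a b.+1 <= pot a b + gh a.
Proof.
rewrite -lerBlDr; apply: pot_ge => c hc; rewrite lerBlDr.
by apply: pot_le; exact: path_up.
Qed.

Lemma pot_mono a b a' b' : (a <= a')%N -> (b <= b')%N -> pot a b <= pot a' b'.
Proof.
by move=> aa bb; apply: pot_ge => c hc; apply: pot_le; exact: path_shrink hc aa bb.
Qed.

Lemma pot_add a1 b1 a2 b2 : pot (a1 + a2) (b1 + b2) <= pot a1 b1 + pot a2 b2.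
Proof.
rewrite -lerBlDr; apply: pot_ge => c1 h1; rewrite lerBlDr addrC -lerBlDr.
apply: pot_ge => c2 h2; rewrite lerBlDr addrC.
by apply: pot_le; exact: path_cost_add.
Qed.

(** All lines of the frame are charged at the inner side lengths, as in [Pr_strip_bound], so that
    the two estimates match. *)
Lemma pot_grow w h s t : pot (w + s) (h + t) <= pot w h + s%:R * gh h + t%:R * gh w.
Proof.
have H1 : pot (w + s) h <= pot w h + s%:R * gh h.
  elim: s => [|s IH]; first by rewrite addn0 mul0r addr0.
  by rewrite addnS (le_trans (pot_right _ _)) // -natr1 mulrDl mul1r addrA lerD2r.
elim: t => [|t IH]; first by rewrite addn0 mul0r addr0.
rewrite addnS (le_trans (pot_up _ _)) // -[t.+1%:R]natr1 mulrDl mul1r addrA lerD //.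
by rewrite gh_anti // leq_addr.
Qed.

Lemma pot_linear k a b : (forall n, gh n <= k) -> pot a b <= k * (a + b)%:R.
Proof. by move=> hk; apply: pot_le; exact: path_cost_linear. Qed.

Definition diag_cost (n : nat) : R := \sum_(0 <= k < n) (gh k + gh k.+1).

(* The cost of the optimal path, along the diagonal and then straight. *)
Definition diag_pot (a b : nat) : R :=
  diag_cost (minn a b) + (maxn a b - minn a b)%:R * gh (minn a b).

Lemma gh_chord a d : gh a + d%:R * (gh a.+1 - gh a) <= gh (a + d)%N.
Proof.
have inc n : gh a.+1 - gh a <= gh (a + n).+1 - gh (a + n)%N.
  elim: n => [|n IH]; first by rewrite addn0.
  by rewrite addnS; have := gh_convex (a + n); move: IH; lra.
elim: d => [|d IH]; first by rewrite mul0r addr0 addn0.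
by rewrite addnS -natr1 mulrDl mul1r; have := inc d; move: IH; lra.
Qed.

Lemma diag_cost_S n : diag_cost n.+1 = diag_cost n + (gh n + gh n.+1).
Proof. by rewrite /diag_cost big_nat_recr. Qed.

Lemma diag_potC a b : diag_pot a b = diag_pot b a.
Proof. by rewrite /diag_pot minnC maxnC. Qed.

(** When the shorter side [a] grows, the increment is [gh a + (b - a) (gh (a + 1) - gh a)], the
    value at [b] of the line through [gh a] and [gh (a + 1)], at most [gh b] by convexity. Otherwise
    it equals [gh b]. *)
Lemma diag_pot_step a b : diag_pot a.+1 b <= diag_pot a b + gh b.
Proof.
rewrite /diag_pot; have [ab|ba] := ltnP a b.
  have -> : minn a.+1 b = a.+1 by lia.
  have -> : maxn a.+1 b = b by lia.
  rewrite diag_cost_S; have := gh_chord a (b - a); rewrite subnKC ?(ltnW ab) //.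
  have -> : (b - a)%:R = (b - a.+1)%:R + 1 :> R by rewrite natr1; congr (_%:R); lia.
  by lra.
have -> : minn a.+1 b = b by lia.
have -> : maxn a.+1 b = a.+1 by lia.
by rewrite subSn // -natr1 mulrDl mul1r addrA.
Qed.

(** The larger sides [a'] and [b'] absorb [path_shrink]: [diag_pot] is not monotone, as thickening a
    long thin rectangle may lower it. Its diagonal part, kept in [pot_diag], is monotone. *)
Lemma path_cost_diag a b c : path_cost a b c ->
  exists a' b', [/\ (a <= a')%N, (b <= b')%N & diag_pot a' b' <= c].
Proof.
elim=> {a b c} [|a b c _ [a' [b' [la lb h]]]|a b c _ [a' [b' [la lb h]]]|
  a b a1 b1 c _ [a' [b' [la lb h]]] l1 l2|a b c c' _ [a' [b' [la lb h]]] l].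
- exists 0%N, 0%N; split => //.
  by rewrite /diag_pot /diag_cost minnn maxnn subnn mul0r addr0 big_geq.
- exists a'.+1, b'; split => //; apply: le_trans (diag_pot_step _ _) _.
  by apply: lerD => //; exact: gh_anti.
- exists a', b'.+1; split => //; rewrite diag_potC.
  apply: le_trans (diag_pot_step _ _) _; rewrite diag_potC.
  by apply: lerD => //; exact: gh_anti.
- by exists a', b'; split => //; [exact: leq_trans l1 la|exact: leq_trans l2 lb].
- by exists a', b'; split => //; exact: le_trans l.
Qed.

Lemma diag_cost_mono m n : (m <= n)%N -> diag_cost m <= diag_cost n.
Proof.
move=> mn; rewrite /diag_cost (big_cat_nat _ mn) //= lerDl sumr_ge0 // => k _.
exact: addr_ge0.
Qed.

Lemma pot_diag a b : diag_cost (minn a b) <= pot a b.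
Proof.
apply: pot_ge => c /path_cost_diag[a' [b' [la lb]]]; apply: le_trans.
rewrite /diag_pot -[leLHS]addr0; apply: lerD; last by rewrite mulr_ge0.
by apply: diag_cost_mono; lia.
Qed.
End Potential.

Section CutCost.
Context {R : realType}.
Variables (q eta ka : R).
Hypotheses (q0 : 0 < q) (eta0 : 0 < eta).

(* [cost], shifted by [eta] so as to be bounded and lowered by [ka] to leave
   room for the error terms. *)
Definition cut_cost (n : nat) : R := Num.max 0 (cost (n%:R * q + eta) - ka).

Let arg0 (n : nat) : 0 < n%:R * q + eta.
Proof. by rewrite ltr_wpDl // mulr_ge0 // ltW. Qed.

Lemma cut_cost_ge0 n : 0 <= cut_cost n.
Proof. by rewrite /cut_cost le_max lexx. Qed.

Lemma cut_cost_anti m n : (m <= n)%N -> cut_cost n <= cut_cost m.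
Proof.
move=> mn; rewrite /cut_cost; apply: le_max2 => //; rewrite lerD2r cost_anti //.
by rewrite lerD2r ler_wpM2r ?ler_nat // ltW.
Qed.

Lemma cut_cost_convex n : 2%:R * cut_cost n.+1 <= cut_cost n + cut_cost n.+2.
Proof.
have c0 := cut_cost_ge0 n; have c2 := cut_cost_ge0 n.+2.
have h0 : cost (n%:R * q + eta) - ka <= cut_cost n by rewrite /cut_cost le_max lexx orbT.
have h2 : cost (n.+2%:R * q + eta) - ka <= cut_cost n.+2 by rewrite /cut_cost le_max lexx orbT.
rewrite {1}/cut_cost /Num.max; case: ifP => _; last by rewrite mulr0 addr_ge0.
have e1 : n.+1%:R * q + eta - q = n%:R * q + eta by rewrite -natr1; ring.
have e2 : n.+1%:R * q + eta + q = n.+2%:R * q + eta by rewrite -[n.+2%:R]natr1; ring.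
have := @cost_midpoint R (n.+1%:R * q + eta) q; rewrite e1 e2 => /(_ (arg0 n) (ltW q0)).
move: h0 h2; move: (cost _) (cost _) (cost _) (cut_cost n) (cut_cost n.+2) => x y z u v.
by lra.
Qed.

Lemma cut_cost_le n : 0 <= ka -> cut_cost n <= cost eta.
Proof.
move=> k0; rewrite /cut_cost ge_max (ltW (cost_gt0 eta0)) /=.
rewrite lerBlDr; apply: (@le_trans _ _ (cost eta)); last by rewrite lerDl.
by rewrite cost_anti // lerDr mulr_ge0 // ltW.
Qed.

Lemma cut_costE n : ka <= cost (n%:R * q + eta) ->
  cut_cost n = cost (n%:R * q + eta) - ka.
Proof. by move=> h; apply/max_idPr; rewrite subr_ge0. Qed.
End CutCost.

Definition strip (S R : rect) : set site -> Prop :=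
  strip_nogap (rx R) (ry R) `|rx S - rx R| (rw S) (rw R - `|rx S - rx R| - rw S)
    `|ry S - ry R| (rh S) (rh R - `|ry S - ry R| - rh S).

Lemma rsub_dims (S R : rect) : rsub S R -> (rw S <= rw R)%N /\ (rh S <= rh R)%N.
Proof. by move=> [? ? ? ?]; split; lia. Qed.

Section Strip.
Variables S R : rect.
Hypotheses (pS : rpos S) (SR : rsub S R).

Let s1 := `|rx S - rx R|%N.
Let s2 := (rw R - s1 - rw S)%N.
Let t1 := `|ry S - ry R|%N.
Let t2 := (rh R - t1 - rh S)%N.

Lemma strip_outer : R = outer (rx R) (ry R) s1 (rw S) s2 t1 (rh S) t2.
Proof.
have [? ? ? ?] := SR; rewrite /outer /s2 /t2 /s1 /t1.
have -> : (`|rx S - rx R| + rw S + (rw R - `|rx S - rx R| - rw S))%N = rw R by lia.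
have -> : (`|ry S - ry R| + rh S + (rh R - `|ry S - ry R| - rh S))%N = rh R by lia.
by case: (R) => [[? ?] [? ?]].
Qed.

Lemma strip_inner : S = inner (rx R) (ry R) s1 (rw S) t1 (rh S).
Proof.
have [? ? ? ?] := SR; rewrite /inner /s1 /t1.
have -> : rx R + `|rx S - rx R|%N%:Z = rx S by lia.
have -> : ry R + `|ry S - ry R|%N%:Z = ry S by lia.
by case: (S) => [[? ?] [? ?]].
Qed.

Lemma dep_on_strip_minus :
  dep_on [seq z <- rsites R | z \notin rsites S] (strip S R).
Proof.
have := @dep_on_strip (rx R) (ry R) s1 (rw S) s2 t1 (rh S) t2 pS.1 pS.2.
by rewrite /outer_minus -strip_outer -strip_inner.
Qed.

Lemma strip_of_spanned Y : spanned R Y -> strip S R Y.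
Proof.
have := @spanned_strip (rx R) (ry R) s1 (rw S) s2 t1 (rh S) t2 pS.1 pS.2 Y.
by rewrite -strip_outer.
Qed.

Lemma strip_dims : (s1 + s2 = rw R - rw S)%N /\ (t1 + t2 = rh R - rh S)%N.
Proof. by have [? ? ? ?] := SR; rewrite /s2 /t2 /s1 /t1; split; lia. Qed.

Lemma Pr_strip_bound (K : realType) (p : K) : 0 < p < 1 ->
  line_beta p (rh S) ^+ 2 * line_beta p (rw S) ^+ 2 * Pr (fun=> p) (rsites R) (strip S R)
  <= line_beta p (rh S) ^+ (rw R - rw S) * line_beta p (rw S) ^+ (rh R - rh S) *
     (1 + p * (line_beta p (rh S) ^- 2 * line_beta p (rw S) ^- 2))
       ^+ ((rw R - rw S) * (rh R - rh S)).
Proof.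
move=> p01; have := @strip_prob (rx R) (ry R) s1 (rw S) s2 t1 (rh S) t2 pS.1 pS.2 K p p01.
by rewrite -strip_outer; have [-> ->] := strip_dims.
Qed.

Lemma Pr_inner_strip (K : realType) (p : K) (E : set site -> Prop) :
  dep_on (rsites S) E ->
  Pr (fun=> p) (rsites R) (fun Y => E Y /\ strip S R Y) =
  Pr (fun=> p) (rsites S) E * Pr (fun=> p) (rsites R) (strip S R).
Proof.
move=> dE.
have sub : {subset rsites S <= rsites R}.
  by move=> z /mem_rsites /(rsub_set SR) /mem_rsites.
rewrite -(Pr_restrict (fun=> p) (uniq_rsites R) (uniq_rsites S) sub dE).
apply: Pr_indep dE dep_on_strip_minus; rewrite ?filter_uniq ?uniq_rsites //.
  by move=> z; rewrite mem_filter => /andP[].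
by move=> z zS; rewrite mem_filter zS.
Qed.
End Strip.

Lemma increasing_spanned r : rpos r -> increasing (spanned r).
Proof. by move=> pr Y Y' YY; exact: spanned_mono. Qed.

Lemma dep_on_disjoint_spanned r1 r2 S : rsub r1 S -> rsub r2 S ->
  dep_on (rsites S) (disjoint_occ (spanned r1) (spanned r2)).
Proof.
move=> /rsub_set r1S /rsub_set r2S Y Y' h [Y1 [Y2 [l1 l2 l3 a b]]].
exists (Y1 `&` rset r1), (Y2 `&` rset r2).
have hr Z (r : rect) : rset r `<=` rset S -> Z `<=` Y -> Z `&` rset r `<=` Y'.
  by move=> rS ZY z [/ZY Yz /rS rz]; apply: (h z _).1 => //; exact/mem_rsites.
split; [exact: hr|exact: hr| | |].
- by rewrite setIACA l3 set0I.
- by rewrite /internally_spanned -setIA setIid.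
- by rewrite /internally_spanned -setIA setIid.
Qed.

Definition subrects (R : rect) : seq rect :=
  [seq (z, d) | z <- rsites R, d <- [seq (w, h) | w <- iota 1 (rw R), h <- iota 1 (rh R)]].

Lemma size_subrects R : size (subrects R) = ((rw R * rh R) ^ 2)%N.
Proof. by rewrite size_allpairs size_rsites size_allpairs !size_iota mulnn. Qed.

Lemma mem_subrects r R : rpos r -> rsub r R -> r \in subrects R.
Proof.
case: r => [[x y] [w h]]; case: R => [[X Y] [W H]]; runfold => -[w0 h0] [? ? ? ?].
apply/allpairsP; exists ((x, y), (w, h)); split => //=.
  by apply/mem_rsites; runfold; split; lia.
by apply/allpairsP; exists (w, h); rewrite !mem_iota /rw /rh /=; split => //; lia.
Qed.

Lemma Pr_cond (K : realType) (p : int * int -> K) s (C : Prop) (E : set site -> Prop) c :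
  (forall x, 0 <= p x <= 1) -> 0 <= c -> (C -> Pr p s E <= c) ->
  Pr p s (fun Y => C /\ E Y) <= c.
Proof.
move=> p01 c0 h; have [/h hc|nC] := pselect C.
  by apply: le_trans hc; apply: Pr_le => // Y _ [].
apply: le_trans c0; rewrite -[leRHS](Ex_const p s 0).
by apply: Ex_le => // Y _; case: asboolP => // -[].
Qed.

Lemma strip_arith1 (R : realType) (a b k : R) : a <= k -> b <= k ->
  2%:R * a + 2%:R * b <= 4%:R * k.
Proof. lra. Qed.

Lemma strip_arith2 (R : realType) (a b k s t u : R) : a <= k -> b <= k ->
  s * - a + t * - b + u <=
  2%:R * - a + 2%:R * - b + (4%:R * k - s * a - t * b + u).
Proof. by rewrite !mulrN; move: (s * a) (t * b) => x y; lra. Qed.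

Lemma strip_arith3 (R : realType) (a b c d e f g h k ka : R) :
  b * h <= b * (d - ka) -> a * g <= a * (c - ka) -> f <= e + a * g + b * h ->
  - e + (4%:R * k - a * c - b * d + ka / 2%:R * (a + b)) <=
  4%:R * k - ka / 2%:R * (a + b) + - f.
Proof. by rewrite !mulrBr; move: (a * g) (b * h) (a * c) (b * d) => x y z w; lra. Qed.

Lemma seed_arith (R : realType) (n h t v c k : R) : 0 <= n -> h <= n + 1 ->
  t <= 4%:R * (n + 1) -> v <= k * (n + 1 + h) -> 2%:R * k + 2%:R <= c -> 0 < k ->
  n * - c <= 2%:R * k + 2%:R - t / 2%:R + - v.
Proof.
move=> n0 hn tn vk kc k0.
have h1 : n * (2%:R * k + 2%:R) <= n * c by exact: ler_wpM2l.
have h2 : k * h <= k * (n + 1) by rewrite ler_wpM2l // ltW.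
by move: h1 h2 vk; rewrite !mulrDr mulrN; lra.
Qed.

Lemma side_arith (R : realType) (z u b t q : R) : z < u -> 4%:R * t * q <= z ->
  u <= (b + 2%:R * t) * q -> z / 2%:R <= b * q.
Proof. lra. Qed.

Lemma pair_arith (R : realType) (a b c k : R) : a <= b + c + k -> - b + - c <= k + - a.
Proof. lra. Qed.

Lemma descent_arith (R : realType) (w h t q z : R) : z < w * q -> z < h * q ->
  4%:R * t * q <= z -> 8%:R * t * q < (w + h) * q.
Proof. lra. Qed.

Lemma union_arith (R : realType) (a e e4 ek n4 n12 : R) :
  2%:R * (n4 * e4 * ek) <= 1 -> 2%:R * a * n12 * e <= 1 -> 0 < a ->
  n4 * a * e4 * ek + n12 * a * a * e <= a.
Proof.
move=> h1 h2 a0.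
have -> : n4 * a * e4 * ek + n12 * a * a * e =
  a / 2%:R * (2%:R * (n4 * e4 * ek) + 2%:R * a * n12 * e) by field.
apply: (@le_trans _ _ (a / 2%:R * 2%:R)); last by rewrite divfK.
by apply: ler_wpM2l; [rewrite divr_ge0 // ltW|lra].
Qed.

(** * The induction over spanned rectangles *)

Section RectBound.
Context {R : realType}.
Variables (p q eta ka zeta A : R) (N T : nat).
(* [zeta / q] is the length below which a rectangle is crossed line by line, and
   [T] the size of a step of the descent. The factor [A] pays for the seeds
   ([seedA]) and for the merging of two rectangles ([mergeA]), and the margin
   [ka] of [cut_cost] for the number of rectangles ([unionc]) and the corners
   of the strips ([stripc]). *)
Hypotheses (p0 : 0 < p) (p2 : p <= 1 / 2%:R) (pq : 1 - p = expR (- q)) (q0 : 0 < q).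
Hypotheses (eta0 : 0 < eta) (ka0 : 0 < ka) (kaN : ka <= cost (N%:R * q + eta)).
Hypotheses (zeta0 : 0 < zeta) (T8 : (8 <= T)%N) (Tzeta : 4%:R * T%:R * q <= zeta).
Let k1 : R := cost eta.
Let k2 : R := cost (zeta / 2%:R).
Hypothesis seedc : 2%:R * k1 + 2%:R <= cost zeta.
Hypothesis stripc : p * expR (4%:R * k2) * T%:R <= ka.
Hypothesis unionc : 2%:R * (N ^ 4)%:R * expR (4%:R * k2) <= expR (ka / 2%:R * T%:R).
Hypotheses (A0 : 0 < A) (seedA : expR (2%:R * k1 + 2%:R - T%:R / 2%:R) <= A).
Hypothesis mergeA : 2%:R * A * (N ^ 12)%:R * expR (4%:R * k2 + 2%:R * k1) <= 1.

Let p01 : 0 < p < 1.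
Proof. by rewrite p0 /=; move: p2; lra. Qed.
Let p01' : forall x : int * int, 0 <= (fun=> p) x <= 1.
Proof. by move=> x; move/andP: p01 => [/ltW -> /ltW ->]. Qed.

Let gh := cut_cost q eta ka.
Let gh0 : forall n, 0 <= gh n. Proof. exact: cut_cost_ge0. Qed.
Let gha : forall m n, (m <= n)%N -> gh n <= gh m.
Proof. by move=> m n; exact: cut_cost_anti. Qed.

Definition rect_pot (r : rect) : R := pot gh (rw r) (rh r).

Lemma line_betaE n : (0 < n)%N -> line_beta p n = expR (- cost (n%:R * q)).
Proof.
move=> n0; have := line_beta_gt0 p01 n0.
by rewrite /cost opprK /line_beta pq -expRM_natl mulrN => b0; rewrite lnK.
Qed.

Lemma gh_le_cost n : (0 < n)%N -> (n <= N)%N -> gh n <= cost (n%:R * q) - ka.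
Proof.
move=> n0 nN; have nq : 0 < n%:R * q by rewrite mulr_gt0 // ltr0n.
rewrite /gh cut_costE.
  by rewrite lerD2r cost_anti // lerDl ltW.
apply: le_trans kaN _; apply: cost_anti.
  by rewrite ltr_wpDl // ltW.
by rewrite lerD2r ler_wpM2r ?ler_nat // ltW.
Qed.

Lemma strip_exp (S Q : rect) : rpos S -> rsub S Q ->
  zeta / 2%:R <= (rh S)%:R * q -> zeta / 2%:R <= (rw S)%:R * q ->
  (phi Q <= phi S + T.*2)%N ->
  Pr (fun=> p) (rsites Q) (strip S Q) <=
  expR (4%:R * k2 - (rw Q - rw S)%:R * cost ((rh S)%:R * q)
    - (rh Q - rh S)%:R * cost ((rw S)%:R * q) + ka / 2%:R * (phi Q - phi S)%:R).
Proof.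
move=> pS SQ zh zw st; have [dw dh] := rsub_dims SQ.
have := Pr_strip_bound pS SQ p01; have [w0 h0] := pS.
have bhX n : line_beta p (rh S) ^+ n = expR (n%:R * - cost ((rh S)%:R * q)).
  by rewrite line_betaE // expRM_natl.
have bwX n : line_beta p (rw S) ^+ n = expR (n%:R * - cost ((rw S)%:R * q)).
  by rewrite line_betaE // expRM_natl.
move: bhX bwX; move: (line_beta p (rh S)) (line_beta p (rw S)) => bh bw.
set ch := cost ((rh S)%:R * q); set cw := cost ((rw S)%:R * q) => bhX bwX.
have stE : (phi Q - phi S = (rw Q - rw S) + (rh Q - rh S))%N.
  by move: dw dh; rewrite /phi; clear; lia.
have {st} : ((rw Q - rw S) + (rh Q - rh S) <= T.*2)%N by move: st; rewrite -stE; clear; lia.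
rewrite stE; move: (rw Q - rw S)%N (rh Q - rh S)%N (Pr _ _ _) => s t P st.
have z20 : 0 < zeta / 2%:R by rewrite divr_gt0.
have hch : ch <= k2 by exact: cost_anti.
have hcw : cw <= k2 by exact: cost_anti.
have e1 : bh ^+ 2 * bw ^+ 2 = expR (2%:R * - ch + 2%:R * - cw) by rewrite bhX bwX expRD.
have e2 : bh ^+ s * bw ^+ t = expR (s%:R * - ch + t%:R * - cw) by rewrite bhX bwX expRD.
have e3 : bh ^- 2 * bw ^- 2 = expR (2%:R * ch + 2%:R * cw).
  by rewrite -invfM e1 -expRN; congr expR; ring.
rewrite e1 e2 e3; set x := p * _.
have x0 : 0 <= x by rewrite /x mulr_ge0 ?expR_ge0 // ltW.
(* From [4 s t <= (s + t) ^ 2] and [s + t <= 2 T] there are at most [(s + t) T / 2] corner sites; by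
   [stripc] they use up half of the margin [ka (s + t)]. *)
have hx : (1 + x) ^+ (s * t) <= expR (ka / 2%:R * (s + t)%:R).
  apply: (@le_trans _ _ (expR x ^+ (s * t))).
    by rewrite lerXn2r ?nnegrE ?expR_ge0 ?expR_ge1Dx // addr_ge0.
  rewrite -expRM_natl ler_expR.
  have hst : (s * t)%:R <= (s + t)%:R * T%:R / 2%:R :> R.
    rewrite ler_pdivlMr // -!natrM ler_nat.
    have h1 : (4 * (s * t) <= (s + t) * (s + t))%N.
      by rewrite mulnn; exact: (nat_AGM2 s t).1.
    have h2 : ((s + t) * (s + t) <= (s + t) * T * 2)%N by rewrite -mulnA muln2 leq_mul2l st orbT.
    by move: h1 h2; move: (s * t)%N ((s + t) * (s + t))%N ((s + t) * T)%N; clear; lia.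
  apply: (@le_trans _ _ ((s + t)%:R * T%:R / 2%:R * (p * expR (4%:R * k2)))).
    apply: ler_pM => //; rewrite /x; apply: ler_wpM2l; first exact: ltW.
    by rewrite ler_expR; exact: strip_arith1.
  have -> : (s + t)%:R * T%:R / 2%:R * (p * expR (4%:R * k2)) =
      (s + t)%:R / 2%:R * (p * expR (4%:R * k2) * T%:R) :> R by field.
  apply: (@le_trans _ _ ((s + t)%:R / 2%:R * ka)).
    by apply: ler_wpM2l stripc; rewrite divr_ge0.
  by rewrite le_eqVlt; apply/orP; left; apply/eqP; field.
move=> hP.
have e0 : 0 < expR (2%:R * - ch + 2%:R * - cw) by exact: expR_gt0.
rewrite -(ler_pM2l e0); apply: le_trans hP _.
apply: (@le_trans _ _ (expR (s%:R * - ch + t%:R * - cw) * expR (ka / 2%:R * (s + t)%:R))).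
  by apply: ler_wpM2l hx; exact: expR_ge0.
by rewrite -!expRD ler_expR; exact: strip_arith2.
Qed.

(** The potential charges each line of the frame [ka] less than its true cost. Half of this pays for
    the corners; the other half is the gain left in the conclusion. *)
Lemma strip_pot (S Q : rect) : rpos S -> rsub S Q ->
  zeta / 2%:R <= (rh S)%:R * q -> zeta / 2%:R <= (rw S)%:R * q ->
  (phi Q <= phi S + T.*2)%N -> (rw Q <= N)%N -> (rh Q <= N)%N ->
  expR (- rect_pot S) * Pr (fun=> p) (rsites Q) (strip S Q) <=
  expR (4%:R * k2 - ka / 2%:R * (phi Q - phi S)%:R) * expR (- rect_pot Q).
Proof.
move=> pS SQ zh zw st wN hN; have [dw dh] := rsub_dims SQ; have [w0 h0] := pS.
apply: (@le_trans _ _ _ _ _ (ler_wpM2l (expR_ge0 _) (strip_exp pS SQ zh zw st))).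
rewrite -!expRD ler_expR.
have := pot_grow gh0 gha (rw S) (rh S) (rw Q - rw S) (rh Q - rh S).
rewrite !subnKC // -/(rect_pot S) -/(rect_pot Q).
have h1 := gh_le_cost h0 (leq_trans dh hN).
have h2 := gh_le_cost w0 (leq_trans dw wN).
have -> : (phi Q - phi S = (rw Q - rw S) + (rh Q - rh S))%N.
  by move: dw dh; rewrite /phi; clear; lia.
rewrite natrD.
apply: strip_arith3; by apply: ler_wpM2l.
Qed.

Lemma rect_pot_le Q : rect_pot Q <= k1 * (phi Q)%:R.
Proof. by apply: pot_linear => // n; apply: cut_cost_le => //; exact: ltW. Qed.

(** In a thin rectangle a line costs at least [2 k1 + 2], while the potential is at most
    [k1 (w + h) <= 2 k1 w]. The surplus of 2 per line yields [exp (- T / 2)], since [T <= 4 w]. *)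
Lemma seed_num (w h : nat) (P V : R) : (0 < h)%N -> (h <= w)%N ->
  h%:R * q <= zeta -> (T <= 2 * (w + h))%N -> V <= k1 * (w + h)%:R ->
  line_beta p h * P <= line_beta p h ^+ w -> P <= A * expR (- V).
Proof.
move=> h0 hw hz hT hV; rewrite line_betaE //.
set c := cost (h%:R * q) => hP.
have k10 : 0 < k1 by exact: cost_gt0.
have hc : 2%:R * k1 + 2%:R <= c.
  by apply: le_trans seedc _; apply: cost_anti => //; rewrite mulr_gt0 // ltr0n.
have w0 : (0 < w)%N by exact: leq_trans hw.
have {hP} : P <= expR (- c) ^+ w.-1.
  rewrite -(ler_pM2l (expR_gt0 (- c))); apply: le_trans hP _.
  by rewrite -exprS prednK.
move/le_trans; apply; apply: (@le_trans _ _ (expR (2%:R * k1 + 2%:R - T%:R / 2%:R) * expR (- V))).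
  rewrite -expRM_natl -expRD ler_expR; have -> : w = w.-1.+1 by rewrite prednK.
  have hw' : h%:R <= w.-1%:R + 1 :> R by rewrite natr1 prednK // ler_nat.
  have hT' : T%:R <= 4%:R * (w.-1%:R + 1) :> R.
    by rewrite natr1 prednK // -natrM ler_nat; move: hw hT; clear; lia.
  have hV' : V <= k1 * (w.-1%:R + 1 + h%:R) by rewrite natr1 prednK // -natrD.
  have n0 : 0 <= w.-1%:R :> R by [].
  rewrite /=; move: n0 hw' hT' hV' hc k10; exact: seed_arith.
by rewrite ler_wpM2r ?expR_ge0.
Qed.

Lemma seed_bound Q : rpos Q -> (T <= 2 * phi Q)%N ->
  (rw Q)%:R * q <= zeta \/ (rh Q)%:R * q <= zeta ->
  span_prob p Q <= A * expR (- rect_pot Q).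
Proof.
move=> pQ hT hz; have [w0 h0] := pQ; have hV := rect_pot_le Q.
have [hw|/ltnW wh] := leqP (rh Q) (rw Q).
  apply: (@seed_num (rw Q) (rh Q)) => //; last exact: span_prob_cols.
  case: hz => // hz; apply: le_trans hz.
  by rewrite ler_wpM2r ?ler_nat // ltW.
apply: (@seed_num (rh Q) (rw Q)) => //; first last.
- exact: span_prob_rows.
- by rewrite addnC.
- by rewrite addnC.
case: hz => // hz; apply: le_trans hz.
by rewrite ler_wpM2r ?ler_nat // ltW.
Qed.

Section Step.
Variable Q : rect.
Hypotheses (pQ : rpos Q) (wN : (rw Q <= N)%N) (hN : (rh Q <= N)%N).
Hypotheses (zw : zeta < (rw Q)%:R * q) (zh : zeta < (rh Q)%:R * q).
Hypothesis IH : forall r, rpos r -> rsub r Q -> (phi r < phi Q)%N ->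
  (T <= 2 * phi r)%N -> span_prob p r <= A * expR (- rect_pot r).

Lemma side_large (a b : nat) : zeta < a%:R * q -> (a <= b + T.*2)%N ->
  zeta / 2%:R <= b%:R * q.
Proof.
move=> za ab.
have : a%:R * q <= (b%:R + 2%:R * T%:R) * q.
  by rewrite ler_wpM2r ?(ltW q0) // -natrM -natrD ler_nat mul2n.
have h := Tzeta; move: za h; move: (a%:R * q) => u; exact: side_arith.
Qed.

Lemma strip_pot_large (S : rect) : rpos S -> rsub S Q -> (phi Q <= phi S + T.*2)%N ->
  expR (- rect_pot S) * Pr (fun=> p) (rsites Q) (strip S Q) <=
  expR (4%:R * k2 - ka / 2%:R * (phi Q - phi S)%:R) * expR (- rect_pot Q).
Proof.
move=> pS SQ st; have [dw dh] := rsub_dims SQ.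
apply: strip_pot => //.
  by apply: (side_large zh); move: dw dh st; rewrite /phi; clear; lia.
by apply: (side_large zw); move: dw dh st; rewrite /phi; clear; lia.
Qed.

Let VQ := expR (- rect_pot Q).

Lemma single_bound (S : rect) : rpos S -> rsub S Q -> (phi S + T <= phi Q)%N ->
  (phi Q <= phi S + T.*2)%N -> (T <= 2 * phi S)%N ->
  Pr (fun=> p) (rsites Q) (fun Y => spanned S Y /\ strip S Q Y) <=
  A * expR (4%:R * k2) * expR (- (ka / 2%:R * T%:R)) * VQ.
Proof.
move=> pS SQ h1 h2 h3.
have hT : T%:R <= (phi Q - phi S)%:R :> R.
  by rewrite ler_nat; move: h1; clear; lia.
have hS : span_prob p S <= A * expR (- rect_pot S).
  by apply: IH => //; move: h1 T8; clear; lia.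
rewrite (Pr_inner_strip pS SQ _ (@dep_on_spanned S)) -/(span_prob p S).
apply: (@le_trans _ _ (A * (expR (- rect_pot S) * Pr (fun=> p) (rsites Q) (strip S Q)))).
  by rewrite mulrA; apply: ler_wpM2r hS; exact: Pr_ge0.
rewrite -[A * _ * _]mulrA -[leRHS]mulrA; apply: ler_wpM2l; first exact: ltW.
apply: le_trans (strip_pot_large pS SQ h2) _.
apply: ler_wpM2r; first exact: expR_ge0.
rewrite -expRD ler_expR lerD2l lerN2; apply: ler_wpM2l hT.
by rewrite divr_ge0 // ltW.
Qed.

(** The induction hypothesis applies to both parts and yields [A] twice; the spare factor is set by
    [mergeA] against the number of triples of rectangles. [2 k1] is the potential of the column and
    the row that may separate the parts. *)
Lemma pair_bound (S r1 r2 : rect) : rpos S -> rsub S Q -> (phi Q < phi S + T)%N ->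
  rpos r1 -> rpos r2 -> rsub r1 S -> rsub r2 S ->
  (phi r1 + T.*2 < phi Q)%N -> (phi r2 + T.*2 < phi Q)%N ->
  (rw S <= rw r1 + rw r2 + 1)%N -> (rh S <= rh r1 + rh r2 + 1)%N ->
  Pr (fun=> p) (rsites Q)
    (fun Y => disjoint_occ (spanned r1) (spanned r2) Y /\ strip S Q Y) <=
  A ^+ 2 * expR (4%:R * k2 + 2%:R * k1) * VQ.
Proof.
move=> pS SQ hS p1 p2' r1S r2S h1 h2 hw hh.
have phS : (phi S <= phi r1 + phi r2 + 2)%N.
  by move: hw hh; rewrite /phi; clear; lia.
(* The other part lies more than [2 T] below [Q], while together the two reach [phi Q - T] up to 2.
   So each semi-perimeter exceeds [T - 2], which is at least [T / 2] as [T >= 8]. *)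
have B1 : span_prob p r1 <= A * expR (- rect_pot r1).
  by apply: IH => //; [exact: rsub_trans SQ|move: h1; clear; lia|
    move: phS hS h2 T8; clear; lia].
have B2 : span_prob p r2 <= A * expR (- rect_pot r2).
  by apply: IH => //; [exact: rsub_trans SQ|move: h2; clear; lia|
    move: phS hS h1 T8; clear; lia].
rewrite (Pr_inner_strip pS SQ _ (dep_on_disjoint_spanned r1S r2S)).
have sub r : rsub r S -> {subset rsites r <= rsites S}.
  by move=> rS z /mem_rsites /(rsub_set rS) /mem_rsites.
have hD : Pr (fun=> p) (rsites S) (disjoint_occ (spanned r1) (spanned r2)) <=
    span_prob p r1 * span_prob p r2.
  rewrite /span_prob -(Pr_restrict _ (uniq_rsites S) (uniq_rsites r1) (sub _ r1S) (@dep_on_spanned r1)).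
  rewrite -(Pr_restrict _ (uniq_rsites S) (uniq_rsites r2) (sub _ r2S) (@dep_on_spanned r2)).
  by apply: Pr_disjoint_occ => //; exact: increasing_spanned.
have V2 : rect_pot S <= rect_pot r1 + rect_pot r2 + 2%:R * k1.
  apply: le_trans (pot_mono gh0 gha hw hh) _.
  apply: le_trans (pot_add gh0 gha _ _ _ _) _.
  apply: lerD; first exact: pot_add.
  rewrite mulrC; apply: pot_linear => // n; apply: cut_cost_le => //; exact: ltW.
have hE : span_prob p r1 * span_prob p r2 <= A ^+ 2 * expR (2%:R * k1) * expR (- rect_pot S).
  apply: (@le_trans _ _ (A * expR (- rect_pot r1) * (A * expR (- rect_pot r2)))).
    by apply: ler_pM => //; exact: Pr_ge0.
  rewrite mulrACA -expr2 -mulrA; apply: ler_wpM2l; first by rewrite exprn_ge0 // ltW.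
  rewrite -!expRD ler_expR; move: V2; exact: pair_arith.
apply: (@le_trans _ _ (A ^+ 2 * expR (2%:R * k1) *
   (expR (- rect_pot S) * Pr (fun=> p) (rsites Q) (strip S Q)))).
  rewrite mulrA; apply: ler_wpM2r; first exact: Pr_ge0.
  exact: le_trans hD hE.
rewrite [4%:R * k2 + _]addrC expRD [A ^+ 2 * (_ * _)]mulrA -[leRHS]mulrA; apply: ler_wpM2l.
  by rewrite mulr_ge0 ?expR_ge0 // exprn_ge0 // ltW.
apply: le_trans (strip_pot_large pS SQ _) _.
  by move: hS; clear; lia.
apply: ler_wpM2r; first exact: expR_ge0.
by rewrite ler_expR lerBlDr lerDl mulr_ge0 // divr_ge0 // ltW.
Qed.

(** A union bound over both alternatives of [spanned_descent]; [unionc] and [mergeA] make each of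
    the two sums at most half of the claim. *)
Lemma descent_bound : span_prob p Q <= A * VQ.
Proof.
have TQ : (8 * T < phi Q)%N.
  suff : (8 * T)%:R * q < (phi Q)%:R * q by rewrite ltr_pM2r // ltr_nat.
  rewrite /phi natrM natrD; have h := Tzeta.
  exact: (descent_arith zw zh Tzeta).
pose M := ((rw Q * rh Q) ^ 2)%N.
pose CA S := [/\ rpos S, rsub S Q, (phi S + T <= phi Q)%N & (phi Q <= phi S + T.*2)%N].
pose CB (t : rect * (rect * rect)) := [/\ [/\ rpos t.1, rsub t.1 Q & (phi Q < phi t.1 + T)%N],
  [/\ rpos t.2.1, rpos t.2.2, rsub t.2.1 t.1 & rsub t.2.2 t.1],
  (phi t.2.1 + T.*2 < phi Q)%N /\ (phi t.2.2 + T.*2 < phi Q)%N &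
  (rw t.1 <= rw t.2.1 + rw t.2.2 + 1)%N /\ (rh t.1 <= rh t.2.1 + rh t.2.2 + 1)%N].
pose trip := [seq (z, r) | z <- subrects Q, r <- [seq (r1, r2) | r1 <- subrects Q, r2 <- subrects Q]].
pose EA S Y := CA S /\ (spanned S Y /\ strip S Q Y).
pose EB (t : rect * (rect * rect)) Y := CB t /\
  (disjoint_occ (spanned t.2.1) (spanned t.2.2) Y /\ strip t.1 Q Y).
have cover : span_prob p Q <= Pr (fun=> p) (rsites Q) (fun Y =>
    (exists2 S, S \in subrects Q & EA S Y) \/ (exists2 t, t \in trip & EB t Y)).
  apply: Pr_le => // Y _ sQ.
  have [||[S [pS SQ sS h1 h2]]|[S [r1 [r2 [[pS SQ h1] [p1 p2' r1S r2S] h2 h3 dis]]]]] :=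
    @spanned_descent Y Q T pQ _ _ sQ.
  - by move: T8; clear; lia.
  - by move: TQ T8; clear; lia.
  - left; exists S; first exact: mem_subrects.
    by split; [split|split => //; exact: strip_of_spanned].
  - right; exists (S, (r1, r2)).
      apply/allpairsP; exists (S, (r1, r2)); split => //; first exact: mem_subrects.
      apply/allpairsP; exists (r1, r2).
      by split => //; apply: mem_subrects => //; exact: rsub_trans SQ.
    by split; [split|split => //; exact: strip_of_spanned].
apply: le_trans cover _; apply: le_trans (Pr_or p01' _ _ _) _.
have V0 : 0 <= VQ by exact: expR_ge0.
have A0' := ltW A0.
have hM : (M <= N ^ 4)%N.
  by rewrite /M (expnM N 2 2) leq_exp2r // -mulnn leq_mul.
have sA : Pr (fun=> p) (rsites Q) (fun Y => exists2 S, S \in subrects Q & EA S Y) <=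
    (N ^ 4)%:R * (A * expR (4%:R * k2) * expR (- (ka / 2%:R * T%:R)) * VQ).
  have c0 : 0 <= A * expR (4%:R * k2) * expR (- (ka / 2%:R * T%:R)) * VQ.
    by rewrite !mulr_ge0 ?expR_ge0.
  apply: le_trans (@Pr_exists _ _ _ p01' _ _ _ _ _ (fun S _ => Pr_cond p01' c0 _)) _.
    move=> S _ [pS SQ h1 h2]; apply: single_bound => //.
    by move: TQ h2; clear; lia.
  by apply: ler_wpM2r => //; rewrite ler_nat size_subrects.
have sB : Pr (fun=> p) (rsites Q) (fun Y => exists2 t, t \in trip & EB t Y) <=
    (N ^ 12)%:R * (A ^+ 2 * expR (4%:R * k2 + 2%:R * k1) * VQ).
  have c0 : 0 <= A ^+ 2 * expR (4%:R * k2 + 2%:R * k1) * VQ.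
    by rewrite !mulr_ge0 ?expR_ge0 ?exprn_ge0.
  apply: le_trans (@Pr_exists _ _ _ p01' _ _ _ _ _ (fun t _ => Pr_cond p01' c0 _)) _.
    by move=> t _ [[? ? ?] [? ? ? ?] [? ?] [? ?]]; apply: pair_bound.
  apply: ler_wpM2r => //; rewrite ler_nat /trip size_allpairs size_subrects size_allpairs !size_subrects -/M.
  have -> : (N ^ 12 = N ^ 4 * (N ^ 4 * N ^ 4))%N by rewrite -!expnD.
  exact: leq_mul hM (leq_mul hM hM).
apply: le_trans (lerD sA sB) _.
rewrite !mulrA -mulrDl; apply: ler_wpM2r => //.
have u1 : 2%:R * ((N ^ 4)%:R * expR (4%:R * k2) * expR (- (ka / 2%:R * T%:R))) <= 1.
  by rewrite expRN !mulrA ler_pdivrMr ?expR_gt0 // mul1r.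
exact: (union_arith u1 mergeA A0).
Qed.
End Step.

Lemma rect_bound Q : rpos Q -> (rw Q <= N)%N -> (rh Q <= N)%N -> (T <= 2 * phi Q)%N ->
  span_prob p Q <= A * expR (- rect_pot Q).
Proof.
move: {2}(phi Q) (leqnn (phi Q)) => n; elim: n Q => [|n IH] Q hn pQ wN hN hT.
  by move: hn pQ; rewrite /phi /rpos; clear; lia.
have [zw|zw] := leP ((rw Q)%:R * q) zeta; first by apply: seed_bound => //; left.
have [zh|zh] := leP ((rh Q)%:R * q) zeta; first by apply: seed_bound => //; right.
apply: descent_bound => // r pr rQ lt hTr; have [dw dh] := rsub_dims rQ.
apply: IH => //; [|exact: leq_trans wN|exact: leq_trans hN].
by move: lt hn; clear; lia.
Qed.
End RectBound.

(** * Choice of the parameters *)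

Section RectEstimate.
Context {R : realType}.

Lemma pow_le_expR (C c : R) n : 0 < C -> 0 < c -> exists2 q1, 0 < q1 &
  forall q, 0 < q -> q < q1 -> C / q ^+ n <= expR (c / q).
Proof.
move=> C0 c0; pose M : R := (n.+1)`!%:R.
have M0 : 0 < M by rewrite ltr0n fact_gt0.
exists (c ^+ n.+1 / (C * M)); first by rewrite divr_gt0 ?exprn_gt0 // mulr_gt0.
move=> q q0 qlt; have cq0 : 0 <= c / q by rewrite divr_ge0 // ltW.
apply: le_trans (expR_ge_pow n cq0); rewrite -/M expr_div_n.
have {}qlt : q * (C * M) <= c ^+ n.+1 by rewrite -ler_pdivlMr ?mulr_gt0 // ltW.
have qn : 0 < q ^+ n by rewrite exprn_gt0.
rewrite -mulrA -invfM ler_pdivlMr ?mulr_gt0 ?exprn_gt0 //.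
have -> : C / q ^+ n * (q ^+ n.+1 * M) = q * (C * M).
  by rewrite exprS; field; rewrite gt_eqF.
by [].
Qed.

Lemma nat_above (x q : R) : 0 <= x -> 0 < q -> exists n,
  [/\ x <= n.+1%:R * q, n.+1%:R * q <= x + q & forall m, (m < n.+1)%N -> m%:R * q <= x].
Proof.
move=> x0 q0; have xq : 0 <= x / q by rewrite divr_ge0 // ltW.
have /andP[h1 h2] := Num.Theory.truncn_itv xq.
move: h1 h2; set n := Num.truncn _ => h1 h2; exists n; split.
- by rewrite -ler_pdivrMr // ltW.
- by rewrite -natr1 mulrDl mul1r lerD2r -ler_pdivlMr.
- move=> m mn; rewrite -ler_pdivlMr //; apply: le_trans h1.
  by rewrite ler_nat.
Qed.

Lemma diag_cost_ge (gh : nat -> R) n : (forall m n, (m <= n)%N -> gh n <= gh m) ->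
  2%:R * \sum_(1 <= k < n.+1) gh k <= diag_cost gh n.
Proof.
move=> gha; rewrite big_add1 /= /diag_cost mulr_sumr.
apply: ler_sum => k _; rewrite mulr_natl mulr2n lerD2r; exact: gha.
Qed.

Lemma rect_pot_ge (q eta ka x : R) (N n : nat) Q : 0 < q -> 0 < eta -> 0 < ka ->
  ka <= cost (N%:R * q + eta) -> (n <= N)%N -> (n <= minn (rw Q) (rh Q))%N ->
  x <= \sum_(1 <= k < n.+1) q * cost (k%:R * q + eta) ->
  2%:R * (x - n%:R * q * ka) <= q * rect_pot q eta ka Q.
Proof.
move=> q0 eta0 ka0 kaN nN nQ hx.
have gh0 := @cut_cost_ge0 R q eta ka.
have gha m k : (m <= k)%N -> cut_cost q eta ka k <= cut_cost q eta ka m.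
  exact: cut_cost_anti.
have := pot_diag gh0 gha (cut_cost_convex ka q0 eta0) (rw Q) (rh Q).
rewrite -/(rect_pot q eta ka Q); have := diag_cost_mono gh0 nQ.
move=> /le_trans h /h {}h; apply: (@le_trans _ _ (q * diag_cost (cut_cost q eta ka) n)); last first.
  by rewrite ler_wpM2l // ltW.
apply: le_trans (ler_wpM2l (ltW q0) (diag_cost_ge n gha)).
rewrite mulrCA; apply: ler_wpM2l => //.
apply: (@le_trans _ _ (\sum_(1 <= k < n.+1) (q * cost (k%:R * q + eta) - q * ka))).
  by rewrite sumrB lerB // sumr_const_nat subSS subn0 -[q * ka *+ n]mulr_natl mulrA.
rewrite mulr_sumr; apply: ler_sum_nat => k /andP[k1 kn].
rewrite -mulrBr; apply: ler_wpM2l; first exact: ltW.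
rewrite cut_costE //; apply: le_trans kaN _; apply: cost_anti.
  by rewrite ltr_wpDl // mulr_ge0 // ltW.
by rewrite lerD2r ler_wpM2r ?(ltW q0) // ler_nat; lia.
Qed.

(** For rectangles whose shorter side is below [b / q], where the sum along the diagonal falls short
    of [lambda]: crossing the longer side alone costs enough. *)
Lemma span_prob_short (p q : R) (b : R) (r : rect) (m : nat) : 0 < p < 1 ->
  1 - p = expR (- q) -> 0 < q -> rpos r -> (m.+1 <= maxn (rw r) (rh r))%N ->
  (minn (rw r) (rh r))%:R * q <= b ->
  span_prob p r <= expR (- (m%:R * cost b)).
Proof.
move=> p01 pq q0 pr; have [w0 h0] := pr.
have num (w h : nat) (P : R) : (0 < h)%N -> (m.+1 <= w)%N -> h%:R * q <= b -> 
    line_beta p h * P <= line_beta p h ^+ w -> P <= expR (- (m%:R * cost b)).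
  move=> h1 mw hb; have b0 := line_beta_gt0 p01 h1.
  have bE : line_beta p h = expR (- cost (h%:R * q)).
    have := b0; rewrite /line_beta pq -expRM_natl mulrN => b0'.
    by rewrite /cost opprK lnK.
  case: w mw => // w mw; rewrite exprS ler_pM2l // bE => /le_trans; apply.
  rewrite -expRM_natl ler_expR mulrN lerN2.
  apply: ler_pM => //; rewrite ?ler_nat //.
    by apply/ltW/cost_gt0/(lt_le_trans _ hb); rewrite mulr_gt0 // ltr0n.
  by apply: cost_anti => //; rewrite mulr_gt0 // ltr0n.
have [hw|/ltnW wh] := leqP (rh r) (rw r) => mm hb.
  by apply: (num (rw r) (rh r)) => //; exact: span_prob_cols.
by apply: (num (rh r) (rw r)) => //; exact: span_prob_rows.
Qed.

Lemma ex_below2 (a b : R) : 0 < a -> 0 < b -> exists c, [/\ 0 < c, c <= a & c <= b].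
Proof.
move=> a0 b0; exists (Num.min a b).
by rewrite lt_min a0 b0 !ge_min !lexx orbT.
Qed.

Lemma rect_estimate_aux (p q eta ka zeta tau B : R) (k : nat) :
  0 < p -> p <= 1 / 2%:R -> 1 - p = expR (- q) -> 0 < q -> p <= q -> q <= 1 ->
  0 < eta -> eta <= 1 -> 0 < ka -> ka <= cost (2%:R * B + 3%:R) -> 0 < zeta ->
  2%:R * cost eta + 2%:R <= cost zeta -> 1 <= B ->
  0 < tau -> tau <= 1 -> tau <= zeta / 4%:R -> tau <= ka / expR (4%:R * cost (zeta / 2%:R)) ->
  9%:R * q <= tau ->
  2%:R * (2%:R * (B + 1)) ^+ 4 * expR (4%:R * cost (zeta / 2%:R)) / q ^+ 4 <=
    expR (ka * tau / 4%:R / q) ->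
  2%:R * (2%:R * (B + 1)) ^+ 12 * expR (4%:R * cost (zeta / 2%:R) + 2%:R * cost eta) *
    expR (2%:R * cost eta + 2%:R) / q ^+ 12 <= expR (tau / 4%:R / q) ->
  B <= k.+1%:R * q -> k.+1%:R * q <= B + q ->
  ka <= cost ((k.+1.*2)%:R * q + eta) /\
  forall Q, rpos Q -> (k < maxn (rw Q) (rh Q))%N -> (maxn (rw Q) (rh Q) <= k.+1.*2)%N ->
    span_prob p Q <= expR (- rect_pot q eta ka Q).
Proof.
move=> p0 p2 pq q0 pleq q1 eta0 eta1 ka0 kaB zeta0 hz B1 tau0 tau1 tz tk q9 hu hs kB1 kB2.
set N := (k.+1.*2)%N.
have Nq : N%:R * q <= 2%:R * (B + 1).
  rewrite /N -mul2n natrM -mulrA ler_wpM2l //; apply: le_trans kB2 _.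
  by rewrite lerD2l.
have kaN : ka <= cost (N%:R * q + eta).
  apply: le_trans kaB _; apply: cost_anti; first by rewrite ltr_wpDl // mulr_ge0 // ltW.
  have -> : 2%:R * B + 3%:R = 2%:R * (B + 1) + 1 by ring.
  exact: lerD.
split => // Q pQ kQ QN.
(* [T] is about [tau / q]. Then [exp (ka T / 2)] and [exp (T / 2)] dominate the powers of [1 / q]
   that count rectangles. *)
have [T [T1 T2 T3]] := nat_above (ltW tau0) q0.
have {T3} Tq : T%:R * q <= tau by exact: T3.
have T8 : (8 <= T)%N.
  rewrite -ltnS -(ltr_nat R) -(ltr_pM2r q0); apply: lt_le_trans T1.
  by apply: lt_le_trans q9; rewrite ltr_pM2r // ltr_nat.
have Tt : tau / 2%:R / q <= T%:R.
  rewrite ler_pdivrMr // ler_pdivrMr //; apply: le_trans T1 _.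
  rewrite -mulrA [q * _]mulrC mulrA ler_wpM2r ?(ltW q0) // -natrM ler_nat.
  by move: T8; clear; lia.
have Nn n : N%:R ^+ n <= (2%:R * (B + 1)) ^+ n / q ^+ n.
  by rewrite -expr_div_n lerXn2r ?nnegrE // ?divr_ge0 ?(ltW q0) ?mulr_ge0 ?addr_ge0 ?(le_trans ler01 B1) // ler_pdivlMr.
have N0 : (0 < N)%N by [].
have X0 : 0 < 2%:R * N%:R ^+ 12 * expR (4%:R * cost (zeta / 2%:R) + 2%:R * cost eta) :> R.
  by rewrite !mulr_gt0 ?expR_gt0 // exprn_gt0 // ltr0n.
(* The largest value allowed by [mergeA]. It is only polynomially small in [q], which leaves room
   for [seedA]. *)
pose A : R := (2%:R * N%:R ^+ 12 * expR (4%:R * cost (zeta / 2%:R) + 2%:R * cost eta))^-1.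
have A0 : 0 < A by rewrite invr_gt0.
have A1 : A <= 1.
  rewrite invf_le1 //.
  have k10 := cost_gt0 eta0.
  have k20 : 0 < cost (zeta / 2%:R) by apply: cost_gt0; rewrite divr_gt0.
  apply: mulr_ege1; last first.
    apply: le_trans (expR_ge1Dx _); rewrite lerDl.
    by apply: addr_ge0; apply: mulr_ge0; [|exact: ltW| |exact: ltW].
  by apply: mulr_ege1; [rewrite ler1n|rewrite exprn_ege1 // ler1n].
have step : span_prob p Q <= A * expR (- rect_pot q eta ka Q).
  apply: (@rect_bound R p q eta ka zeta A N T) => //.
  - have := ler_wpM2l (ler0n R 4) Tq; rewrite mulrA => /le_trans; apply.
    by rewrite mulrC -ler_pdivlMr.
  - rewrite ler_pdivlMr ?expR_gt0 // in tk.
    apply: le_trans tk; rewrite mulrAC; apply: ler_wpM2r; first exact: expR_ge0.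
    by apply: le_trans Tq; rewrite mulrC ler_wpM2l.
  - apply: (@le_trans _ _ (expR (ka * tau / 4%:R / q))).
      apply: le_trans hu; rewrite [leRHS]mulrAC; apply: ler_wpM2r; first exact: expR_ge0.
      by rewrite -mulrA natrX; apply: ler_wpM2l.
    rewrite ler_expR; have -> : ka * tau / 4%:R / q = ka / 2%:R * (tau / 2%:R / q).
      by field; rewrite gt_eqF.
    by apply: ler_wpM2l Tt; rewrite divr_ge0 // ltW.
  - rewrite /A -[leRHS]mul1r ler_pdivlMr //.
    have e1 : expR (tau / 4%:R / q) <= expR (T%:R / 2%:R).
      rewrite ler_expR; have -> : tau / 4%:R / q = tau / 2%:R / q / 2%:R.
        by field; rewrite gt_eqF.
      by rewrite ler_wpM2r.
    rewrite [expR (_ - _)]expRD expRN mulrAC ler_pdivrMr ?expR_gt0 // mul1r mulrC.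
    apply: le_trans e1; apply: le_trans hs.
    rewrite [leRHS]mulrAC; apply: ler_wpM2r; first exact: expR_ge0.
    rewrite [leRHS]mulrAC; apply: ler_wpM2r; first exact: expR_ge0.
    by rewrite -mulrA; apply: ler_wpM2l.
  - rewrite natrX [2%:R * A]mulrC -[A * _ * _]mulrA -[A * _ * _]mulrA mulVf //.
    exact: lt0r_neq0.
  - by move: QN; clear; lia.
  - by move: QN; clear; lia.
  - suff : (T <= k.+1)%N by move: kQ; rewrite /phi; clear; lia.
    rewrite -(ler_nat R) -(ler_pM2r q0).
    by apply: le_trans Tq _; apply: le_trans tau1 _; exact: le_trans kB1.
by apply: le_trans step _; rewrite ler_piMl ?expR_ge0.
Qed.

Lemma rect_estimate (e : R) : 0 < e -> exists B q0, [/\ 1 <= B, 0 < q0 &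
  forall p q k Q, 0 < p -> p <= 1 / 2%:R -> 1 - p = expR (- q) -> 0 < q -> p <= q ->
  q < q0 -> B <= k.+1%:R * q -> k.+1%:R * q <= B + q -> rpos Q ->
  (k < maxn (rw Q) (rh Q))%N -> (maxn (rw Q) (rh Q) <= k.+1.*2)%N ->
  span_prob p Q <= expR (- ((2%:R * lambda - e) / q))].
Proof.
move=> e0; have e4 : 0 < e / 4%:R by rewrite divr_gt0.
have [dd [b [dd0 b0 hR]]] := cost_riemann_ge e4.
have cb0 := cost_gt0 b0.
have l0 : 0 <= lambda :> R by exact/ltW/lambda_gt0.
(* A rectangle with a side below [b / q] has its longer side above [k], with [k q >= B - 1]; its
   lines then cost at least [k cost b >= 2 lambda / q]. *)
pose B : R := 1 + 2%:R * lambda / cost b.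
have B1 : 1 <= B.
  by rewrite /B lerDl; apply: divr_ge0; [exact: mulr_ge0|exact: ltW].
have [eta [eta0 eta1 etad]] := ex_below2 ltr01 (divr_gt0 dd0 (ltr0Sn R 1)).
(* The first bound keeps [cut_cost] untruncated up to size [N], where [N q + eta <= 2 B + 3]; the
   second limits to [e / 4] what [ka] takes from the sum up to [(b + 1) / q]. *)
have [||ka [ka0 kaB kae]] := @ex_below2 (cost (2%:R * B + 3%:R)) (e / 4%:R / (b + 1)).
  by apply: cost_gt0; rewrite addr_gt0 // mulr_gt0 // (lt_le_trans ltr01).
  by rewrite divr_gt0 // addr_gt0.
(* The witness solves [- ln (2 zeta) / 2 = y] in the lower bound [cost_ge]. *)
have [zeta zeta0 hz] : exists2 zeta : R, 0 < zeta & 2%:R * cost eta + 2%:R <= cost zeta.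
  pose y : R := 2%:R * cost eta + 2%:R.
  exists (expR (- (2%:R * y)) / 2%:R); first by rewrite divr_gt0 ?expR_gt0.
  apply: le_trans (cost_ge _); last by rewrite divr_gt0 ?expR_gt0.
  by rewrite [2%:R * (_ / _)]mulrC divfK ?pnatr_eq0 // expRK opprK [2%:R * y]mulrC mulfK ?pnatr_eq0 //.
have [||tau1 [t0 t1 t2]] := @ex_below2 (zeta / 4%:R) (ka / expR (4%:R * cost (zeta / 2%:R))).
  by rewrite divr_gt0.
  by rewrite divr_gt0 ?expR_gt0.
have [tau [tau0 tauL tauM]] := ex_below2 ltr01 t0.
have tz := le_trans tauM t1; have tk := le_trans tauM t2.
have BB : 0 < 2%:R * (B + 1) by rewrite mulr_gt0 // addr_gt0 // (lt_le_trans ltr01).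
have [||q1 q10 hq1] := @pow_le_expR
  (2%:R * (2%:R * (B + 1)) ^+ 4 * expR (4%:R * cost (zeta / 2%:R))) (ka * tau / 4%:R) 4.
- apply: mulr_gt0; last exact: expR_gt0.
  apply: mulr_gt0 => //; exact: exprn_gt0.
- by rewrite divr_gt0 // mulr_gt0.
have [||q2 q20 hq2] := @pow_le_expR
  (2%:R * (2%:R * (B + 1)) ^+ 12 * expR (4%:R * cost (zeta / 2%:R) + 2%:R * cost eta) *
    expR (2%:R * cost eta + 2%:R)) (tau / 4%:R) 12.
- apply: mulr_gt0; last exact: expR_gt0.
  apply: mulr_gt0; last exact: expR_gt0.
  apply: mulr_gt0 => //; exact: exprn_gt0.
- by rewrite divr_gt0.
have [qa [qa0 qa1 qa2]] := ex_below2 q10 q20.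
have [qb [qb0 qb1 qb2]] := ex_below2 (divr_gt0 dd0 (ltr0Sn R 1)) (divr_gt0 tau0 (ltr0Sn R 8)).
have [qc [qc0 qc1 qc2]] := ex_below2 qa0 qb0.
have [q3 [q30 q31 q32]] := ex_below2 qc0 ltr01.
exists B, q3; split => // p q k Q p0 p2 pq q0 pleq qlt kB1 kB2 pQ kQ QN.
have le1 : q <= 1 by exact/ltW/(lt_le_trans qlt).
have q4 : q < qc by exact: lt_le_trans q31.
have q5 : q < qa by exact: lt_le_trans qc1.
have q6 : q < qb by exact: lt_le_trans qc2.
have q9 : 9%:R * q <= tau.
  by rewrite mulrC -ler_pdivlMr //; apply/ltW/(lt_le_trans q6).
have [kaN est] := @rect_estimate_aux p q eta ka zeta tau B k p0 p2 pq q0 pleq le1 eta0 eta1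
  ka0 kaB zeta0 hz B1 tau0 tauL tz tk q9 (hq1 _ q0 (lt_le_trans q5 qa1))
  (hq2 _ q0 (lt_le_trans q5 qa2)) kB1 kB2.
have [n [n1 n2 n3]] := nat_above (ltW b0) q0.
have [nQ|Qn] := leqP n.+1 (minn (rw Q) (rh Q)); last first.
  have p01 : 0 < p < 1 by rewrite p0 /=; move: p2; clear; lra.
  apply: le_trans (span_prob_short p01 pq q0 pQ kQ (n3 _ Qn)) _.
  rewrite ler_expR lerN2.
  have h : 2%:R * lambda / cost b <= k%:R * q.
    by move: kB1; rewrite /B -natr1 mulrDl mul1r; move: le1; clear; lra.
  rewrite ler_pdivrMr //; apply: (@le_trans _ _ (2%:R * lambda)); first by rewrite lerBlDr lerDl ltW.
  by rewrite mulrAC -ler_pdivrMr.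
apply: le_trans (est Q pQ kQ QN) _; rewrite ler_expR lerN2 ler_pdivrMr // [leRHS]mulrC.
have hx := hR q eta n.+1 q0 eta0 _ n1.
have {}hx : lambda - e / 4%:R <= \sum_(1 <= k0 < n.+2) q * cost (k0%:R * q + eta).
  by apply: hx; move: etad (ltW (lt_le_trans q6 qb1)); clear; lra.
have nN : (n.+1 <= k.+1.*2)%N by move: nQ QN; clear; lia.
apply: le_trans (rect_pot_ge q0 eta0 ka0 kaN nN nQ hx).
have h : n.+1%:R * q * ka <= e / 4%:R.
  rewrite ler_pdivlMr ?addr_gt0 // mulrC in kae; apply: le_trans kae.
  apply: ler_wpM2r; first exact: ltW.
  by apply: le_trans n2 _; rewrite lerD2l.
by move: h; clear; lra.
Qed.
End RectEstimate.

(** * The subcritical bound *)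

Section Subcritical.
Context {R : realType}.

Lemma Pr0 (I : eqType) (s : seq I) (E : set I -> Prop) :
  Pr (fun=> 0 : R) s E = (`[< E set0 >])%:R.
Proof.
rewrite /Pr; elim: s E => [//|x s IH] E /=.
by rewrite mul0r add0r subr0 mul1r IH.
Qed.

Lemma span_prob0 (r : rect) : rpos r -> span_prob (0 : R) r = 0.
Proof.
move=> pr; rewrite /span_prob Pr0; case: asboolP => // h; exfalso.
have : rset r (rx r, ry r) by case: pr; runfold => ? ?; split; lia.
rewrite -h set0I => /(@closure_min set0 set0); apply => //.
Qed.

Lemma square_spanned_rect (L K : nat) (p c : R) : 0 <= p <= 1 -> 0 <= c ->
  (forall Q, rpos Q -> (K < maxn (rw Q) (rh Q))%N -> (maxn (rw Q) (rh Q) <= K.+1.*2)%N ->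
    span_prob p Q <= c) -> (K < L)%N ->
  span_prob p (big_square L) <= (L ^ 2 * (K.+1.*2) ^ 2)%:R * c.
Proof.
move=> p01 c0 H KL.
have p01' : forall x : int * int, 0 <= (fun=> p) x <= 1 by [].
have pS : rpos (big_square L) by rewrite /big_square; runfold; split; lia.
pose ds := [seq (w, h) | w <- iota 1 K.+1.*2, h <- iota 1 K.+1.*2].
pose js : seq rect := [seq (z, d) | z <- rsites (big_square L), d <- ds].
pose C r := [/\ rpos r, rsub r (big_square L), (K < maxn (rw r) (rh r))%N &
  (maxn (rw r) (rh r) <= K.+1.*2)%N].
pose E (r : rect) Y := C r /\ spanned r Y.
have sz : size js = (L ^ 2 * (K.+1.*2) ^ 2)%N.
  by rewrite /js size_allpairs size_rsites /ds size_allpairs !size_iota !mulnn.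
rewrite -sz; apply: le_trans (@Pr_exists _ _ _ p01' _ js _ E _ _).
  apply: Pr_le => // Y _ sp.
  have [|r [pr rS sr h1 h2]] := spanned_scale pS (ltn0Sn K) sp.
    by rewrite /big_square /rw /rh /=; lia.
  exists r; last by split.
  have hd : (rw r, rh r) \in ds.
    apply/allpairsP; exists (rw r, rh r); rewrite !mem_iota.
    by case: pr => w0 h0; split => //=; move: w0 h0 h2; clear; lia.
  have hz : (rx r, ry r) \in rsites (big_square L).
    apply/mem_rsites; apply: (rsub_set rS).
    by case: pr; runfold => w0 h0; split => /=; move: w0 h0; clear; lia.
  have -> : r = ((rx r, ry r), (rw r, rh r)) by case: (r) => [[? ?] [? ?]].
  by apply/allpairsP; exists ((rx r, ry r), (rw r, rh r)).
move=> r _; apply: Pr_cond => // -[pr rS h1 h2].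
rewrite (Pr_restrict _ (uniq_rsites _) (uniq_rsites r) _ (@dep_on_spanned r)) //.
  exact: H.
by move=> z /mem_rsites /(rsub_set rS) /mem_rsites.
Qed.

(** [q] is the exact rate at which a line of [n] sites is empty, with probability [exp (- n q)].
    Since [1 / q >= 1 / p - 1], returning to [p] costs at most the constant factor
    [exp (2 lambda)]. *)
Lemma ln_rate (p : R) : 0 < p -> p <= 1 / 2%:R ->
  exists q, [/\ 1 - p = expR (- q), 0 < q, p <= q, q <= 2%:R * p & p^-1 - 1 <= q^-1].
Proof.
move=> p0 p2; exists (- ln (1 - p)).
have r0 : 0 < 1 - p by move: p2; lra.
have pq : p <= - ln (1 - p).
  by rewrite lerNr; apply: le_ln1Dx; move: p2; lra.
have q0 : 0 < - ln (1 - p) by exact: lt_le_trans pq.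
have h : - ln (1 - p) <= p / (1 - p).
  rewrite -lnV ?posrE //.
  have e : (1 - p)^-1 = 1 + p / (1 - p) by field; exact: lt0r_neq0.
  rewrite [X in ln X]e.
  by apply: le_ln1Dx; apply: (@lt_trans _ _ 0) => //; rewrite divr_gt0.
split => //.
- by rewrite opprK lnK.
- apply: le_trans h _; rewrite ler_pdivrMr //; move: p0 p2; nra.
- have -> : p^-1 - 1 = (p / (1 - p))^-1 by field; rewrite !lt0r_neq0.
  by rewrite lef_pV2 ?posrE // divr_gt0.
Qed.

Lemma subcritical_bound (e dl : R) : 0 < e -> 0 < dl ->
  exists p0 l0 : R, [/\ 0 < p0, 0 < l0 &
    forall (p : R) (L : nat), 0 <= p < p0 -> l0 <= ln L%:R -> p * ln L%:R <= lambda - e ->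
    span_prob p (big_square L) <= dl].
Proof.
move=> e0 dl0; have [B [q0 [B1 q00 est]]] := rect_estimate e0.
have lam0 : 0 < lambda :> R := lambda_gt0.
have B0 : 0 < B + 1 by move: B1; lra.
have cB : 0 < cost (B + 1) by exact: cost_gt0.
pose C : R := (2%:R * (B + 1)) ^+ 2 * expR (2%:R * lambda) / dl.
have C0 : 0 < C.
  apply: divr_gt0 => //; apply: mulr_gt0; last exact: expR_gt0.
  by apply: exprn_gt0; apply: mulr_gt0.
have [p1 p10 hp1] := pow_le_expR 2 C0 e0.
have [p2 [p20 p21 p22]] := ex_below2 p10 (divr_gt0 q00 (ltr0Sn R 1)).
have [p3 [p30 p31 p32]] := ex_below2 p20 (divr_gt0 (@ltr01 R) (ltr0Sn R 1)).
exists p3, (Num.max 1 (- ln dl / cost (B + 1))).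
split => //; first by rewrite lt_max ltr01.
move=> p L /andP[pge0 pp3] hL pL.
have [l1 l2] : 1 <= ln L%:R :> R /\ - ln dl / cost (B + 1) <= ln L%:R.
  by move: hL; rewrite ge_max => /andP[].
have L0 : (0 < L)%N.
  by case: (L) l1 => //; rewrite ln0 // ler10.
have pS : rpos (big_square L) by split.
have [->|/negPf pn0] := eqVneq p 0; first by rewrite span_prob0 // ltW.
have {pn0}pgt0 : 0 < p by rewrite lt_def pn0 pge0.
have ple2 : p <= 1 / 2%:R by exact/ltW/(lt_le_trans pp3).
have p01 : 0 < p < 1 by rewrite pgt0 /=; move: ple2; clear; lra.
have [q [pq qgt0 pleq qle2 hinv]] := ln_rate pgt0 ple2.
have qlt : q < q0.
  apply: le_lt_trans qle2 _; rewrite mulrC -ltr_pdivlMr //.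
  by apply: lt_le_trans p22; exact: lt_le_trans p31.
have q1 : q <= 1 by apply: le_trans qle2 _; move: ple2; clear; lra.
have [K [K1 K2 K3]] := nat_above (le_trans ler01 B1) qgt0.
have Lpos : 0 < L%:R :> R by rewrite ltr0n.
(* [p] may be so small that the square does not reach the scale [B / q]. Its lines are then short,
   each costs at least [cost (B + 1)], and a large [L] suffices. *)
have [LK|KL] := leqP L K.
  have Lb : (minn (rw (big_square L)) (rh (big_square L)))%:R * q <= B + 1.
    rewrite /big_square /rw /rh /= minnn.
    by apply: (@le_trans _ _ B); [exact: K3|rewrite lerDl].
  have Lm : (L.-1.+1 <= maxn (rw (big_square L)) (rh (big_square L)))%N.
    by rewrite /big_square /rw /rh /= maxnn prednK.
  apply: le_trans (span_prob_short p01 pq qgt0 pS Lm Lb) _.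
  rewrite -[leRHS]lnK ?posrE // ler_expR lerNl -ler_pdivrMr //.
  apply: le_trans l2 _.
  have eL : 1 + L.-1%:R = L%:R :> R by rewrite addrC natr1 prednK.
  by rewrite -eL; apply: le_ln1Dx; apply: (@lt_le_trans _ _ 0).
have p01' : 0 <= p <= 1 by case/andP: p01 => /ltW -> /ltW ->.
apply: le_trans (square_spanned_rect p01' (expR_ge0 _) (fun Q pQ h1 h2 =>
  est p q K Q pgt0 ple2 pq qgt0 pleq qlt K1 K2 pQ h1 h2) KL) _.
have hK : (K.+1.*2)%:R <= 2%:R * (B + 1) / p :> R.
  apply: (@le_trans _ _ (2%:R * (B + 1) / q)).
    rewrite ler_pdivlMr // -mul2n natrM -mulrA; apply: ler_wpM2l => //.
    by apply: le_trans K2 _; rewrite lerD2l.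
  apply: ler_wpM2l; first by apply: mulr_ge0 => //; exact: ltW.
  by rewrite lef_pV2 ?posrE.
have e1 : e <= lambda.
  have : 0 < p * ln L%:R by apply: mulr_gt0 => //; apply: lt_le_trans l1.
  by move: pL; clear; lra.
have hl : ln L%:R <= (lambda - e) / p by rewrite ler_pdivlMr // mulrC.
(* The exponents [2 (lambda - e)] of the positions and [2 lambda - e] of the rectangle differ by
   [e]; the resulting [exp (- e / p)] beats the number of shapes, polynomial in [1 / p]. *)
have hexp : (L ^ 2)%:R * expR (- ((2%:R * lambda - e) / q)) <=
    expR (2%:R * lambda) / expR (e / p).
  have -> : (L ^ 2)%:R = expR (2%:R * ln L%:R) :> R by rewrite natrX expRM_natl lnK.
  rewrite -expRN -!expRD ler_expR.
  have h1 : (2%:R * lambda - e) * (p^-1 - 1) <= (2%:R * lambda - e) / q.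
    by apply: ler_wpM2l hinv; move: e1 lam0; clear; lra.
  by move: h1 hl e1 lam0 e0; move: (_ / q) (p^-1) => x y; clear; lra.
rewrite natrM mulrAC; apply: (@le_trans _ _ (expR (2%:R * lambda) / expR (e / p) *
  (2%:R * (B + 1) / p) ^+ 2)).
  apply: ler_pM => //.
  by rewrite natrX lerXn2r ?nnegrE // (le_trans _ hK).
have := hp1 p pgt0 (lt_le_trans pp3 (le_trans p31 p21)).
rewrite /C expr_div_n => h.
rewrite mulrAC ler_pdivrMr ?expR_gt0 //.
have {}h := ler_wpM2l (ltW dl0) h; apply: le_trans h.
rewrite le_eqVlt; apply/orP; left; apply/eqP; field.
by rewrite !lt0r_neq0.
Qed.
End Subcritical.

(** * The threshold *)

(** Some tail infimum already exceeds [l]. It cannot be infinite, as it lies below a real term and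
    above [l], so its distance to [l] serves as [e]. *)
Lemma limn_einf_gap (R : realType) (l : R) (u : nat -> R) :
  (l%:E < limn_einf (fun n => (u n)%:E))%E ->
  exists2 e, 0 < e & \forall n \near \oo, l + e <= u n.
Proof.
rewrite limn_einf_lim (cvg_lim _ (@cvg_einfs_sup _ _)) // => /ereal_sup_gt[_ [N _ <-]].
have inf_le n : (N <= n)%N -> (einfs (fun n => (u n)%:E) N <= (u n)%:E)%E.
  by move=> Nn; apply: ereal_inf_lbound; exists n.
move: inf_le; case: (einfs _ N) => [r| |] inf_le.
- rewrite lte_fin => lr; exists (r - l); first by rewrite subr_gt0.
  by exists N => // n /= Nn; rewrite addrC subrK -lee_fin inf_le.
- by move: (inf_le N (leqnn N)); rewrite leye_eq.
- by rewrite ltNge leNye.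
Qed.

Lemma limn_esup_gap (R : realType) (l : R) (u : nat -> R) :
  (limn_esup (fun n => (u n)%:E) < l%:E)%E ->
  exists2 e, 0 < e & \forall n \near \oo, u n <= l - e.
Proof.
move=> h; have [|e e0 he] := @limn_einf_gap R (- l) (fun n => - u n).
  by rewrite -[X in limn_einf X]/(-%E \o (fun n => (u n)%:E)) limn_einfN EFinN lteN2.
by exists e => //; apply: filterS he => n; rewrite lerNr opprD opprK.
Qed.

Lemma spanning_probabilityE (R : realType) (d : measure_display)
    (T : measurableType d) (P : probability T R) (X : T -> set site) (p : R) L :
  bernoulli_set P X p -> 0 <= p <= 1 ->
  spanning_probability P X L = (span_prob p (big_square L))%:E.
Proof.
move=> hX p01; rewrite /spanning_probability square_rset.
by rewrite (transfer hX (uniq_rsites _) (@dep_on_spanned (big_square L))).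
Qed.

Lemma ln_near_infty (R : realType) (L : nat -> nat) (A : R) : L @ \oo --> \oo ->
  \forall n \near \oo, A <= ln (L n)%:R.
Proof.
move=> /cvgnyPge /(_ (Num.truncn (expR A)).+1); apply: filterS => n hn.
have h : expR A <= (L n)%:R.
  by apply: le_trans (ltW (truncnS_gt (expR A))) _; rewrite ler_nat.
rewrite -[A]expRK ler_ln ?posrE ?expR_gt0 //.
exact: lt_le_trans (expR_gt0 A) h.
Qed.

Theorem theorem1 (R : realType) (d : measure_display) (T : measurableType d)
    (X : T -> set site) (P : R -> probability T R)
    (hP : forall p : R, 0 <= p <= 1 -> bernoulli_set (P p) X p)
    (L : nat -> nat) (p : nat -> R)
    (hL0 : forall n : nat, (0 < L n)%N)
    (hp01 : forall n : nat, 0 <= p n <= 1)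
    (hL : L @ \oo --> \oo)
    (hp : p @ \oo --> (0 : R)) :
  let lambda : R := pi ^+ 2 / 18%:R in
  ((lambda%:E < limn_einf (fun n : nat => (p n * ln (L n)%:R)%:E))%E ->
     (fun n : nat => spanning_probability (P (p n)) X (L n)) @ \oo
       --> (1%:E : \bar R))
  /\
  ((limn_esup (fun n : nat => (p n * ln (L n)%:R)%:E) < lambda%:E)%E ->
     (fun n : nat => spanning_probability (P (p n)) X (L n)) @ \oo
       --> (0%:E : \bar R)).
Proof.
move=> lam.
have -> : (fun n => spanning_probability (P (p n)) X (L n)) =
    (fun n => (span_prob (p n) (big_square (L n)))%:E).
  by apply/funext => n; rewrite (spanning_probabilityE _ (hP _ (hp01 n)) (hp01 n)).
have sp01 n : 0 <= span_prob (p n) (big_square (L n)) <= 1.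
  by rewrite Pr_ge0 ?Pr_le1.
have psmall (p0 : R) : 0 < p0 -> \forall n \near \oo, p n < p0.
  move=> p00; move/cvgrPdist_lt: hp => /(_ _ p00); apply: filterS => n.
  by rewrite sub0r normrN ger0_norm //; case/andP: (hp01 n).
split=> [/limn_einf_gap[e e0 he]|/limn_esup_gap[e e0 he]].
- have [p0 [K [l0 [p00 K0 l00 H]]]] := supercritical_bound e0.
  apply: cvg_EFin; first exact: nearW.
  apply/cvgrPdist_le => dl dl0; near=> n.
  have lK : K / dl <= ln (L n)%:R by near: n; exact: ln_near_infty.
  have ln0 : 0 < ln (L n)%:R :> R by apply: lt_le_trans lK; rewrite divr_gt0.
  have pl : lambda + e <= p n * ln (L n)%:R by near: n.
  (* Positivity is forced by [p n * ln (L n) > 0]; in the other half of the theorem [p n = 0] may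
     occur and is covered by [subcritical_bound]. *)
  have pn0 : 0 < p n.
    have : 0 < p n * ln (L n)%:R.
      by apply: lt_le_trans pl; rewrite addr_gt0 ?lambda_gt0.
    by rewrite pmulr_lgt0.
  have pp : 0 < p n < p0 by rewrite pn0 /=; near: n; exact: psmall.
  have ll : l0 <= ln (L n)%:R by near: n; exact: ln_near_infty.
  have h := H _ _ pp ll pl; have /andP[s0 s1] := sp01 n.
  rewrite /= ger0_norm ?subr_ge0 // lerBlDr -lerBlDl; apply: le_trans h.
  by rewrite lerD2l lerN2 ler_pdivrMr // mulrC -ler_pdivrMr.
- apply: cvg_EFin; first exact: nearW.
  apply/cvgrPdist_le => dl dl0.
  have [p0 [l0 [p00 l00 H]]] := subcritical_bound e0 dl0.
  near=> n; have /andP[s0 s1] := sp01 n; have /andP[pn0 _] := hp01 n.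
  rewrite /= sub0r normrN ger0_norm //; apply: H.
  + by rewrite pn0 /=; near: n; exact: psmall.
  + by near: n; exact: ln_near_infty.
  + by near: n.
Unshelve. all: by end_near.
Qed.
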